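(* Let $n \geq 2$ and suppose $f \colon \mathbb{B}_n \to \mathbb{B}_N$ is a proper holomorphic map such that $k_f = N-1$ and $f(rS^{2n-1}) \subset RS^{2N-1}$ for some $r,R \in (0,1)$. Then there exist a unitary map $U$ and an integer $d$ such that $f = U H_d$.
   Context: $\mathbb{B}_n\subset\mathbb{C}^n$ is the open unit ball, $S^{2n-1}=\partial\mathbb{B}_n$ the unit sphere, and $rS^{2n-1}$ the sphere of radius $r$ centered at the origin. For a map $f \colon U \subset \mathbb{C}^n \to \mathbb{C}^N$, the general hyperplane rank is $$k_f = \max\{ \dim \operatorname{aff}(f(H \cap U)) : H \subset \mathbb{C}^n \text{ an affine hyperplane}\},$$ where $\operatorname{aff}(X)$ is the smallest complex affine subspace of $\mathbb{C}^N$ containing $X$ and dimensions are complex. For an integer $d\ge 1$, $H_d \colon \mathbb{C}^n \to \mathbb{C}^{\binom{n+d-1}{d}}$ is the symmetrized homogeneous map of degree $d$ whose components are $\sqrt{\tfrac{d!}{\alpha!}}\, z^\alpha$ over all multi-indices $\alpha$ with $|\alpha|=d$, so that $\|H_d(z)\|^2=\|z\|^{2d}$. In particular $N=\binom{n+d-1}{d}$ in the conclusion. *)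

(* Defs.v *)
From HB Require Import structures.
From mathcomp Require Import all_boot all_order all_algebra.
From mathcomp Require Import complex.
From mathcomp Require Import all_classical all_reals all_analysis.

Set Implicit Arguments.
Unset Strict Implicit.
Unset Printing Implicit Defensive.

Import Order.TTheory GRing.Theory Num.Theory.
Import numFieldNormedType.Exports.

Local Open Scope classical_set_scope.
Local Open Scope ring_scope.
Local Open Scope complex_scope.

(* [R[i]] gets the norm topology that the library puts on [K^o] for every
   numFieldType [K]; ['cV[R[i]]_n] then carries the product topology. *)
HB.instance Definition _ (R : realType) := NormedModule.copy R[i] (R[i])^o.

Section Geometry.
Variable R : realType.
Local Notation C := R[i].

Definition enorm n (z : 'cV[C]_n) : C := sqrtC (\sum_(i < n) `|z i 0| ^+ 2).

Definition unit_ball n : set 'cV[C]_n := [set z | enorm z < 1].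

Definition sphere n (r : R) : set 'cV[C]_n := [set z | enorm z = r%:C].

(* Differentiability is Frechet differentiability over the field [R[i]], so on
   an open set it is complex differentiability. *)
Definition holomorphic_on n m (A : set 'cV[C]_n) (f : 'cV[C]_n -> 'cV[C]_m) :=
  forall z, A z -> differentiable f z.

Definition proper_on n m (A : set 'cV[C]_n) (B : set 'cV[C]_m)
    (f : 'cV[C]_n -> 'cV[C]_m) :=
  f @` A `<=` B /\
  forall K, compact K -> K `<=` B -> compact (A `&` f @^-1` K).

(* Affine subspaces are nonempty: the empty set has no dimension. *)
Definition affine_dim n (A : set 'cV[C]_n) (k : nat) :=
  exists (p : 'cV[C]_n) (V : {vspace 'cV[C]_n}),
    \dim V = k /\ A = [set z | z - p \in V].

Definition affine_subspace n (A : set 'cV[C]_n) := exists k, affine_dim A k.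

Definition aff n (X : set 'cV[C]_n) : set 'cV[C]_n :=
  \bigcap_(A in [set A | affine_subspace A /\ X `<=` A]) A.

Definition affine_hyperplane n (H : set 'cV[C]_n) :=
  exists2 k, affine_dim H k & k.+1 = n.

Definition hyperplane_image_dim n m (A : set 'cV[C]_n)
    (f : 'cV[C]_n -> 'cV[C]_m) : set nat :=
  [set k | exists2 H, affine_hyperplane H & affine_dim (aff (f @` (H `&` A))) k].

Definition hyperplane_rank n m (A : set 'cV[C]_n) (f : 'cV[C]_n -> 'cV[C]_m)
    (k : nat) :=
  hyperplane_image_dim A f k /\
  forall j, hyperplane_image_dim A f j -> (j <= k)%N.

End Geometry.

Arguments unit_ball {R n}.
Arguments sphere {R n} r.

Definition multi_indices (n d : nat) : {set n.-tuple 'I_d.+1} :=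
  [set t : n.-tuple 'I_d.+1 | (\sum_(i <- t) i == d)%N].

Lemma card_multi_indices n d : #|multi_indices n d| = 'C(n + d - 1, d).
Proof.
case: n => [|n]; last first.
  rewrite /multi_indices card_ord_partitions addSn subn1 /=.
  by rewrite -bin_sub ?leq_addr// addKn.
case: d => [|d].
  rewrite bin0; apply/eqP/cards1P; exists [tuple].
  by apply/setP => t; rewrite [t]tuple0 !inE big_nil.
rewrite add0n subn1 /= bin_small//; apply/eqP; rewrite cards_eq0.
by apply/eqP/setP => t; rewrite [t]tuple0 !inE big_nil.
Qed.

(* The order of the components of the map below is that of [enum]; it only
   matters up to a permutation matrix. *)
Definition multi_index n d (j : 'I_('C(n + d - 1, d))) : n.-tuple 'I_d.+1 :=
  enum_val (cast_ord (esym (card_multi_indices n d)) j).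

Definition Hmap (R : realType) n d (z : 'cV[R[i]]_n) :
    'cV[R[i]]_('C(n + d - 1, d)) :=
  \col_j let a := multi_index j in
    sqrtC ((d`!)%:R / (\prod_(i < n) (tnth a i)`!)%:R)
    * \prod_(i < n) z i 0 ^+ tnth a i.

(* Main.v *)
(* Polarizing [|f z| = rho] on the sphere of radius [r] gives
   [<f z, f w> = rho^2] whenever [z] and [w] in the ball satisfy [<z, w> = r^2].
   Since some hyperplane has an image of affine dimension [N - 1], for generic
   [w] these linear equations determine [f w]; they make sense for [w] slightly
   outside the ball, so Cramer's rule extends [f] across a boundary point.
   Properness makes the extension [F] map the unit sphere to the unit sphere,
   and polarizing again gives [<F z, F w> = 1] for [<z, w> = 1] near that point.
   For [<z, w> = 1] the vectors [rho^2 F w] and [f (r^2 w)] therefore have the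
   same products with [f z], so they coincide and [f (r^2 w) = rho^2 f w] on the
   ball.  Comparing expansions along lines, [f] is homogeneous of some degree
   [d] with [rho = r^d].  Then [<f z, f w> = <z, w>^d = <H_d z, H_d w>], and two
   maps with the same products differ by an isometry of the spans of their
   images, which are the whole spaces. *)

Require Import Defs.
From HB Require Import structures.
From mathcomp Require Import all_boot all_order all_algebra.
From mathcomp Require Import complex.
From mathcomp Require Import all_classical all_reals all_analysis.
From mathcomp Require Import ring lra.

Set Implicit Arguments.
Unset Strict Implicit.
Unset Printing Implicit Defensive.

Import Order.TTheory GRing.Theory Num.Theory.
Import numFieldNormedType.Exports.

Local Open Scope classical_set_scope.
Local Open Scope ring_scope.
Local Open Scope complex_scope.

(** Holomorphy is plain complex differentiability at each point, so the identity theorem is built up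
    from Goursat's lemma. It is only ever used in one complex variable: each step is arranged so
    that zeros accumulating at one end of a segment reach the other end.

    The obstacle is a mismatch of spans. The rank hypothesis makes the vectors [f z - b] span for
    [z] on one hyperplane [dot z e = c0] and a suitable base point [b], while Cramer's rule wants
    the vectors [f z] themselves to span, on a hyperplane [dot z w = r ^+ 2] with [w] on the unit
    sphere. Both kinds of span agree when the pole [w] lies in the ball: all values then satisfy the
    inhomogeneous equation [dot (f z) (f w) = rho ^+ 2], so their affine hull misses the origin.
    Among the parallel hyperplanes [dot z e = c] this covers [|c| > r ^+ 2]. Determinants of values
    depend holomorphically on [c], which carries the independence to generic [c] in any set with a
    cluster point in the unit disc. It is needed on [|c| = r ^+ 2], and again for [|c|] slightly
    below [1], where [dot z w = 1] has its pole [w] just outside the ball. *)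

(** * Differentiability of algebraic expressions and determinants *)

Section DiffToolkit.
Variables (K : numFieldType) (V : normedModType K).
Implicit Types (f g : V -> K) (x : V).

Lemma diffable_add f g x : differentiable f x -> differentiable g x ->
  differentiable (fun y => f y + g y) x.
Proof. exact: differentiableD. Qed.

Lemma diffable_sub f g x : differentiable f x -> differentiable g x ->
  differentiable (fun y => f y - g y) x.
Proof. exact: differentiableB. Qed.

Lemma diffable_mul f g x : differentiable f x -> differentiable g x ->
  differentiable (fun y => f y * g y) x.
Proof. exact: differentiableM. Qed.

Lemma diffable_cst (a : K) x : differentiable (fun=> a) x.
Proof. exact: differentiable_cst. Qed.

Lemma diffable_inv f x : differentiable f x -> f x != 0 -> differentiable (fun y => (f y)^-1) x.
Proof. exact: differentiableV. Qed.

Lemma diffable_exp f n x : differentiable f x -> differentiable (fun y => f y ^+ n) x.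
Proof.
move=> df; elim: n => [|n ih]; first exact: diffable_cst.
by under eq_fun do rewrite exprS; exact: diffable_mul.
Qed.

Lemma diffable_sum (I : Type) (r : seq I) (P : pred I) (F : I -> V -> K) x :
  (forall i, P i -> differentiable (F i) x) ->
  differentiable (fun y => \sum_(i <- r | P i) F i y) x.
Proof.
move=> dF; elim: r => [|i r ih].
  by under eq_fun do rewrite big_nil; exact: diffable_cst.
under eq_fun do rewrite big_cons; case Pi: (P i) => //.
by apply: diffable_add => //; exact: dF.
Qed.

Lemma diffable_prod (I : Type) (r : seq I) (P : pred I) (F : I -> V -> K) x :
  (forall i, P i -> differentiable (F i) x) ->
  differentiable (fun y => \prod_(i <- r | P i) F i y) x.
Proof.
move=> dF; elim: r => [|i r ih].
  by under eq_fun do rewrite big_nil; exact: diffable_cst.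
under eq_fun do rewrite big_cons; case Pi: (P i) => //.
by apply: diffable_mul => //; exact: dF.
Qed.

Lemma diffable_det m (A : V -> 'M[K]_m) x :
  (forall i j, differentiable (fun y => A y i j) x) ->
  differentiable (fun y => \det (A y)) x.
Proof.
move=> dA; apply: diffable_sum => s _; apply: diffable_mul; first exact: diffable_cst.
by apply: diffable_prod.
Qed.
End DiffToolkit.

(** * Contour integrals over rectangles *)

Section ComplexIntegral.
Variable R : realType.
Local Notation C := R[i].
Local Notation mu := (@lebesgue_measure R).
Implicit Types (a b x y M : R) (f g : R -> C) (z w : C).

Lemma normCRe z : `|z| = (complex.Re `|z|)%:C.
Proof. by rewrite normc_def. Qed.

Lemma ReiM z : complex.Re (- ('i * z)) = complex.Im z.
Proof. by case: z => a b /=; rewrite mul0r mul1r sub0r opprK. Qed.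

Lemma normc_ge_Im z : `|complex.Im z|%:C <= `|z|.
Proof.
rewrite -ReiM (le_trans (normc_ge_Re _))// normrN normrM [`|'i|]normc_def/=.
by rewrite expr0n/= expr1n add0r sqrtr1 mul1r.
Qed.

Lemma nonexpansive_continuous (h : C -> R) : {morph h : z w / z - w} ->
  (forall z, `|h z|%:C <= `|z|) -> continuous h.
Proof.
move=> hB hz z; apply/(@cvgrPdist_lt R R C (nbhs z)) => e e0; near=> w.
have : `|z - w| < e%:C.
  by near: w; apply: (@cvgr_dist_lt C C C (nbhs z)); [exact: cvg_id|rewrite ltcR].
by rewrite -ltcR -hB; apply: le_lt_trans.
Unshelve. all: by end_near. Qed.

Lemma continuous_Re : continuous (@complex.Re R : C -> R).
Proof. by apply: (@nonexpansive_continuous (@complex.Re R)) => [[? ?] []|]//; exact: normc_ge_Re. Qed.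

Lemma continuous_Im : continuous (@complex.Im R : C -> R).
Proof. by apply: (@nonexpansive_continuous (@complex.Im R)) => [[? ?] []|]//; exact: normc_ge_Im. Qed.

Lemma normc_le_ReIm z : `|z| <= (`|complex.Re z| + `|complex.Im z|)%:C.
Proof.
rewrite {1}[z]complexE (le_trans (ler_normD _ _))// normrM.
rewrite rmorphD lerD// !normc_def/= !expr0n/= ?addr0 ?add0r ?sqrtr_sqr//.
by rewrite normr1 mul1r.
Qed.

Lemma continuous_complex (f g : R -> R) x :
  {for x, continuous f} -> {for x, continuous g} ->
  {for x, continuous (fun x => f x +i* g x : C)}.
Proof.
move=> cf cg; apply/cvgrPdist_lt => e e0.
have e0' : 0 < complex.Re e / 2 by move: e0; rewrite ltcE/= => /andP[_ /divr_gt0]; apply.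
have eE : e = (complex.Re e)%:C by move: e0; case: (e) => ? ?; rewrite ltcE/= => /andP[/eqP -> _].
near=> y; apply: (le_lt_trans (normc_le_ReIm _)) => /=; rewrite eE ltcR.
rewrite [ltRHS]splitr ltrD//; near: y.
  exact: (@cvgr_dist_lt _ _ _ (nbhs x) _ _ _ cf).
exact: (@cvgr_dist_lt _ _ _ (nbhs x) _ _ _ cg).
Unshelve. all: by end_near. Qed.

Definition cint a b g : C :=
  (\int[mu]_(x in `[a, b]) complex.Re (g x)) +i*
  (\int[mu]_(x in `[a, b]) complex.Im (g x)).

(** Continuity in the whole line at each point of the segment, not continuity within the segment:
    the property passes to subsegments and to [Re] and [Im] of the integrand without change. *)
Definition cts a b g := forall x, a <= x <= b -> {for x, continuous g}.

Lemma within_cts a b (h : C -> R) g : continuous h -> cts a b g ->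
  {within `[a, b], continuous (h \o g)}.
Proof.
move=> ch cg; apply: continuous_in_subspaceT => x; rewrite inE/= in_itv/= => xab.
by apply: continuous_comp; [exact: cg|exact: ch].
Qed.

Lemma integrable_cts a b (h : C -> R) g : continuous h -> cts a b g ->
  mu.-integrable `[a, b] (EFin \o (h \o g)).
Proof.
move=> ch cg; apply: continuous_compact_integrable.
  exact: segment_compact.
exact: within_cts.
Qed.

Lemma cintD a b f g : cts a b f -> cts a b g ->
  cint a b (fun x => f x + g x) = cint a b f + cint a b g.
Proof.
move=> cf cg; rewrite /cint; apply/eqP; rewrite eq_complex /=; apply/andP; split.
  rewrite -RintegralD//; try exact: (integrable_cts continuous_Re).
  by apply/eqP; apply: eq_Rintegral => x _; case: (f x) (g x) => ? ? [].
rewrite -RintegralD//; try exact: (integrable_cts continuous_Im).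
by apply/eqP; apply: eq_Rintegral => x _; case: (f x) (g x) => ? ? [].
Qed.

Lemma cintZ a b z f : cts a b f -> cint a b (fun x => z * f x) = z * cint a b f.
Proof.
move=> cf; rewrite /cint; case: z => u v.
have h1 := integrable_cts continuous_Re cf; have h2 := integrable_cts continuous_Im cf.
apply/eqP; rewrite eq_complex /=; apply/andP; split.
  rewrite -!RintegralZl// -RintegralB//; first last.
  - by have := @integrableZl _ _ _ mu `[a, b] (measurable_itv _) v _ h2.
  - by have := @integrableZl _ _ _ mu `[a, b] (measurable_itv _) u _ h1.
  by apply/eqP; apply: eq_Rintegral => x _; case: (f x).
rewrite -!RintegralZl// -RintegralD//; first last.
- by have := @integrableZl _ _ _ mu `[a, b] (measurable_itv _) v _ h1.
- by have := @integrableZl _ _ _ mu `[a, b] (measurable_itv _) u _ h2.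
by apply/eqP; apply: eq_Rintegral => x _; case: (f x).
Qed.

Lemma eq_cint a b f g : (forall x, a <= x <= b -> f x = g x) ->
  cint a b f = cint a b g.
Proof.
by move=> fg; rewrite /cint; congr (_ +i* _); apply: eq_Rintegral => x;
  rewrite inE/= in_itv/= => /fg ->.
Qed.

Lemma cint_cat b a c f : a <= b -> b <= c -> cts a c f ->
  cint a c f = cint a b f + cint b c f.
Proof.
move=> ab bc cf.
have H (h : C -> R) : continuous h -> \int[mu]_(x in `[a, c]) h (f x) =
    \int[mu]_(x in `[a, b]) h (f x) + \int[mu]_(x in `[b, c]) h (f x).
  move=> ch; have ih := integrable_cts ch cf.
  have := @Rintegral_itvB R _ (BLeft a) (BRight c) b ih.
  rewrite !bnd_simp => /(_ ab bc) /eqP; rewrite subr_eq => /eqP ->.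
  rewrite addrC; congr (_ + _); apply: Rintegral_itv_obnd_cbnd.
  apply: (integrableS _ _ _ ih) => //.
  by apply: subset_itv; rewrite !bnd_simp.
by rewrite /cint; apply/eqP; rewrite eq_complex/= !H ?eqxx//;
  [exact: continuous_Im|exact: continuous_Re].
Qed.

Lemma Rint_bound a b M (h : C -> R) f : a <= b -> continuous h -> cts a b f ->
  (forall x, a <= x <= b -> `|h (f x)| <= M) ->
  `|\int[mu]_(x in `[a, b]) h (f x)| <= M * (b - a).
Proof.
move=> ab ch cf fM; have ih := integrable_cts ch cf.
apply: (le_trans (le_normr_Rintegral _ ih)) => //.
have iM : mu.-integrable `[a, b] (EFin \o (fun=> M)).
  apply: continuous_compact_integrable; first exact: segment_compact.
  by apply: continuous_subspaceT => x; exact: cvg_cst.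
have -> : M * (b - a) = \int[mu]_(x in `[a, b]) M.
  rewrite Rintegral_cst; last exact: measurable_itv.
  rewrite [X in fine X]lebesgue_measure_itv/= lte_fin.
  by move: (ab); rewrite le_eqVlt => /predU1P[->|->]; rewrite ?ltxx ?subrr ?mulr0.
apply: (@le_Rintegral _ _ R mu) => //.
exact: (integrable_norm ih).
Qed.

(** The factor [2] comes from bounding the real and imaginary parts separately; no later estimate
    depends on a sharp constant. *)
Lemma cint_bound a b M f : a <= b -> cts a b f ->
  (forall x, a <= x <= b -> `|f x| <= M%:C) ->
  `|cint a b f| <= (2 * M * (b - a))%:C.
Proof.
move=> ab cf fM; apply: (le_trans (normc_le_ReIm _)); rewrite lecR/=.
rewrite -mulrA mulr_natl mulr2n lerD//; apply: Rint_bound => //;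
  try exact: continuous_Re; try exact: continuous_Im; move=> x xab; rewrite -lecR.
  by apply: le_trans (fM x xab); exact: normc_ge_Re.
by apply: le_trans (fM x xab); exact: normc_ge_Im.
Qed.

Lemma Rint_id a b : a <= b -> \int[mu]_(x in `[a, b]) x = (b ^+ 2 - a ^+ 2) / 2.
Proof.
rewrite le_eqVlt => /predU1P[->|ab].
  by rewrite subrr mul0r set_itv1 Rintegral_set1.
rewrite /Rintegral (@continuous_FTC2 _ id (fun x => x ^+ 2 / 2)).
- by rewrite -EFinB/= -mulrBl.
- exact: ab.
- by apply: continuous_subspaceT => x; exact: cvg_id.
- split.
  + by move=> x _; apply: derivableM => //; apply: derivableX.
  + by apply: cvg_at_right_filter; apply: cvgM; [exact: exprn_continuous|exact: cvg_cst].
  + by apply: cvg_at_left_filter; apply: cvgM; [exact: exprn_continuous|exact: cvg_cst].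
- move=> x _; rewrite derive1Mr// derive1E exp_derive/=.
  by rewrite expr1 /GRing.scale/= mulr1; field.
Qed.

End ComplexIntegral.

(** * Goursat's lemma *)

Section Goursat.
Variable R : realType.
Local Notation C := R[i].
Implicit Types (a b x y M u v : R) (f g : C -> C) (z w : C).

(** The counterclockwise contour integral: bottom, right, top, left, with the factor ['i] coming
    from [dz] on the vertical sides. *)
Definition bdry x0 x1 y0 y1 f : C :=
  cint x0 x1 (fun x => f (x +i* y0)) + 'i * cint y0 y1 (fun y => f (x1 +i* y))
  - cint x0 x1 (fun x => f (x +i* y1)) - 'i * cint y0 y1 (fun y => f (x0 +i* y)).

Definition in_rect x0 x1 y0 y1 z :=
  [&& x0 <= complex.Re z, complex.Re z <= x1, y0 <= complex.Im z & complex.Im z <= y1].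

Definition on_bdry x0 x1 y0 y1 z := in_rect x0 x1 y0 y1 z &&
  [|| complex.Re z == x0, complex.Re z == x1, complex.Im z == y0 | complex.Im z == y1].

Definition cont_bdry x0 x1 y0 y1 f :=
  forall z, on_bdry x0 x1 y0 y1 z -> {for z, continuous f}.

Definition cont_rect x0 x1 y0 y1 f :=
  forall z, in_rect x0 x1 y0 y1 z -> {for z, continuous f}.

Lemma continuous_hor y x : {for x, continuous (fun x => x +i* y : C)}.
Proof. by apply: continuous_complex; [exact: cvg_id|exact: cvg_cst]. Qed.

Lemma continuous_ver x y : {for y, continuous (fun y => x +i* y : C)}.
Proof. by apply: continuous_complex; [exact: cvg_cst|exact: cvg_id]. Qed.

Lemma cont_rect_bdry x0 x1 y0 y1 f : cont_rect x0 x1 y0 y1 f -> cont_bdry x0 x1 y0 y1 f.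
Proof. by move=> cf z /andP[/cf]. Qed.

Lemma cts_hor x0 x1 y0 y1 y f : cont_bdry x0 x1 y0 y1 f -> y0 <= y1 -> (y == y0) || (y == y1) ->
  cts x0 x1 (fun x => f (x +i* y)).
Proof.
move=> cf y01 yE x /andP[h3 h4].
apply: (@continuous_comp R C C (fun x => x +i* y) f); first exact: continuous_hor.
apply: cf; rewrite /on_bdry/= yE !orbT andbT; apply/and4P; split=> //=.
  by case/orP: yE => /eqP ->.
by case/orP: yE => /eqP ->.
Qed.

Lemma cts_ver x0 x1 y0 y1 x f : cont_bdry x0 x1 y0 y1 f -> x0 <= x1 -> (x == x0) || (x == x1) ->
  cts y0 y1 (fun y => f (x +i* y)).
Proof.
move=> cf x01 xE y /andP[h3 h4].
apply: (@continuous_comp R C C (fun y => x +i* y) f); first exact: continuous_ver.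
apply: cf; rewrite /on_bdry/= orbA xE andbT; apply/and4P; split=> //=.
  by case/orP: xE => /eqP ->.
by case/orP: xE => /eqP ->.
Qed.

Lemma sub_rect x0 x1 y0 y1 x0' x1' y0' y1' z :
  x0 <= x0' -> x1' <= x1 -> y0 <= y0' -> y1' <= y1 ->
  in_rect x0' x1' y0' y1' z -> in_rect x0 x1 y0 y1 z.
Proof. by move=> ? ? ? ? /and4P[? ? ? ?]; apply/and4P; split; lra. Qed.

Lemma bdry_catx x1 x0 x2 y0 y1 f : x0 <= x1 -> x1 <= x2 -> y0 <= y1 ->
  cont_rect x0 x2 y0 y1 f ->
  bdry x0 x2 y0 y1 f = bdry x0 x1 y0 y1 f + bdry x1 x2 y0 y1 f.
Proof.
move=> x01 x12 y01 cf; rewrite /bdry.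
rewrite !(@cint_cat R x1 x0 x2)//; first by ring.
- by apply: (cts_hor (cont_rect_bdry cf)); rewrite ?eqxx ?orbT.
- by apply: (cts_hor (cont_rect_bdry cf)); rewrite ?eqxx ?orbT.
Qed.

Lemma bdry_caty y1 x0 x1 y0 y2 f : x0 <= x1 -> y0 <= y1 -> y1 <= y2 ->
  cont_rect x0 x1 y0 y2 f ->
  bdry x0 x1 y0 y2 f = bdry x0 x1 y0 y1 f + bdry x0 x1 y1 y2 f.
Proof.
move=> x01 y01 y12 cf; rewrite /bdry.
rewrite !(@cint_cat R y1 y0 y2)//; first by ring.
- by apply: (cts_ver (cont_rect_bdry cf)); rewrite ?eqxx ?orbT.
- by apply: (cts_ver (cont_rect_bdry cf)); rewrite ?eqxx ?orbT.
Qed.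

Lemma bdryD x0 x1 y0 y1 f g : x0 <= x1 -> y0 <= y1 ->
  cont_bdry x0 x1 y0 y1 f -> cont_bdry x0 x1 y0 y1 g ->
  bdry x0 x1 y0 y1 (fun z => f z + g z) = bdry x0 x1 y0 y1 f + bdry x0 x1 y0 y1 g.
Proof.
move=> x01 y01 cf cg; rewrite /bdry !cintD; first by ring.
all: by [apply: (cts_hor cf); rewrite ?eqxx ?orbT|apply: (cts_ver cf); rewrite ?eqxx ?orbT
  |apply: (cts_hor cg); rewrite ?eqxx ?orbT|apply: (cts_ver cg); rewrite ?eqxx ?orbT].
Qed.

Lemma bdryZ x0 x1 y0 y1 z f : x0 <= x1 -> y0 <= y1 ->
  cont_bdry x0 x1 y0 y1 f ->
  bdry x0 x1 y0 y1 (fun w => z * f w) = z * bdry x0 x1 y0 y1 f.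
Proof.
move=> x01 y01 cf; rewrite /bdry !cintZ; first by ring.
all: by [apply: (cts_hor cf); rewrite ?eqxx ?orbT|apply: (cts_ver cf); rewrite ?eqxx ?orbT].
Qed.

Lemma eq_bdry x0 x1 y0 y1 f g : x0 <= x1 -> y0 <= y1 ->
  (forall z, on_bdry x0 x1 y0 y1 z -> f z = g z) ->
  bdry x0 x1 y0 y1 f = bdry x0 x1 y0 y1 g.
Proof.
move=> x01 y01 fg; rewrite /bdry.
by congr (_ + _ * _ - _ - _ * _); apply: eq_cint => t /andP[? ?]; apply: fg; apply/andP; (split; first by apply/and4P; split=> //=); rewrite /= eqxx ?orbT.
Qed.

Lemma Rint_cst a b x : a <= b ->
  \int[@lebesgue_measure R]_(t in `[a, b]) x = x * (b - a).
Proof.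
move=> ab; rewrite Rintegral_cst; last exact: measurable_itv.
rewrite [X in fine X]lebesgue_measure_itv/= lte_fin.
by move: (ab); rewrite le_eqVlt => /predU1P[->|->]; rewrite ?ltxx ?subrr ?mulr0.
Qed.

Lemma cint_hor a b y : a <= b ->
  cint a b (fun x => x +i* y) = ((b ^+ 2 - a ^+ 2) / 2) +i* (y * (b - a)).
Proof. by move=> ab; rewrite /cint/= Rint_id// Rint_cst. Qed.

Lemma cint_ver a b x : a <= b ->
  cint a b (fun y => x +i* y) = (x * (b - a)) +i* ((b ^+ 2 - a ^+ 2) / 2).
Proof. by move=> ab; rewrite /cint/= Rint_id// Rint_cst. Qed.

Lemma cint_cst a b z : a <= b -> cint a b (fun=> z) = z * (b - a)%:C.
Proof.
by case: z => u v ab; rewrite /cint/= !Rint_cst//; apply/eqP; rewrite eq_complex/= !mulr0 subr0 add0r !eqxx.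
Qed.

Lemma bdry_affine x0 x1 y0 y1 (p q : C) : x0 <= x1 -> y0 <= y1 ->
  bdry x0 x1 y0 y1 (fun z => p + q * z) = 0.
Proof.
move=> x01 y01.
rewrite bdryD//; last 2 first.
- by move=> z _; exact: (@cst_continuous C C).
- by move=> z _; apply: (@continuousM C C); [exact: (@cst_continuous C C)|exact: cvg_id].
rewrite bdryZ//; last by move=> z _; exact: cvg_id.
rewrite /bdry !cint_cst// !cint_hor// !cint_ver//.
rewrite [X in X + _](_ : _ = 0) ?add0r; last by ring.
rewrite [X in _ * X](_ : _ = 0) ?mulr0//.
by apply/eqP; rewrite eq_complex/=; apply/andP; split; apply/eqP; field.
Qed.

Lemma norm_im : `|'i : C| = 1.
Proof. by rewrite normc_def/= expr0n/= expr1n add0r sqrtr1. Qed.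

Lemma bdry_bound x0 x1 y0 y1 M f : x0 <= x1 -> y0 <= y1 ->
  cont_bdry x0 x1 y0 y1 f ->
  (forall z, on_bdry x0 x1 y0 y1 z -> `|f z| <= M%:C) ->
  `|bdry x0 x1 y0 y1 f| <= (4 * M * ((x1 - x0) + (y1 - y0)))%:C.
Proof.
move=> x01 y01 cf fM.
have -> : 4 * M * ((x1 - x0) + (y1 - y0)) = 2 * M * (x1 - x0) + 2 * M * (y1 - y0)
  + 2 * M * (x1 - x0) + 2 * M * (y1 - y0) by ring.
rewrite /bdry !rmorphD; apply: (le_trans (ler_normD _ _)); apply: lerD.
  apply: (le_trans (ler_normD _ _)); apply: lerD.
    apply: (le_trans (ler_normD _ _)); apply: lerD.
all: rewrite ?normrN ?normrM ?norm_im ?mul1r; apply: cint_bound => //.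
all: try by [apply: (cts_hor cf); rewrite ?eqxx ?orbT|apply: (cts_ver cf); rewrite ?eqxx ?orbT].
all: by move=> t /andP[? ?]; apply: fM; apply/andP; split; [apply/and4P; split|rewrite /= eqxx ?orbT].
Qed.

(** Nested rectangles given by their lower left corners, with sides [u / 2 ^+ k] and [v / 2 ^+ k] at
    level [k]. The corners increase and the opposite corners decrease, so the suprema of the corner
    coordinates give a common point. *)
Lemma bisection (P : nat -> R -> R -> Prop) a b u v : 0 <= u -> 0 <= v -> P 0%N a b ->
  (forall k a b, P k a b -> exists a' b', [/\ P k.+1 a' b',
     a <= a', a' + u / 2 ^+ k.+1 <= a + u / 2 ^+ k,
     b <= b' & b' + v / 2 ^+ k.+1 <= b + v / 2 ^+ k]) ->
  exists x y, forall k, exists a b, [/\ P k a b, a <= x <= a + u / 2 ^+ k & b <= y <= b + v / 2 ^+ k].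
Proof.
move=> u0 v0 P0 step.
(* Choice wants a total successor map, so the state records its level and [P] becomes a premise; a
   state violating [P] is sent to itself. *)
have /choice[nx nxP] : forall t : nat * (R * R), exists t' : nat * (R * R),
    P t.1 t.2.1 t.2.2 -> [/\ t'.1 = t.1.+1, P t'.1 t'.2.1 t'.2.2,
     t.2.1 <= t'.2.1, t'.2.1 + u / 2 ^+ t.1.+1 <= t.2.1 + u / 2 ^+ t.1 &
     (t.2.2 <= t'.2.2) /\ (t'.2.2 + v / 2 ^+ t.1.+1 <= t.2.2 + v / 2 ^+ t.1)].
  move=> [k [a' b']]; have [Pk|nP] := pselect (P k a' b'); last by exists (k, (a', b')).
  by have [a2 [b2 []]] := step _ _ _ Pk; exists (k.+1, (a2, b2)).
pose s k := iter k nx (0%N, (a, b)).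
have sP k : (s k).1 = k /\ P k (s k).2.1 (s k).2.2.
  elim: k => [//|k [e Pk]]; rewrite /s iterS -/(s k).
  by move: (nxP (s k)); rewrite e => /(_ Pk)[-> H _ _ _]; split.
have sS k : [/\ (s k).2.1 <= (s k.+1).2.1, (s k.+1).2.1 + u / 2 ^+ k.+1 <= (s k).2.1 + u / 2 ^+ k,
  (s k).2.2 <= (s k.+1).2.2 & (s k.+1).2.2 + v / 2 ^+ k.+1 <= (s k).2.2 + v / 2 ^+ k].
  have [e Pk] := sP k; rewrite /s iterS -/(s k).
  by move: (nxP (s k)); rewrite e => /(_ Pk)[_ _ ? ? []].
have key (c : nat -> R) (w : R) : 0 <= w -> (forall k, c k <= c k.+1) ->
    (forall k, c k.+1 + w / 2 ^+ k.+1 <= c k + w / 2 ^+ k) ->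
    exists x, forall k, c k <= x <= c k + w / 2 ^+ k.
  move=> w0 c1 c2.
  have wp k : 0 <= w / 2 ^+ k by rewrite divr_ge0// exprn_ge0.
  have up i j : c i <= c (i + j)%N.
    by elim: j => [|j]; rewrite ?addn0// addnS => /le_trans; apply.
  have dn i j : c (i + j)%N + w / 2 ^+ (i + j) <= c i + w / 2 ^+ i.
    by elim: j => [|j]; rewrite ?addn0// addnS; apply: le_trans.
  have ub i : ubound (range c) (c i + w / 2 ^+ i).
    move=> _ [j _ <-]; have [ij|/ltnW ji] := leqP i j.
      by have := dn i (j - i)%N; have := wp j; rewrite subnKC//; lra.
    by have := up j (i - j)%N; have := wp i; rewrite subnKC//; lra.
  exists (sup (range c)) => k; apply/andP; split.
    by apply: ub_le_sup; [exists (c 0%N + w / 2 ^+ 0); exact: ub|exists k].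
  by apply: ge_sup; [exists (c 0%N); exists 0%N|exact: ub].
have [x xP] := key (fun k => (s k).2.1) u u0 (fun k => let: And4 h _ _ _ := sS k in h)
  (fun k => let: And4 _ h _ _ := sS k in h).
have [y yP] := key (fun k => (s k).2.2) v v0 (fun k => let: And4 _ _ h _ := sS k in h)
  (fun k => let: And4 _ _ _ h := sS k in h).
by exists x, y => k; exists (s k).2.1, (s k).2.2; split=> //; case: (sP k).
Qed.

Lemma complex_gt0 (e : C) : 0 < e -> e = (complex.Re e)%:C /\ 0 < complex.Re e.
Proof. by case: e => a b; rewrite ltcE/= => /andP[/eqP -> ->]. Qed.

Lemma nbhs_complexP (z : C) (P : set C) : nbhs z P <->
  exists2 d : R, 0 < d & forall w, `|w - z| < d%:C -> P w.
Proof.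
split.
  move=> /nbhs_ballP[e /complex_gt0[-> e0] eP]; exists (complex.Re e) => // w wz.
  by apply: eP; rewrite -ball_normE/= distrC.
move=> [d d0 dP]; apply/nbhs_ballP; exists d%:C; first by rewrite /= ltcR.
by move=> w; rewrite -ball_normE/= distrC; exact: dP.
Qed.

Lemma derivable_eps f z : derivable f z 1 -> exists L, forall e, 0 < e ->
  exists2 d : R, 0 < d & forall w, `|w - z| < d%:C -> `|f w - f z - L * (w - z)| <= e%:C * `|w - z|.
Proof.
move=> /cvg_ex[/= L Lf]; exists L => e e0.
have e0' : 0 < e%:C :> C by rewrite ltcR.
have /(_ (dnbhs_filter _)) := @cvgr_dist_le C C C _ _ _ _ Lf _ e0'.
move=> /nbhs_complexP[d d0 dP]; exists d => // w wz.
have [->|wNz] := eqVneq w z; first by rewrite !subrr mulr0 subrr normr0 mulr0.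
have wz0 : w - z != 0 by rewrite subr_eq0.
have := dP (w - z); rewrite subr0 => /(_ wz wz0).
rewrite /= [_%:A]mulr1 subrK /GRing.scale/= -(ler_pM2r (x := `|w - z|)) ?normr_gt0//.
rewrite -normrM mulrBl mulrAC mulVf// mul1r [in X in X -> _]distrC.
by rewrite [leRHS]mulrC [leLHS]distrC mulrC distrC.
Qed.

Lemma derivable_continuous f z : derivable f z 1 -> {for z, continuous f}.
Proof. by move=> /derivable1_diffP/differentiable_continuous. Qed.

Lemma exists_expr2_gt x : exists k, x < 2 ^+ k.
Proof.
exists (Num.truncn x).+1; apply: lt_le_trans (truncnS_gt x) _.
by rewrite -natrX ler_nat ltnW// ltn_expl.
Qed.

Lemma sub_expr2S u k : u / 2 ^+ k = u / 2 ^+ k.+1 + u / 2 ^+ k.+1.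
Proof. by rewrite exprS; field; rewrite expf_neq0. Qed.

Lemma norm_sub_rect x0 x1 y0 y1 z w : in_rect x0 x1 y0 y1 z -> in_rect x0 x1 y0 y1 w ->
  `|w - z| <= ((x1 - x0) + (y1 - y0))%:C.
Proof.
case: z w => a b [a' b'] /and4P[/= ? ? ? ?] /and4P[/= ? ? ? ?].
apply: (le_trans (normc_le_ReIm _)); rewrite lecR lerD//= ler_norml; lra.
Qed.

Lemma bdry_quarter x0 x1 x2 y0 y1 y2 (m : R) f : x0 <= x1 -> x1 <= x2 -> y0 <= y1 -> y1 <= y2 ->
  cont_rect x0 x2 y0 y2 f -> (4 * m)%:C <= `|bdry x0 x2 y0 y2 f| ->
  [\/ m%:C <= `|bdry x0 x1 y0 y1 f|, m%:C <= `|bdry x0 x1 y1 y2 f|,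
      m%:C <= `|bdry x1 x2 y0 y1 f| | m%:C <= `|bdry x1 x2 y1 y2 f|].
Proof.
move=> x01 x12 y01 y12 cf.
have y02 : y0 <= y2 by apply: le_trans y12.
rewrite (@bdry_catx x1)//.
rewrite (@bdry_caty y1 x0)//; last by move=> z zr; apply: cf; apply: sub_rect zr.
rewrite (@bdry_caty y1 x1)//; last by move=> z zr; apply: cf; apply: sub_rect zr.
move: (bdry x0 x1 y0 y1 f) (bdry x0 x1 y1 y2 f) (bdry x1 x2 y0 y1 f) (bdry x1 x2 y1 y2 f).
move=> A B D E H.
have : `|A + B + (D + E)| <= `|A| + `|B| + (`|D| + `|E|).
  by rewrite (le_trans (ler_normD _ _))// lerD// ler_normD.
move=> /(le_trans H); rewrite (normCRe A) (normCRe B) (normCRe D) (normCRe E) -!rmorphD !lecR.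
move: (complex.Re _) (complex.Re _) (complex.Re _) (complex.Re _) => s r q p {}H.
have [|hA] := leP m p; first by constructor 1.
have [|hB] := leP m q; first by constructor 2.
have [|hD] := leP m r; first by constructor 3.
constructor 4; move: hA hB hD H; clear; lra.
Qed.

(** The affine part of [f] at [z] has contour integral zero. The remainder is at most [e] times the
    diameter, and the contour contributes a second factor of that size, so the bound is quadratic in
    the sides and can compete with the [4 ^+ k] lost by quartering. *)
Lemma bdry_local x0 x1 y0 y1 f z L e : 0 <= e -> in_rect x0 x1 y0 y1 z ->
  cont_rect x0 x1 y0 y1 f ->
  (forall w, in_rect x0 x1 y0 y1 w -> `|f w - f z - L * (w - z)| <= e%:C * `|w - z|) ->
  `|bdry x0 x1 y0 y1 f| <= (4 * e * ((x1 - x0) + (y1 - y0)) ^+ 2)%:C.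
Proof.
move=> e0 zr cf fL; have /and4P[h1 h2 h3 h4] := zr.
have x01 := le_trans h1 h2; have y01 := le_trans h3 h4.
have aff_c p q : cont_rect x0 x1 y0 y1 (fun w : C => p + q * w).
  move=> w _; apply: (@continuousD _ C C); first exact: (@cst_continuous C C).
  by apply: (@continuousM C C); [exact: (@cst_continuous C C)|exact: cvg_id].
pose r w := f w + ((L * z - f z) + - L * w).
have rE w : r w = f w - f z - L * (w - z) by rewrite /r; ring.
have /cont_rect_bdry cr : cont_rect x0 x1 y0 y1 r.
  by move=> w wr; apply: (@continuousD _ C C); [exact: cf|exact: aff_c].
have -> : bdry x0 x1 y0 y1 f = bdry x0 x1 y0 y1 r.
  by rewrite /r (bdryD x01 y01 (cont_rect_bdry cf) (cont_rect_bdry (aff_c _ _))) (bdry_affine _ _ x01 y01) addr0.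
rewrite exprS expr1 [X in X%:C](_ : _ = 4 * (e * ((x1 - x0) + (y1 - y0))) * ((x1 - x0) + (y1 - y0))); last by ring.
apply: bdry_bound => // w /andP[wr _]; rewrite rE (le_trans (fL w wr))// [X in _ <= X]rmorphM.
by apply: ler_wpM2l; [rewrite lecR|exact: norm_sub_rect].
Qed.

Theorem Goursat_rectangle x0 x1 y0 y1 f : x0 <= x1 -> y0 <= y1 ->
  (forall z, in_rect x0 x1 y0 y1 z -> derivable f z 1) -> bdry x0 x1 y0 y1 f = 0.
Proof.
move=> x01 y01 df.
have cf : cont_rect x0 x1 y0 y1 f by move=> z /df; exact: derivable_continuous.
apply/eqP; rewrite -normr_le0 normCRe; set m := complex.Re _.
have mE : `|bdry x0 x1 y0 y1 f| = m%:C by rewrite normCRe.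
rewrite lecR leNgt; apply/negP => m0.
pose u := x1 - x0; pose v := y1 - y0.
have u0 : 0 <= u by rewrite subr_ge0. have v0 : 0 <= v by rewrite subr_ge0.
have up k : 0 <= u / 2 ^+ k by rewrite divr_ge0// exprn_ge0.
have vp k : 0 <= v / 2 ^+ k by rewrite divr_ge0// exprn_ge0.
(* Some quarter always keeps at least a quarter of the integral, hence [m / 4 ^+ k] at level [k]. *)
pose P k a b := [/\ x0 <= a, a + u / 2 ^+ k <= x1, y0 <= b, b + v / 2 ^+ k <= y1 &
   (m / 4 ^+ k)%:C <= `|bdry a (a + u / 2 ^+ k) b (b + v / 2 ^+ k) f|].
have [||||x [y xy]] := @bisection P x0 y0 u v => //.
- rewrite /P !expr0 !divr1 /u /v !subrKC mE; split=> //.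
- move=> k a b [h1 h2 h3 h4 h5].
  set a1 := a + u / 2 ^+ k.+1; set b1 := b + v / 2 ^+ k.+1.
  have aE : a + u / 2 ^+ k = a1 + u / 2 ^+ k.+1 by rewrite /a1 -addrA -sub_expr2S.
  have bE : b + v / 2 ^+ k = b1 + v / 2 ^+ k.+1 by rewrite /b1 -addrA -sub_expr2S.
  have aa1 : a <= a1 by rewrite lerDl up.
  have bb1 : b <= b1 by rewrite lerDl vp.
  have aa2 : a1 <= a1 + u / 2 ^+ k.+1 by rewrite lerDl up.
  have bb2 : b1 <= b1 + v / 2 ^+ k.+1 by rewrite lerDl vp.
  rewrite aE bE in h5; rewrite aE in h2; rewrite bE in h4.
  rewrite (_ : m / 4 ^+ k = 4 * (m / 4 ^+ k.+1)) in h5; last first.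
    by rewrite exprS; field; rewrite expf_neq0.
  have [|H|H|H|H] := bdry_quarter aa1 aa2 bb1 bb2 _ h5.
  + by move=> z zr; apply: cf; apply: sub_rect zr.
  + exists a, b; rewrite aE bE -/a1 -/b1; split=> //; split=> //.
      exact: le_trans h2.
    exact: le_trans h4.
  + exists a, b1; rewrite aE bE -/a1; split=> //; split=> //; first exact: le_trans h2.
    exact: le_trans bb1.
  + exists a1, b; rewrite aE bE -/b1; split=> //; split=> //; last exact: le_trans h4.
    exact: le_trans aa1.
  + exists a1, b1; rewrite aE bE; split=> //; split=> //.
      exact: le_trans aa1.
    exact: le_trans bb1.
have z_in : in_rect x0 x1 y0 y1 (x +i* y).
  have [a [b [[h1 h2 h3 h4 _] xa yb]]] := xy 0%N.
  by apply/and4P; split=> /=; move: h1 h2 h3 h4 xa yb; clear; lra.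
have [L Ld] := derivable_eps (df _ z_in).
(* Chosen so that [bdry_local] at level [k], multiplied by [4 ^+ k], yields [m <= m / 2]. The [+ 1]
   keeps the denominator positive for a degenerate rectangle. *)
pose e := m / (8 * ((u + v) ^+ 2 + 1)).
have D0 : 0 < (u + v) ^+ 2 + 1 by rewrite ltr_wpDl// sqr_ge0.
have e0 : 0 < e by rewrite divr_gt0// mulr_gt0.
have [d d0 dP] := Ld e e0.
have [k kd] := exists_expr2_gt ((u + v) / d).
have kd' : (u + v) / 2 ^+ k < d.
  by rewrite ltr_pdivrMr ?exprn_gt0// mulrC -ltr_pdivrMr.
have [a [b [[h1 h2 h3 h4 h5] xa yb]]] := xy k.
have uk := up k; have vk := vp k.
have zr : in_rect a (a + u / 2 ^+ k) b (b + v / 2 ^+ k) (x +i* y) by case/andP: xa yb => ? ? /andP[? ?]; apply/and4P; split.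
have := @bdry_local _ _ _ _ f _ L e (ltW e0) zr.
have wE : a + u / 2 ^+ k - a + (b + v / 2 ^+ k - b) = (u + v) / 2 ^+ k by ring.
rewrite wE => h; have {h} : `|bdry a (a + u / 2 ^+ k) b (b + v / 2 ^+ k) f| <= (4 * e * ((u + v) / 2 ^+ k) ^+ 2)%:C.
  apply: h => [w wr|w wr].
    by apply: cf; apply: sub_rect wr.
  apply: dP; apply: (le_lt_trans (norm_sub_rect zr wr)).
  by rewrite wE ltcR.
move=> /(le_trans h5); rewrite lecR ler_pdivrMr ?exprn_gt0//.
have -> : 4 * e * ((u + v) / 2 ^+ k) ^+ 2 * 4 ^+ k = 4 * e * (u + v) ^+ 2.
  have -> : 4 ^+ k = 2 ^+ k * 2 ^+ k :> R by rewrite -exprMn -natrM.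
  by field; rewrite expf_neq0.
rewrite /e => hm.
have : 4 * (m / (8 * ((u + v) ^+ 2 + 1))) * (u + v) ^+ 2 <= m / 2.
  have -> : 4 * (m / (8 * ((u + v) ^+ 2 + 1))) * (u + v) ^+ 2 =
    m / 2 * ((u + v) ^+ 2 / ((u + v) ^+ 2 + 1)) by field; rewrite gt_eqF.
  rewrite -[leRHS]mulr1 ler_pM2l ?divr_gt0// ler_pdivrMr// mul1r lerDl ler01//.
by move: hm m0; clear; lra.
Qed.

End Goursat.

(** * Cauchy's integral formula on a square *)

Section CauchyFormula.
Variable R : realType.
Local Notation C := R[i].
Implicit Types (a b x y M u v : R) (f g : C -> C) (z w : C).

Lemma realcD x y : (x + y)%:C = x%:C + y%:C :> C.
Proof. exact: rmorphD. Qed.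

Lemma realcM x y : (x * y)%:C = x%:C * y%:C :> C.
Proof. exact: rmorphM. Qed.

Lemma realcV x : (x^-1)%:C = x%:C^-1 :> C.
Proof. exact: fmorphV. Qed.

Lemma realcX x n : (x ^+ n)%:C = x%:C ^+ n :> C.
Proof. exact: rmorphXn. Qed.

Lemma Re_norm_ge0 z : 0 <= complex.Re `|z|.
Proof. by rewrite normc_def/= sqrtr_ge0. Qed.

Lemma normC_small z : (forall e : R, 0 < e -> `|z| <= e%:C) -> z = 0.
Proof.
move=> ze; apply/eqP; rewrite -normr_le0 normCRe lecR; apply/ler_addgt0Pr => e e0.
by rewrite add0r -lecR -normCRe ze.
Qed.

(** Meant for the difference quotient of a holomorphic function, which is known to be continuous at
    [w] but not yet derivable there. Two vertical and two horizontal cuts isolate a square of half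
    side [t] around [w]. Goursat's lemma removes the other four pieces, and the integral over the
    square is of order [t] since [g] is bounded near [w]. *)
Lemma bdry_exceptional x0 x1 y0 y1 g w :
  x0 < complex.Re w < x1 -> y0 < complex.Im w < y1 ->
  cont_rect x0 x1 y0 y1 g ->
  (forall z, in_rect x0 x1 y0 y1 z -> z != w -> derivable g z 1) ->
  bdry x0 x1 y0 y1 g = 0.
Proof.
case: w => a b /= /andP[x0a ax1] /andP[y0b by1] cg dg.
have w_in : in_rect x0 x1 y0 y1 (a +i* b) by apply/and4P; split; exact: ltW.
apply: normC_small => e e0.
have y01 : y0 <= y1 by exact: ltW (lt_trans y0b by1).
have [d d0 dP] : exists2 d : R, 0 < d & forall z, `|z - a +i* b| < d%:C ->
    `|g (a +i* b) - g z| < 1.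
  by apply/nbhs_complexP; apply: (@cvgr_dist_lt C C C (nbhs _) _ _ _ (cg _ w_in)).
pose M := complex.Re `|g (a +i* b)| + 1.
have M0 : 0 < M by rewrite /M ltr_wpDl// Re_norm_ge0.
near (0 : R)^'+ => t.
have t0 : 0 < t by near: t; exact: nbhs_right_gt.
have td : 4 * t < d by rewrite mulrC -ltr_pdivlMr//; near: t; apply: nbhs_right_lt; exact: divr_gt0.
have h1 : x0 <= a - t by rewrite lerBrDr -lerBrDl ltW//; near: t; apply: nbhs_right_lt; rewrite subr_gt0.
have h2 : a + t <= x1 by rewrite -lerBrDl ltW//; near: t; apply: nbhs_right_lt; rewrite subr_gt0.
have h3 : y0 <= b - t by rewrite lerBrDr -lerBrDl ltW//; near: t; apply: nbhs_right_lt; rewrite subr_gt0.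
have h4 : b + t <= y1 by rewrite -lerBrDl ltW//; near: t; apply: nbhs_right_lt; rewrite subr_gt0.
have te : 4 * M * (4 * t) <= e.
  rewrite mulrA mulrC -ler_pdivlMr ?mulr_gt0// ltW//; near: t; apply: nbhs_right_lt.
  by rewrite divr_gt0 ?mulr_gt0.
have ha : a - t <= a + t by move: t0; clear; lra.
have hb : b - t <= b + t by move: t0; clear; lra.
have sub p q r s z : x0 <= p -> q <= x1 -> y0 <= r -> s <= y1 -> in_rect p q r s z ->
    in_rect x0 x1 y0 y1 z by exact: sub_rect.
have zero p q r s : x0 <= p -> q <= x1 -> y0 <= r -> s <= y1 -> p <= q -> r <= s ->
    ~~ in_rect p q r s (a +i* b) -> bdry p q r s g = 0.
  move=> h5 h6 h7 h8 pq rs nw; apply: Goursat_rectangle => // z zr.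
  apply: dg; first exact: sub zr.
  by apply: contraNneq nw => <-.
rewrite (@bdry_catx R (a - t))//; last by move: ha h2; clear; lra.
rewrite (@bdry_catx R (a + t) (a - t))//; last first.
  by move=> z zr; apply: cg; apply: sub zr.
rewrite (zero x0) //; last 2 first.
- by move: ha h2; clear; lra.
- by rewrite /in_rect/= !negb_and -!ltNge; apply/orP; right; rewrite ltrBlDr ltrDl t0.
rewrite (zero _ x1) //; last 2 first.
- by move: ha h1; clear; lra.
- by rewrite /in_rect/= !negb_and -!ltNge; apply/orP; left; rewrite ltrDl t0.
rewrite addr0 add0r (@bdry_caty R (b - t))//; last 2 first.
- by move: hb h4; clear; lra.
- by move=> z zr; apply: cg; apply: sub zr.
rewrite (@bdry_caty R (b + t) _ _ (b - t))//; last first.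
  by move=> z zr; apply: cg; apply: sub zr.
rewrite (zero _ _ y0) //; last 2 first.
- by move: hb h4; clear; lra.
- by rewrite /in_rect/= !negb_and -!ltNge !(ltrBlDr, ltrDl) t0 !orbT.
rewrite (zero _ _ _ y1) //; last 2 first.
- by move: hb h3; clear; lra.
- by rewrite /in_rect/= !negb_and -!ltNge !(ltrBlDr, ltrDl) t0 !orbT.
rewrite addr0 add0r; apply: le_trans (_ : (4 * M * (4 * t))%:C <= _); last by rewrite lecR.
have -> : 4 * t = (a + t - (a - t)) + (b + t - (b - t)) by ring.
apply: bdry_bound => //.
  by move=> z /andP[zr _]; apply: cg; apply: sub zr.
move=> z /andP[zr _].
have wr : in_rect (a - t) (a + t) (b - t) (b + t) (a +i* b).
  by apply/and4P; split => /=; move: t0; clear; lra.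
have /dP : `|z - a +i* b| < d%:C.
  apply: (le_lt_trans (norm_sub_rect wr zr)); rewrite ltcR.
  by apply: le_lt_trans td; rewrite le_eqVlt; apply/orP; left; apply/eqP; ring.
move=> gz; rewrite /M realcD -normCRe.
have -> : g z = g (a +i* b) - (g (a +i* b) - g z) by ring.
by apply: (le_trans (ler_normB _ _)); apply: lerD => //; exact: ltW.
Unshelve. all: by end_near. Qed.

Section square.
Variables (l : R) (l0 : 0 < l).
Local Notation Q := (bdry (- l) l (- l) l).
Local Notation sq := (in_rect (- l) l (- l) l).
Local Notation edge := (on_bdry (- l) l (- l) l).
Local Notation cedge := (cont_bdry (- l) l (- l) l).

Let ll : - l <= l. Proof. by rewrite ge0_cp// ltW. Qed.

Lemma edge_norm z : edge z -> l%:C <= `|z|.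
Proof.
move=> /andP[_]; have ln : `|l| = l by rewrite gtr0_norm.
by case/or4P => /eqP h; [have := normc_ge_Re z|have := normc_ge_Re z|have := normc_ge_Im z|have := normc_ge_Im z];
  rewrite h ?normrN ln.
Qed.

Lemma edge_neq w z : `|w| < l%:C -> edge z -> z - w != 0.
Proof.
by move=> wl /edge_norm; rewrite subr_eq0; apply: contraTneq => ->; rewrite lt_geF.
Qed.

(** For holomorphic [f], up to the factor [2 * pi * 'i]: at [w = 0] this is the [n]-th Taylor
    coefficient, and in general it is the Taylor remainder after [n] terms divided by [w ^+ n]. *)
Definition cauchy_int f n w := Q (fun z => f z * z^-1 ^+ n * (z - w)^-1).

Lemma cont_cauchy f n w : cedge f -> `|w| < l%:C ->
  cedge (fun z => f z * z^-1 ^+ n * (z - w)^-1).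
Proof.
move=> cf wl z ze; have := edge_neq wl ze.
have := @edge_neq 0 z; rewrite normr0 ltcR subr0 => /(_ l0 ze) z0 zw.
apply: (@continuousM C C); first apply: (@continuousM C C).
- exact: cf.
- by apply/differentiable_continuous/diffable_exp/diffable_inv.
- by apply/differentiable_continuous/diffable_inv => //; exact: diffable_sub.
Qed.

(* One step of the expansion [1/(z - w) = 1/z + w/z^2 + ...]. *)
Lemma cauchy_int_rec f n w : cedge f -> `|w| < l%:C ->
  cauchy_int f n w = cauchy_int f n 0 + w * cauchy_int f n.+1 w.
Proof.
move=> cf wl; have l0' : `|0 : C| < l%:C by rewrite normr0 ltcR.
rewrite /cauchy_int -(bdryZ w ll ll (cont_cauchy (n := n.+1) cf wl)).
rewrite -(bdryD ll ll (cont_cauchy (n := n) cf l0')).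
  apply: eq_bdry => // z ze; have := edge_neq wl ze; have := edge_neq l0' ze.
  rewrite subr0 => z0 zw; rewrite exprSr [f z * (_ / _)]mulrA; move: (f z * _) => p.
  by field; rewrite z0 zw.
move=> z ze; apply: (@continuousM C C); first exact: (@cst_continuous C C).
exact: (cont_cauchy (n := n.+1) cf wl).
Qed.

Lemma cauchy_int_bound f n w M : 0 <= M -> cedge f ->
  (forall z, edge z -> `|f z| <= M%:C) -> `|w| <= (l / 2)%:C ->
  `|cauchy_int f n w| <= (32 * M / l ^+ n)%:C.
Proof.
move=> M0 cf fM wl2.
have wl : `|w| < l%:C.
  by apply: (le_lt_trans wl2); rewrite ltcR ltr_pdivrMr// ltr_pMr// ltr1n.
(* The constant [32] collects the [4] of [bdry_bound], the length sum [4 * l], and [2 / l] from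
   [|z - w| >= l / 2] on the contour. *)
have -> : 32 * M / l ^+ n = 4 * (M * l^-1 ^+ n * (l / 2)^-1) * ((l - - l) + (l - - l)).
  by rewrite exprVn; field; rewrite expf_neq0 ?gt_eqF.
apply: (bdry_bound ll ll (cont_cauchy cf wl)).
move=> z ze; rewrite !normrM normrX !normfV !realcM realcX !realcV.
have zl := edge_norm ze.
have zwl : (l / 2)%:C <= `|z - w|.
  have h : `|z| <= `|z - w| + `|w| by rewrite -{1}(subrK w z) ler_normD.
  move: (le_trans zl h); rewrite {1}[l]splitr realcD => h2.
  by rewrite -(lerD2r (l / 2)%:C) (le_trans h2)// lerD2l.
have lc : 0 < l%:C :> C by rewrite ltcR.
have lc2 : 0 < (l / 2)%:C :> C by rewrite ltcR divr_gt0.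
rewrite ler_pM ?mulr_ge0 ?exprn_ge0 ?invr_ge0//.
- rewrite ler_pM ?exprn_ge0 ?invr_ge0//; first exact: fM.
  by rewrite lerXn2r ?nnegrE ?invr_ge0 ?(ltW lc)// lef_pV2 ?posrE// (lt_le_trans lc).
- by rewrite lef_pV2 ?posrE// (lt_le_trans lc2).
Qed.

Let cedge_cst (c : C) : cedge (fun=> c).
Proof. by move=> z _; exact: (@cst_continuous C C). Qed.

(** Each side contributes to the imaginary part the integral of [l / (x ^+ 2 + l ^+ 2)] over
    [[- l, l]]. The integrand is at least [1 / (2 * l)], so each of the four contributions is at
    least [1]. *)
Lemma cauchy_int1_neq0 : cauchy_int (fun=> 1) 0 0 != 0.
Proof.
have l0' : `|0 : C| < l%:C by rewrite normr0 ltcR.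
suff : 0 < complex.Im (cauchy_int (fun=> 1) 0 0) by apply: contraTneq => ->; rewrite /= ltxx.
have cc := cont_cauchy (n := 0) (@cedge_cst 1) l0'.
set g := (fun z : C => _) in cc.
have gE z : g z = z^-1 by rewrite /g expr0 !mul1r subr0.
have I1 (c : R -> C) : cts (- l) l c ->
   (forall x, - l <= x <= l -> (2 * l)^-1 <= complex.Im (c x)) -> 1 <= complex.Im (cint (- l) l c).
  move=> cc1 hc /=.
  have -> : 1 = \int[@lebesgue_measure R]_(x in `[- l, l]) (2 * l)^-1.
    by rewrite Rint_cst//; field; rewrite gt_eqF.
  apply: (@le_Rintegral _ _ R (@lebesgue_measure R)) => //.
  - apply: continuous_compact_integrable; first exact: segment_compact.
    by apply: continuous_subspaceT => x; exact: cvg_cst.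
  - exact: (integrable_cts (@continuous_Im R) cc1).
have key x : - l <= x <= l -> (2 * l)^-1 <= l / (x ^+ 2 + l ^+ 2).
  move=> /andP[h1 h2]; have xl : x ^+ 2 <= l ^+ 2 by rewrite -subr_ge0 subr_sqr mulr_ge0 ?subr_ge0// -[l]opprK addrC subr_ge0.
  have p2 : 0 < l ^+ 2 by rewrite exprn_gt0.
  have x2 : 0 <= x ^+ 2 by rewrite sqr_ge0.
  rewrite -[leLHS]div1r ler_pdivrMr ?mulr_gt0// mulrAC ler_pdivlMr ?ltr_wpDl//.
  by rewrite mul1r mulrCA -expr2 mulr_natl mulr2n lerD2r.
have invE x y : (x +i* y)^-1 = (x / (x ^+ 2 + y ^+ 2)) -i* (y / (x ^+ 2 + y ^+ 2)) by [].
have sl : `|l| = l by rewrite gtr0_norm.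
have cm (c : C) (h : R -> C) : cts (- l) l h -> cts (- l) l (fun x => c * h x).
  by move=> ch x xl; apply: (@continuousM C R); [exact: (@cst_continuous R C)|exact: ch].
have cA := cts_hor cc ll (introT orP (or_introl (eqxx _))).
have cD := cts_hor cc ll (introT orP (or_intror (eqxx _))).
have cE := cts_ver cc ll (introT orP (or_introl (eqxx _))).
have cB := cts_ver cc ll (introT orP (or_intror (eqxx _))).
rewrite /cauchy_int -/g /bdry -mulNr -[X in _ - X + _]mul1r -mulNr -!cintZ//.
have := I1 _ cA _; have := I1 _ (cm 'i _ cB) _; have := I1 _ (cm (- 1) _ cD) _.
have := I1 _ (cm (- 'i) _ cE) _.
set A := cint _ _ _; set B := cint _ _ _; set D := cint _ _ _; set E := cint _ _ _.
have ImD (a b : C) : complex.Im (a + b) = complex.Im a + complex.Im b by case: a b => ? ? [].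
rewrite !ImD => hE hD hB hA.
have {hE} : 1 <= complex.Im A.
  apply: hE => x /key /le_trans; apply; rewrite gE invE /=.
  by rewrite le_eqVlt; apply/orP; left; apply/eqP; rewrite sqrrN addrC; ring.
have {hD} : 1 <= complex.Im B.
  apply: hD => x /key /le_trans; apply; rewrite gE invE /=.
  by rewrite le_eqVlt; apply/orP; left; apply/eqP; ring.
have {hB} : 1 <= complex.Im D.
  apply: hB => x /key /le_trans; apply; rewrite gE invE /=.
  by rewrite le_eqVlt; apply/orP; left; apply/eqP; rewrite addrC; ring.
have {hA} : 1 <= complex.Im E.
  apply: hA => x /key /le_trans; apply; rewrite gE invE /=.
  by rewrite le_eqVlt; apply/orP; left; apply/eqP; rewrite sqrrN; ring.
move: (complex.Im A) (complex.Im B) (complex.Im D) (complex.Im E); clear => *; lra.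
Qed.

(** [bdry_exceptional] applies to [(f z - f w) / (z - w)], completed at [w] by the derivative [L];
    splitting the quotient gives the formula. *)
Lemma cauchy_formula f w : (forall z, sq z -> derivable f z 1) -> `|w| < l%:C ->
  cauchy_int f 0 w = f w * cauchy_int (fun=> 1) 0 w.
Proof.
move=> df wl.
have cf : cedge f by move=> z /andP[/df/derivable_continuous].
have wre : `|complex.Re w| < l by rewrite -ltcR (le_lt_trans (normc_ge_Re w)).
have wim : `|complex.Im w| < l by rewrite -ltcR (le_lt_trans (normc_ge_Im w)).
have w_in : sq w by move: wre wim; rewrite !ltr_norml => /andP[? ?] /andP[? ?]; apply/and4P; split; exact: ltW.
have [L Ld] := derivable_eps (df _ w_in).
pose g z := if z == w then L else (f z - f w) / (z - w).
have gE z : z != w -> \forall z' \near z, (f z' - f w) / (z' - w) = g z'.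
  move=> zw; apply/nbhs_complexP; exists (complex.Re `|z - w|).
    by rewrite -ltcR -normCRe normr_gt0 subr_eq0.
  move=> z' z'z; rewrite /g; case: eqP => // z'w; move: z'z.
  by rewrite z'w -normCRe distrC ltxx.
have dg z : sq z -> z != w -> derivable g z 1.
  move=> zs zw; apply: (near_eq_derivable (gE _ zw)).
  apply/derivable1_diffP/diffable_mul; first by apply: diffable_sub; [apply/derivable1_diffP/df|exact: diffable_cst].
  by apply: diffable_inv; [apply: diffable_sub; [exact: ex_diff|exact: diffable_cst]|rewrite subr_eq0].
have cg : cont_rect (- l) l (- l) l g.
  move=> z zs; have [zw|/(dg _ zs)] := eqVneq z w; last exact: derivable_continuous.
  rewrite zw; apply/(@cvgrPdist_le C C C (nbhs w)) => e /complex_gt0[-> e0].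
  apply/nbhs_complexP; have [d d0 dP] := Ld _ e0; exists d => // z' /dP.
  rewrite /g eqxx; case: eqP => [-> _|/eqP z'w]; first by rewrite subrr normr0 lecR ltW.
  rewrite -subr_eq0 in z'w; rewrite -ler_pdivrMr ?normr_gt0// -normfV -normrM distrC.
  by rewrite mulrBl mulfK.
have := bdry_exceptional _ _ cg dg.
rewrite -!ltr_norml => /(_ wre wim); rewrite (@eq_bdry _ _ _ _ _ _ (fun z => f z * z^-1 ^+ 0 * (z - w)^-1 +
   - f w * (1 * z^-1 ^+ 0 * (z - w)^-1)) ll ll).
  rewrite (bdryD ll ll (cont_cauchy (n := 0) cf wl)).
    rewrite (bdryZ _ ll ll (cont_cauchy (n := 0) (@cedge_cst 1) wl)).
    by rewrite mulNr => /subr0_eq.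
  move=> z ze; apply: (@continuousM C C); first exact: (@cst_continuous C C).
  exact: (cont_cauchy (n := 0) (@cedge_cst 1) wl).
move=> z /(edge_neq wl) zw; rewrite /g -subr_eq0 (negbTE zw) expr0 !mul1r mulr1 mulrBl.
by rewrite mulNr.
Qed.

End square.

End CauchyFormula.

(** * Zeros of holomorphic functions *)

Section LocalForm.
Variable R : realType.
Local Notation C := R[i].
Implicit Types (f g : C -> C) (z w a : C).

Lemma continuous_neq0 g a : {for a, continuous g} -> g a != 0 ->
  exists2 d : R, 0 < d & forall z, `|z - a| < d%:C -> g z != 0.
Proof.
move=> cg ga; apply/nbhs_complexP.
have e0 : 0 < `|g a| by rewrite normr_gt0.
have := @cvgr_dist_lt C C C (nbhs a) (nbhs_filter a) _ _ cg _ e0; apply: (@filterS _ (nbhs a) (nbhs_filter a)) => z.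
by apply: contraTneq => ->; rewrite subr0 ltxx.
Qed.

Section square.
Variables (l : R) (l0 : 0 < l) (f : C -> C) (M : R) (M0 : 0 <= M).
Hypothesis cf : cont_bdry (- l) l (- l) l f.
Hypothesis fM : forall z, on_bdry (- l) l (- l) l z -> `|f z| <= M%:C.
Let T := cauchy_int l f.

Let small w : `|w| < (l / 2)%:C -> `|w| < l%:C.
Proof. by move=> /lt_trans; apply; rewrite ltcR ltr_pdivrMr// ltr_pMr// ltr1n. Qed.

(** By the recursion, [T n w - T n 0 = w * T n.+1 w], and [T n.+1] is bounded near the origin. *)
Lemma cauchy_int_continuous n : {for 0, continuous (T n)}.
Proof.
apply/(@cvgrPdist_le C C C (nbhs 0)) => e /complex_gt0[-> e0].
pose K := 32 * M / l ^+ n.+1 + 1.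
have K0 : 0 < K by rewrite ltr_wpDl// divr_ge0 ?mulr_ge0 ?exprn_ge0// ltW.
apply/nbhs_complexP; exists (Num.min (l / 2) (complex.Re e / K)).
  by rewrite lt_min !divr_gt0.
move=> w; rewrite subr0 normCRe ltcR lt_min -!ltcR -!normCRe => /andP[w1 w2].
rewrite /T (cauchy_int_rec l0 n cf (small w1)) opprD addNKr normrN normrM.
have h : `|T n.+1 w| <= K%:C.
  apply: (le_trans (cauchy_int_bound l0 n.+1 M0 cf fM (ltW w1))).
  by rewrite lecR lerDl.
apply: (@le_trans _ _ ((complex.Re e / K)%:C * K%:C)).
  by apply: ler_pM => //; exact: ltW.
by rewrite -realcM mulfVK// gt_eqF.
Qed.

Lemma cauchy_int_shift n w : `|w| < (l / 2)%:C -> (forall k, (k < n)%N -> T k 0 = 0) ->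
  T 0 w = w ^+ n * T n w.
Proof.
move=> wl; elim: n => [|n ih] h; first by rewrite expr0 mul1r.
rewrite ih; last by move=> k kn; apply: h; exact: ltnW.
rewrite /T (cauchy_int_rec l0 n cf (small wl)) -/(T n 0) h// add0r.
by rewrite mulrA exprSr.
Qed.

(** With all coefficients zero, [T 0 w = w ^+ n * T n w] for every [n]. As [|w| < l / 2], the
    modulus is at most [32 * M / 2 ^+ n], which tends to zero. *)
Lemma cauchy_int_eq0 w : `|w| < (l / 2)%:C -> (forall k, T k 0 = 0) -> T 0 w = 0.
Proof.
move=> wl h; apply: normC_small => e e0.
have [n nP] := exists_expr2_gt (32 * M / e).
have nP' : 32 * M / 2 ^+ n <= e.
  by rewrite ler_pdivrMr ?exprn_gt0// [leRHS]mulrC -ler_pdivrMr// ltW.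
rewrite (@cauchy_int_shift n)// normrM normrX.
apply: (@le_trans _ _ ((l / 2)%:C ^+ n * (32 * M / l ^+ n)%:C)).
  apply: ler_pM; rewrite ?exprn_ge0//; last exact: (cauchy_int_bound l0 n M0 cf fM (ltW wl)).
  by rewrite lerXn2r ?nnegrE ?(ltW wl)// (le_trans _ (ltW wl)).
rewrite -realcX -realcM lecR; apply: le_trans nP'.
rewrite expr_div_n le_eqVlt; apply/orP; left; apply/eqP; field.
by rewrite !expf_neq0 ?gt_eqF.
Qed.

End square.

(* The Cauchy integral of [f] is divided by that of [1], which is only shown to
   be continuous and nonzero at the origin: the value [2 * pi * 'i] is never
   needed, and a merely continuous [g] suffices below. *)
Lemma holomorphic_local_form0 f (r : R) : 0 < r ->
  (forall z, `|z| < r%:C -> derivable f z 1) ->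
  (exists2 d : R, 0 < d & forall z, `|z| < d%:C -> f z = 0) \/
  exists n g, [/\ g 0 != 0, {for 0, continuous g} &
    exists2 d : R, 0 < d & forall z, `|z| < d%:C -> f z = z ^+ n * g z].
Proof.
move=> r0 df.
have cf0 : {for 0, continuous f} by apply/derivable_continuous/df; rewrite normr0 ltcR.
have [d d0 dP] : exists2 d : R, 0 < d & forall z, `|z - 0| < d%:C -> `|f 0 - f z| < 1.
  by apply/nbhs_complexP; apply: (@cvgr_dist_lt C C C (nbhs _) _ _ _ cf0).
(* On the square of half side [l] one has [|z| <= 2 * l < Num.min r d], so [f] is derivable there
   and bounded by [|f 0| + 1]. *)
pose l := Num.min r d / 3.
have m0 : 0 < Num.min r d by rewrite lt_min r0.
have l0 : 0 < l by rewrite divr_gt0.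
have l3 : 2 * l < Num.min r d by rewrite /l; move: m0; clear; lra.
have sq_norm z : in_rect (- l) l (- l) l z -> `|z| < (Num.min r d)%:C.
  move=> /and4P[h1 h2 h3 h4]; apply: le_lt_trans (normc_le_ReIm z) _.
  rewrite ltcR; apply: le_lt_trans l3; rewrite mulr_natl mulr2n lerD// ler_norml.
    by rewrite h1 h2.
  by rewrite h3 h4.
have dsq z : in_rect (- l) l (- l) l z -> derivable f z 1.
  by move=> /sq_norm zl; apply: df; apply: lt_le_trans zl _; rewrite lecR ge_min lexx.
have cf : cont_bdry (- l) l (- l) l f by move=> z /andP[/dsq/derivable_continuous].
pose M := complex.Re `|f 0| + 1.
have M0 : 0 <= M by rewrite addr_ge0// Re_norm_ge0.
have fM z : on_bdry (- l) l (- l) l z -> `|f z| <= M%:C.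
  move=> /andP[/sq_norm zl _]; rewrite /M realcD -normCRe -[f z](subKr (f 0)).
  apply: (le_trans (ler_normB _ _)); apply: lerD => //; apply/ltW/dP; rewrite subr0.
  by apply: lt_le_trans zl _; rewrite lecR ge_min lexx orbT.
have c1 : cont_bdry (- l) l (- l) l (fun=> 1 : C) by move=> z _; exact: (@cst_continuous C C).
have b1 z : on_bdry (- l) l (- l) l z -> `|1 : C| <= 1%:C by rewrite normr1.
pose W := cauchy_int l (fun=> 1) 0.
have W0 : W 0 != 0 by exact: cauchy_int1_neq0.
have cW : {for 0, continuous W} := cauchy_int_continuous l0 ler01 c1 b1 (n := 0).
have [d1 d10 Wd] := continuous_neq0 cW W0.
have form w : `|w| < (l / 2)%:C -> f w * W w = cauchy_int l f 0 w.
  move=> wl; rewrite (cauchy_formula l0 dsq)//; apply: lt_trans wl _.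
  by rewrite ltcR ltr_pdivrMr// ltr_pMr// ltr1n.
have d2 : 0 < Num.min (l / 2) d1 by rewrite lt_min d10 divr_gt0.
have d2P z : `|z| < (Num.min (l / 2) d1)%:C -> `|z| < (l / 2)%:C /\ W z != 0.
  rewrite normCRe ltcR lt_min -!ltcR -!normCRe => /andP[h1 h2]; split=> //.
  by apply: Wd; rewrite subr0.
have [/existsNP/cid[k0 /eqP ck0]|c0] := pselect (~ forall k, cauchy_int l f k 0 = 0); last first.
  left; exists (Num.min (l / 2) d1) => // z /d2P[zl Wz].
  apply: (mulIf Wz); rewrite mul0r form//.
  by apply: (cauchy_int_eq0 l0 M0 cf fM) => //; exact: contrapT.
right; have exk : exists k, cauchy_int l f k 0 != 0 by exists k0.
case: (ex_minnP exk) => n cn nmin.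
exists n, (fun z => cauchy_int l f n z * (W z)^-1); split.
- by rewrite mulf_neq0// invr_eq0.
- apply: (@continuousM C C); first exact: (cauchy_int_continuous l0 M0 cf fM).
  exact: (@continuousV C C).
exists (Num.min (l / 2) d1) => // z /d2P[zl Wz].
rewrite mulrA -(@cauchy_int_shift l l0 f cf n z zl); last first.
  by move=> k kn; apply/eqP; apply: contraTT kn => /nmin; rewrite -leqNgt.
by rewrite -form// mulfK.
Qed.

Lemma holomorphic_local_form f a (r : R) : 0 < r ->
  (forall z, `|z - a| < r%:C -> derivable f z 1) ->
  (exists2 d : R, 0 < d & forall z, `|z - a| < d%:C -> f z = 0) \/
  exists n g, [/\ g a != 0, {for a, continuous g} &
    exists2 d : R, 0 < d & forall z, `|z - a| < d%:C -> f z = (z - a) ^+ n * g z].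
Proof.
move=> r0 df.
have [|[d d0 dP]|[n [g [g0 cg [d d0 dP]]]]] := @holomorphic_local_form0 (fun z => f (z + a)) r r0.
- move=> z zr; apply/derivable1_diffP.
  apply: (@differentiable_comp _ C C C (fun z => z + a) f).
    by apply: diffable_add; [exact: ex_diff|exact: diffable_cst].
  by apply/derivable1_diffP/df; rewrite addrK.
- by left; exists d => // z /dP; rewrite subrK.
- right; exists n, (fun z => g (z - a)); split.
  + by rewrite subrr.
  + apply: (@continuous_comp C C C (fun z => z - a) g); last by rewrite subrr.
    by apply: (@continuousB _ C C); [exact: cvg_id|exact: (@cst_continuous C C)].
  + by exists d => // z /dP; rewrite subrK.
Qed.

End LocalForm.

Section IdentityTheorem.
Variable R : realType.
Local Notation C := R[i].
Implicit Types (f g : C -> C) (z w a : C).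

Definition zeros_cluster f a :=
  forall d : R, 0 < d -> exists z, [/\ z != a, `|z - a| < d%:C & f z = 0].

(** In the form [(z - a) ^+ n * g z] with [g a != 0], the only possible zero near [a] is [a]
    itself. *)
Lemma zeros_cluster_nbhs f a : nbhs a (fun t => derivable f t 1) ->
  zeros_cluster f a -> exists2 d : R, 0 < d & forall z, `|z - a| < d%:C -> f z = 0.
Proof.
move=> /nbhs_complexP[r r0 df] acc.
have [//|[n [g [ga cg [d d0 fE]]]]] := holomorphic_local_form r0 df.
have [d' d'0 gd] := continuous_neq0 cg ga.
have m0 : 0 < Num.min d d' by rewrite lt_min d0.
have [z [za]] := acc _ m0.
rewrite normCRe ltcR lt_min -!ltcR -!normCRe => /andP[h1 h2] fz.
have /eqP := fE _ h1; rewrite fz eq_sym mulf_eq0 expf_eq0 subr_eq0 (negbTE za) andbF/=.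
by rewrite (negbTE (gd _ h2)).
Qed.

(** A supremum argument on the [x] for which [f] vanishes near every point of [[0, x]]: at the
    supremum the zeros on the left cluster, so [f] vanishes near it as well, and the set extends
    further unless the supremum is [1]. The identity theorems on lines and discs, and the
    polarization below, reduce to this one by reparametrization. *)
Lemma identity_segment f :
  (forall x : R, 0 <= x <= 1 -> nbhs (x%:C : C) (fun t => derivable f t 1)) ->
  zeros_cluster f 0 -> f 1 = 0.
Proof.
move=> df acc0.
pose Z (x : R) := exists2 d : R, 0 < d & forall z, `|z - x%:C| < d%:C -> f z = 0.
have Zacc (x : R) : 0 <= x <= 1 -> zeros_cluster f x%:C -> Z x.
  by move=> x01 acc; apply: zeros_cluster_nbhs => //; exact: df.
pose S : set R := [set x | 0 <= x <= 1 /\ forall y, 0 <= y <= x -> Z y].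
have S0 : S 0.
  split; first by rewrite lexx ler01.
  move=> y; rewrite -eq_le => /eqP <-; apply: Zacc => //; by rewrite lexx ler01.
have ubS : ubound S 1 by move=> x [/andP[]].
have hS : has_sup S by split; [exists 0|exists 1].
pose s := sup S.
have s0 : 0 <= s by apply: ub_le_sup => //; exists 1.
have s1 : s <= 1 by apply: ge_sup => //; exists 0.
have below y : 0 <= y < s -> Z y.
  move=> /andP[y0 ys]; have [|x [_ xS] yx] := sup_adherent (eps := s - y) _ hS.
    by rewrite subr_gt0.
  by apply: xS; rewrite y0/= ltW//; rewrite subKr in yx.
have Zs : Z s.
  move: s0; rewrite le_eqVlt => /predU1P[<-|s0]; first by case: S0 => _; apply; rewrite lexx.
  apply: Zacc; first by rewrite s1 ltW.
  move=> d d0; pose m := Num.min d s; have m0 : 0 < m by rewrite lt_min d0.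
  have ms : m <= s by rewrite ge_min lexx orbT.
  have md : m <= d by rewrite ge_min lexx.
  exists (s - m / 2)%:C; split.
  - by rewrite (inj_eq (@complexI _)) lt_eqF// ltrBlDr ltrDl divr_gt0.
  - rewrite -rmorphB addrAC subrr add0r normc_def/= expr0n/= addr0 sqrtr_sqr ltcR normrN.
    by rewrite gtr0_norm ?divr_gt0//; move: md m0; clear; lra.
  - have [|d' d'0] := below (s - m / 2).
      by apply/andP; split; move: ms m0; clear; lra.
    by apply; rewrite subrr normr0 ltcR.
have [d d0 dP] := Zs.
move: s1; rewrite le_eqVlt => /predU1P[s1|s1].
  by apply: dP; rewrite s1 subrr normr0 ltcR.
pose t := Num.min (s + d / 2) 1.
have st : s < t by rewrite lt_min s1 ltrDl divr_gt0.
have tS : S t.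
  split; first by rewrite ge_min lexx orbT andbT ltW// (le_lt_trans s0).
  move=> y /andP[y0 yt]; have [ys|sy] := ltP y s; first by apply: below; rewrite y0.
  exists (d / 2); first by rewrite divr_gt0.
  move=> z zy; apply: dP; rewrite -(subrKA y%:C).
  apply: (le_lt_trans (ler_normD _ _)); rewrite [d]splitr realcD; apply: ltr_leD => //.
  rewrite -rmorphB normc_def/= expr0n/= addr0 sqrtr_sqr lecR ger0_norm ?subr_ge0//.
  by rewrite lerBlDl (le_trans yt)// ge_min lexx.
have : t <= s by apply: ub_le_sup => //; exists 1.
by rewrite leNgt st.
Qed.

Lemma near_zero_cluster f a : nbhs a (fun t => f t = 0) -> zeros_cluster f a.
Proof.
move=> /nbhs_complexP[d d0 dP] e e0.
pose m := Num.min d e / 2.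
have m0 : 0 < m by rewrite divr_gt0// lt_min d0.
have mm : m < Num.min d e by move: m0; rewrite /m; clear; lra.
have nm : `|a + m%:C - a| = m%:C.
  by rewrite addrAC subrr add0r normc_def/= expr0n/= addr0 sqrtr_sqr gtr0_norm.
exists (a + m%:C); split.
- by rewrite -subr_eq0 addrAC subrr add0r (inj_eq (@complexI _)) gt_eqF.
- by rewrite nm ltcR (lt_le_trans mm)// ge_min lexx orbT.
- by apply: dP; rewrite nm ltcR (lt_le_trans mm)// ge_min lexx.
Qed.

Lemma eps_derivable f z L : (forall e : R, 0 < e ->
  exists2 d : R, 0 < d & forall w, `|w - z| < d%:C -> `|f w - f z - L * (w - z)| <= e%:C * `|w - z|) ->
  derivable f z 1.
Proof.
move=> h; apply/cvg_ex; exists L; apply/(@cvgrPdist_le C C C (0^')) => e /complex_gt0[-> e0].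
have [d d0 dP] := h _ e0; apply/nbhs_complexP; exists d => // w; rewrite subr0 => wd w0.
rewrite /= [_%:A]mulr1 /GRing.scale/= distrC.
have := dP (w + z); rewrite addrK => /(_ wd).
rewrite -ler_pdivrMr ?normr_gt0// -normfV -normrM mulrBl mulfK//.
by rewrite mulrC.
Qed.

(** Schwarz reflection. It turns functions that enter through the conjugate-linear second argument
    of [dot] into holomorphic ones. *)
Lemma derivable_conj f z : derivable f z^*%C 1 -> derivable (fun w => (f w^*%C)^*%C) z 1.
Proof.
move=> /derivable_eps[L Ld]; apply: (@eps_derivable _ _ L^*%C) => e e0.
have [d d0 dP] := Ld _ e0; exists d => // w wz.
have := dP w^*%C; rewrite -rmorphB normcJ => /(_ wz).
by rewrite -normcJ !(rmorphB, rmorphM)/= !conjcK.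
Qed.

End IdentityTheorem.

(** * Hermitian products and polarization *)

Section Hermitian.
Variable R : realType.
Local Notation C := R[i].

Lemma conjcD (x y : C) : (x + y)^*%C = x^*%C + y^*%C.
Proof. exact: rmorphD. Qed.

Lemma conjcM (x y : C) : (x * y)^*%C = x^*%C * y^*%C.
Proof. exact: rmorphM. Qed.

Section dot.
Variable n : nat.
Implicit Types (z w u : 'cV[C]_n) (c : C).

Definition dot z w : C := \sum_(i < n) z i 0 * (w i 0)^*%C.

Lemma dotDl z u w : dot (z + u) w = dot z w + dot u w.
Proof. by rewrite /dot -big_split; apply: eq_bigr => i _; rewrite mxE mulrDl. Qed.

Lemma dotZl c z w : dot (c *: z) w = c * dot z w.
Proof. by rewrite /dot mulr_sumr; apply: eq_bigr => i _; rewrite mxE mulrA. Qed.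

Lemma dotC z w : dot z w = (dot w z)^*%C.
Proof.
rewrite /dot rmorph_sum; apply: eq_bigr => i _.
by rewrite rmorphM/= conjcK mulrC.
Qed.

Lemma dotDr z u w : dot w (z + u) = dot w z + dot w u.
Proof. by rewrite dotC dotDl rmorphD/= -!dotC. Qed.

Lemma dotZr c z w : dot w (c *: z) = c^*%C * dot w z.
Proof. by rewrite dotC dotZl rmorphM/= -!dotC. Qed.

Lemma dotNl z w : dot (- z) w = - dot z w.
Proof. by rewrite -scaleN1r dotZl mulN1r. Qed.

Lemma dotNr z w : dot w (- z) = - dot w z.
Proof. by rewrite dotC dotNl rmorphN/= -dotC. Qed.

Lemma dotBl z u w : dot (z - u) w = dot z w - dot u w.
Proof. by rewrite dotDl dotNl. Qed.

Lemma dotBr z u w : dot w (z - u) = dot w z - dot w u.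
Proof. by rewrite dotDr dotNr. Qed.

Lemma dot0l w : dot 0 w = 0.
Proof. by rewrite -(scale0r (0 : 'cV[C]_n)) dotZl mul0r. Qed.

Lemma dot_norm z : dot z z = \sum_(i < n) `|z i 0| ^+ 2.
Proof. by apply: eq_bigr => i _; rewrite sqr_normc. Qed.

Lemma dot_ge0 z : 0 <= dot z z.
Proof. by rewrite dot_norm sumr_ge0// => i _; rewrite exprn_ge0. Qed.

Lemma dot_eq0 z : dot z z = 0 -> z = 0.
Proof.
rewrite dot_norm => /eqP; rewrite psumr_eq0; last by move=> i _; rewrite exprn_ge0.
move=> /allP h; apply/matrixP => i j; rewrite ord1 !mxE.
by have := h i (mem_index_enum _); rewrite expf_eq0/= normr_eq0 => /eqP.
Qed.

(** The Euclidean square norm as a real number. On column vectors [|z|] is the maximum norm, which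
    carries the topology, so the two are kept apart. *)
Definition nsq z : R := complex.Re (dot z z).

Lemma dotE z : dot z z = (nsq z)%:C.
Proof. by have := dot_ge0 z; rewrite /nsq; case: (dot z z) => a b; rewrite lecE/= => /andP[/eqP ->]. Qed.

Lemma nsq_ge0 z : 0 <= nsq z.
Proof. by rewrite -lecR -dotE dot_ge0. Qed.

Lemma nsq_eq0 z : nsq z = 0 -> z = 0.
Proof. by move=> z0; apply: dot_eq0; rewrite dotE z0. Qed.

Lemma nsqB z w : nsq (z - w) = nsq z + nsq w - 2 * complex.Re (dot z w).
Proof.
rewrite /nsq dotBl !dotBr [dot w z]dotC.
by case: (dot z z) (dot w w) (dot z w) => ? ? [? ?] [? ?] /=; ring.
Qed.

Lemma nsqZ c z : nsq (c *: z) = complex.Re `|c| ^+ 2 * nsq z.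
Proof.
apply: complexI; rewrite -dotE dotZl dotZr realcM realcX -normCRe sqr_normc mulrA.
by rewrite -dotE.
Qed.

Lemma unit_ballE z : unit_ball z = (nsq z < 1 :> R).
Proof.
rewrite /unit_ball /enorm /= -dot_norm dotE -ltcR.
have h : 0 <= (nsq z)%:C by rewrite ler0c nsq_ge0.
by rewrite -[in RHS](sqrtCK (nsq z)%:C) expr_lt1 ?sqrtC_ge0.
Qed.

Lemma sphereP (r : R) z : 0 <= r -> sphere r z <-> nsq z = r ^+ 2.
Proof.
move=> r0; rewrite /sphere /enorm /= -dot_norm dotE; split.
  by move=> /(congr1 (fun x => x ^+ 2)); rewrite sqrtCK -realcX => /complexI.
by move=> ->; rewrite realcX sqrCK// ler0c.
Qed.

End dot.

Lemma differentiable_coordinate m n (F : 'cV[C]_n -> 'cV[C]_m) z k :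
  differentiable F z -> differentiable (fun y => F y k 0) z.
Proof.
move=> dF; apply: (@differentiable_comp _ _ _ _ F (fun M : 'cV[C]_m => M k 0)) => //.
exact: differentiable_coord.
Qed.

Lemma continuous_conj : continuous (@conjc R).
Proof.
move=> z; apply/(@cvgrPdist_le C C C (nbhs z)) => e /complex_gt0[-> e0].
apply/nbhs_complexP; exists (complex.Re e) => // w wz.
by rewrite -rmorphB normcJ distrC ltW.
Qed.

Lemma differentiable_Z (V : normedModType C) n (h : V -> C) (P : 'cV[C]_n) x : differentiable h x ->
  differentiable (fun y => h y *: P) x.
Proof. exact: differentiableZl. Qed.

Lemma realc_eq0 (x : R) : (x%:C == 0 :> C) = (x == 0).
Proof. by rewrite (inj_eq (@complexI _) _ 0). Qed.

Lemma sum_recip (A : R) : 2 < A -> exists s : R, [/\ 1 < s & s ^+ 2 + s^-1 ^+ 2 = A].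
Proof.
(* [q] is to be [s + s^-1] and the later [p] is to be [s - s^-1], whence [s = (q + p) / 2]. *)
move=> A2; pose q := Num.sqrt (A + 2).
have q2 : q ^+ 2 = A + 2 by rewrite sqr_sqrtr//; move: A2; clear; lra.
have q0 : 0 <= q by exact: sqrtr_ge0.
pose p := Num.sqrt (A - 2).
have p2 : p ^+ 2 = A - 2 by rewrite sqr_sqrtr//; move: A2; clear; lra.
have p0 : 0 < p by rewrite sqrtr_gt0; move: A2; clear; lra.
have q1 : 2 < q by rewrite -(@ltr_pXn2r _ 2)// ?nnegrE// q2; move: A2; clear; lra.
have s1 : 1 < (q + p) / 2 by move: q1 p0; clear; lra.
have sV : ((q + p) / 2)^-1 = (q - p) / 2.
  apply: (@mulfI _ ((q + p) / 2)); first by rewrite gt_eqF// (lt_trans ltr01).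
  rewrite divff; last by rewrite gt_eqF// (lt_trans ltr01).
  have -> : (q + p) / 2 * ((q - p) / 2) = (q ^+ 2 - p ^+ 2) / 4 by field.
  by rewrite q2 p2; field.
exists ((q + p) / 2); split=> //; rewrite sV.
have -> : ((q + p) / 2) ^+ 2 + ((q - p) / 2) ^+ 2 = (q ^+ 2 + p ^+ 2) / 2 by field.
by rewrite q2 p2; field.
Qed.

(** The parameter [t] is complex: real [t] in [[0, 1]] runs from [1] to [s], while the points of the
    unit circle near [1] correspond to complex [t] near [0]. Zeros on the circle thus start a
    continuation along the real segment. *)
Lemma unit_circle_cluster (s : R) (f : C -> C) : 1 < s ->
  (exists2 r : R, 0 < r & forall z, `|z| = 1 -> `|z - 1| < r%:C -> f z = 0) ->
  zeros_cluster (fun t => f (1 + t * (s - 1)%:C)) 0.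
Proof.
move=> s1 [r r0 fr] d d0; have s10 : 0 < s - 1 by rewrite subr_gt0.
have m0 : 0 < Num.min (d * (s - 1)) r by rewrite lt_min mulr_gt0.
have [y y0 y2] : exists2 y : R, 0 < y & 2 * y < Num.min (d * (s - 1)) r.
  exists (Num.min (d * (s - 1)) r / 4); first by rewrite divr_gt0.
  by move: m0; clear; lra.
have y20 : 0 <= 2 * y by rewrite mulr_ge0// ltW.
(* The Cayley transform gives a point of the circle with [z - 1 = 2 * y * 'i / (1 - 'i * y)], hence
   at distance at most [2 * y] from [1]. *)
pose z : C := (1 +i* y) / (1 -i* y).
have D0 : 0 < 1 + y ^+ 2 by rewrite ltr_pwDl// sqr_ge0.
have nz : (1 -i* y : C) != 0 by rewrite eq_complex/= oner_eq0.
have nE : `|1 +i* y : C| = `|1 -i* y : C| by rewrite !normc_def/= sqrrN.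
have z1 : `|z| = 1 by rewrite normrM normfV nE divff// normr_eq0.
have zB : z - 1 = (2 * y)%:C * 'i / (1 -i* y).
  have -> : (2 * y)%:C * 'i = (1 +i* y) - (1 -i* y) :> C.
    by apply/eqP; rewrite eq_complex/=; apply/andP; split; apply/eqP; ring.
  by rewrite mulrBl divff.
have zn : `|z - 1| <= (2 * y)%:C.
  rewrite zB !normrM normfV norm_im mulr1 normc_def/= expr0n/= addr0 sqrtr_sqr gtr0_norm ?mulr_gt0//.
  rewrite ler_pdivrMr ?normr_gt0// ler_peMr ?ler0c//.
  rewrite normc_def/= -[1]/(1%:C) lecR expr1n sqrrN -[leLHS]sqrtr1 ler_wsqrtr// lerDl sqr_ge0 //.
have zN1 : z - 1 != 0.
  rewrite zB !mulf_neq0 ?invr_eq0//; last by rewrite eq_complex/= oner_eq0 andbF.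
  by rewrite realc_eq0 gt_eqF// mulr_gt0.
move: z z1 zn zN1 {zB} => z z1 zn zN1.
have sC : (s - 1)%:C != 0 :> C by rewrite realc_eq0 gt_eqF.
have zs : 1 + (z - 1) / (s - 1)%:C * (s - 1)%:C = z.
  by rewrite mulfVK// addrC subrK.
exists ((z - 1) / (s - 1)%:C); split.
- by rewrite mulf_neq0// invr_eq0.
- rewrite subr0 normrM normfV [`|(s - 1)%:C|]ger0_norm ?ler0c ?ltW// ltr_pdivrMr ?ltcR//.
  by apply: le_lt_trans zn _; rewrite -realcM ltcR (lt_le_trans y2)// ge_min lexx.
- rewrite zs fr//; apply: le_lt_trans zn _.
  by rewrite ltcR (lt_le_trans y2)// ge_min lexx orbT.
Qed.

End Hermitian.

Section Polarization.
Variable R : realType.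
Local Notation C := R[i].
Variables (n m : nat).
Implicit Types (z w u : 'cV[C]_n) (F : 'cV[C]_n -> 'cV[C]_m).

(* The curve [a x = x P + x^-1 Q], with [P] and [Q] orthogonal, passes through [z]
   at [s] and through [w] at [1/s], and maps the unit circle into the sphere of
   radius [sqrt tau].  Hence [<F (a x), F (a (1/conj x))> - kappa] is holomorphic
   in [x] and vanishes on the circle, so it vanishes at [s].  The identity theorem
   is applied along the segment from [1] to [s] only, where [a x] is a combination
   of [z] and [w] with nonnegative coefficients; this explains the hypothesis
   on [D]. *)
Lemma polarization F (D : set 'cV[C]_n) (tau kappa : R) z w : 0 < tau ->
  (forall u, D u -> nbhs u D) -> (forall u, D u -> differentiable F u) ->
  (forall u, D u -> nsq u = tau -> nsq (F u) = kappa) ->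
  (forall lam mu : R, 0 <= lam -> 0 <= mu -> lam + mu <= 1 ->
     4 * tau <= (lam + mu) ^+ 2 * (nsq z + nsq w + 2 * tau) ->
     D (lam%:C *: z + mu%:C *: w)) ->
  dot z w = tau%:C -> dot (F z) (F w) = kappa%:C.
Proof.
move=> tau0 oD dF FE Dzw zw.
have nzw : nsq (z - w) = nsq z + nsq w - 2 * tau by rewrite nsqB zw.
have [zEw|zNw] := eqVneq z w.
  have zt : nsq z = tau by apply: complexI; rewrite -dotE -zw zEw.
  rewrite -zEw dotE FE//; have := Dzw 1 0 ler01 (lexx 0).
  rewrite scale1r scale0r !addr0 lexx expr1n -zEw zt; apply=> //.
  by move: tau0; clear; lra.
have nzw0 : 0 < nsq (z - w).
  by rewrite lt_neqAle nsq_ge0 andbT eq_sym; apply: contra zNw => /eqP/nsq_eq0/subr0_eq ->.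
(* Orthogonality of [P] and [Q] dictates [s]: it amounts to [(s ^+ 2 + s^-1 ^+ 2) * tau = nsq z +
   nsq w]. A solution [s > 1] exists because [z != w] makes the right side exceed [2 * tau]. *)
have [s [s1 sE]] : exists s : R, 1 < s /\ s ^+ 2 + s^-1 ^+ 2 = (nsq z + nsq w) / tau.
  have [|s [? ?]] := @sum_recip R ((nsq z + nsq w) / tau); last by exists s.
  by rewrite ltr_pdivlMr//; move: nzw nzw0; clear; lra.
have s0 : 0 < s by apply: lt_trans s1.
have sN0 : s%:C != 0 :> C by rewrite realc_eq0 gt_eqF.
pose Dl : R := s ^+ 2 - s^-1 ^+ 2.
have sV1 : s^-1 < 1 by rewrite invf_lt1.
have Dl0 : 0 < Dl.
  by rewrite subr_gt0 ltr_pXn2r ?nnegrE ?invr_ge0 ?(ltW s0)// (lt_trans sV1).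
have DlN : Dl%:C != 0 :> C by rewrite realc_eq0 gt_eqF.
have realcB (x y : R) : (x - y)%:C = x%:C - y%:C :> C by exact: rmorphB.
(* [P] and [Q] solve the system [z = s P + s^-1 Q], [w = s^-1 P + s Q], whose determinant is
   [Dl]. *)
pose P := (Dl^-1)%:C *: (s%:C *: z - (s^-1)%:C *: w).
pose Q := (Dl^-1)%:C *: (s%:C *: w - (s^-1)%:C *: z).
have conjr (x : R) : (x%:C : C)^*%C = x%:C by rewrite conjc_real.
have wz : dot w z = tau%:C by rewrite dotC zw conjr.
have PQ : dot P Q = 0.
  rewrite /P /Q !(dotZl, dotZr, dotBl, dotBr) !conjr zw wz !dotE.
  rewrite [X in _ * (_ * X)](_ : _ = 0) ?mulr0//.
  have e : (s ^+ 2 + s^-1 ^+ 2) * tau = nsq z + nsq w by rewrite sE mulfVK// gt_eqF.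
  rewrite -!realcM -!rmorphB/= -!realcM -!rmorphB/=; congr (_%:C).
  have -> : s * (s * tau - s^-1 * nsq z) - s^-1 * (s * nsq w - s^-1 * tau)
    = (s ^+ 2 + s^-1 ^+ 2) * tau - (nsq z + nsq w) by field; rewrite gt_eqF.
  by rewrite e subrr.
have QP : dot Q P = 0 by rewrite dotC PQ conjc0.
have DlE : Dl%:C = s%:C ^+ 2 - (s^-1)%:C ^+ 2 :> C by rewrite /Dl realcB !realcX.
have zE : z = s%:C *: P + (s^-1)%:C *: Q.
  apply/matrixP => i j; rewrite !mxE.
  have -> : s%:C * ((Dl^-1)%:C * (s%:C * z i j - (s^-1)%:C * w i j)) +
    (s^-1)%:C * ((Dl^-1)%:C * (s%:C * w i j - (s^-1)%:C * z i j)) =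
    (Dl^-1)%:C * ((s%:C ^+ 2 - (s^-1)%:C ^+ 2) * z i j) by ring.
  by rewrite -DlE realcV mulKf.
have wE : w = (s^-1)%:C *: P + s%:C *: Q.
  apply/matrixP => i j; rewrite !mxE.
  have -> : (s^-1)%:C * ((Dl^-1)%:C * (s%:C * z i j - (s^-1)%:C * w i j)) +
    s%:C * ((Dl^-1)%:C * (s%:C * w i j - (s^-1)%:C * z i j)) =
    (Dl^-1)%:C * ((s%:C ^+ 2 - (s^-1)%:C ^+ 2) * w i j) by ring.
  by rewrite -DlE realcV mulKf.
have PE : P = (Dl^-1)%:C *: (s%:C *: z - (s^-1)%:C *: w) by [].
have QE : Q = (Dl^-1)%:C *: (s%:C *: w - (s^-1)%:C *: z) by [].
have DlR : Dl = s ^+ 2 - s^-1 ^+ 2 by [].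
clearbody P Q Dl.
have PPQQ : dot P P + dot Q Q = tau%:C.
  rewrite -zw {1}zE {1}wE !(dotDl, dotDr, dotZl, dotZr) PQ QP !conjr !realcV.
  by field.
pose a (x : C) := x *: P + x^-1 *: Q.
have a_diff x : x != 0 -> differentiable a x.
  move=> x0; apply: differentiableD; apply: differentiable_Z; first exact: ex_diff.
  exact: diffable_inv.
have a_real (x : R) : 0 < x -> a x%:C =
   ((x * s - (x * s)^-1) / Dl)%:C *: z + ((s / x - x / s) / Dl)%:C *: w.
  move=> x0; rewrite /a PE QE -realcV; apply/matrixP => i j; rewrite !mxE.
  rewrite !(realcM, realcV, realcB).
  have xN : x%:C != 0 :> C by rewrite realc_eq0 gt_eqF.
  by field; rewrite xN sN0 DlN.
have a_D (x : R) : s^-1 <= x <= s -> D (a x%:C).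
  move=> /andP[x1 x2]; have x0 : 0 < x by apply: lt_le_trans x1; rewrite invr_gt0.
  have sx : 1 <= x * s by rewrite mulrC -ler_pdivrMl// mulr1.
  have sumE : (x * s - (x * s)^-1) / Dl + (s / x - x / s) / Dl = (x + x^-1) / (s + s^-1).
    have -> : Dl = (s + s^-1) * (s - s^-1) by rewrite DlR; ring.
    have d0 : s - s^-1 != 0 by rewrite subr_eq0 gt_eqF// (lt_trans sV1).
    have q0' : s + s^-1 != 0 by rewrite gt_eqF// addr_gt0// invr_gt0.
    have -> : (x * s)^-1 = x^-1 * s^-1 by rewrite invfM.
    rewrite -mulrDl (_ : x * s - x^-1 / s + (s / x - x / s) = (x + x^-1) * (s - s^-1)); last by ring.
    by rewrite invfM mulrACA divff// mulr1.
  have q0 : 0 < s + s^-1 by rewrite addr_gt0// invr_gt0.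
  rewrite a_real//; apply: Dzw; rewrite ?sumE.
  - rewrite divr_ge0 ?(ltW Dl0)// subr_ge0 (le_trans _ sx)// invf_le1//.
    by rewrite mulr_gt0.
  - rewrite divr_ge0 ?(ltW Dl0)// subr_ge0 (@le_trans _ _ 1)//.
      by rewrite ler_pdivrMr ?mul1r.
    by rewrite ler_pdivlMr ?mul1r.
  - rewrite ler_pdivrMr// mul1r -subr_ge0.
    have -> : s + s^-1 - (x + x^-1) = (s - x) * (x * s - 1) / (x * s).
      by field; rewrite !gt_eqF.
    by rewrite divr_ge0 ?mulr_ge0 ?subr_ge0// ltW.
  (* The sum of the two coefficients is [(x + x^-1) / (s + s^-1)], so the right side of the required
     bound is [(x + x^-1) ^+ 2 * tau], and [x + x^-1 >= 2]. *)
  - have -> : nsq z + nsq w + 2 * tau = (s + s^-1) ^+ 2 * tau.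
      have -> : (s + s^-1) ^+ 2 = (s ^+ 2 + s^-1 ^+ 2) + 2 by field; rewrite gt_eqF.
      by rewrite [RHS]mulrDl sE mulfVK// gt_eqF.
    have -> : ((x + x^-1) / (s + s^-1)) ^+ 2 * ((s + s^-1) ^+ 2 * tau) =
      (4 + (x - x^-1) ^+ 2) * tau.
      rewrite expr_div_n mulrA mulfVK; last by rewrite expf_neq0 ?gt_eqF.
      by congr (_ * _); field; rewrite gt_eqF.
    by rewrite ler_pM2r// lerDl sqr_ge0.
pose U : set C := [set x | x != 0 /\ D (a x)].
have oU x : U x -> nbhs x U.
  move=> [x0 Dx]; apply: filterI.
    by apply/nbhs_complexP; have := continuous_neq0 (@cvg_id _ (nbhs x)) x0.
  exact: (differentiable_continuous (a_diff _ x0) (oD _ Dx)).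
have circ (x : C) : `|x| = 1 -> x^*%C = x^-1.
  by move=> x1; rewrite invc_norm x1 expr1n invr1 mul1r.
have a_circ x : `|x| = 1 -> a (x^*%C)^-1 = a x.
  by move=> /circ ->; rewrite invrK.
have nsq_circ x : `|x| = 1 -> nsq (a x) = tau.
  move=> x1; have xN : x != 0 by rewrite -normr_eq0 x1 oner_eq0.
  apply: complexI; rewrite -dotE /a !(dotDl, dotDr, dotZl, dotZr) PQ QP fmorphV/= circ// invrK.
  by rewrite !mulr0 addr0 add0r mulrA divff// mul1r mulrA mulVf// mul1r.
pose h (x : C) := \sum_(k < m) F (a x) k 0 * (F (a (x^*%C)^-1) k 0)^*%C - kappa%:C.
pose line (t : C) := 1 + t * (s - 1)%:C.
have : (fun t => h (line t)) 1 = 0.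
  apply: (@identity_segment R (fun t => h (line t))).
    have line_diff t : differentiable line t.
      by apply: diffable_add; [exact: diffable_cst|apply: diffable_mul; [exact: ex_diff|exact: diffable_cst]].
    have lineJ t : (line t)^*%C = line t^*%C by rewrite /line conjcD conjcM conjc1 conjr.
    move=> t /andP[t0 t1]; pose x := 1 + t * (s - 1).
    have xE : line t%:C = x%:C by rewrite /x realcD realcM.
    have s10 : 0 <= s - 1 by rewrite subr_ge0 ltW.
    have x1 : 1 <= x by rewrite lerDl mulr_ge0.
    have xs : x <= s by rewrite -lerBrDl ler_piMl.
    have x0 : 0 < x by apply: lt_le_trans x1.
    have Ux : U x%:C.
      split; first by rewrite realc_eq0 gt_eqF.
      by apply: a_D; rewrite xs andbT (le_trans (ltW sV1)).
    have UVx : U (x^-1)%:C.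
      split; first by rewrite realc_eq0 invr_eq0 gt_eqF.
      by apply: a_D; rewrite lef_pV2 ?posrE// xs/= (@le_trans _ _ 1) ?invf_le1// ltW.
    have near1 : nbhs (t%:C : C) (fun t => U (line t)).
      by apply: (differentiable_continuous (line_diff _)); rewrite xE; exact: oU.
    have near2 : nbhs (t%:C : C) (fun t => U ((line t)^*%C)^-1).
      have c : {for t%:C, continuous (fun t => ((line t)^*%C)^-1)}.
        apply: (@continuous_comp C C C (fun t => (line t)^*%C) (fun t => t^-1)).
          apply: (@continuous_comp C C C line (fun t => t^*%C)).
            exact: differentiable_continuous.
          exact: continuous_conj.
        by rewrite xE conjr; apply: inv_continuous; rewrite realc_eq0 gt_eqF.
      by apply: c; rewrite xE conjr -realcV; exact: oU.
    apply: (@filterS _ _ (nbhs_filter _) _ _ _ (filterI near1 near2)) => t' [[h1 h2] [h3 h4]].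
    apply/derivable1_diffP/diffable_sub; last exact: diffable_cst.
    apply: diffable_sum => k _; apply: diffable_mul.
      apply: (@differentiable_comp _ _ _ _ (a \o line) (fun y => F y k 0)).
        by apply: (@differentiable_comp _ _ _ _ line a); [exact: line_diff|exact: a_diff].
      by apply: differentiable_coordinate; exact: dF.
    (* [line] has real coefficients and commutes with conjugation, so the conjugated factor has the
       shape of Schwarz reflection. *)
    have := @derivable_conj R (fun y => F (a (line y)^-1) k 0) t'.
    under [X in _ -> derivable X _ _]eq_fun do rewrite -lineJ.
    move=> hJ; apply/derivable1_diffP/hJ/derivable1_diffP.
    rewrite invr_eq0 lineJ in h3; rewrite lineJ in h4.
    apply: (@differentiable_comp _ _ _ _ (fun y => a (line y)^-1) (fun y => F y k 0)).
      apply: (@differentiable_comp _ _ _ _ (fun y => (line y)^-1) a).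
        exact: diffable_inv.
      by apply: a_diff; rewrite invr_eq0.
    by apply: differentiable_coordinate; exact: dF.
  apply: unit_circle_cluster => //.
  have U1 : U 1.
    split; first exact: oner_neq0.
    by apply: (a_D 1); rewrite (ltW sV1) ltW.
  have /nbhs_complexP[r r0 rU] := oU _ U1.
  exists r => // x x1 /rU[_ Dx].
  rewrite /h a_circ// -/(dot (F (a x)) (F (a x))) dotE FE//; first exact: subrr.
  exact: nsq_circ.
rewrite /h /line mul1r realcB subrKC conjr -realcV.
have -> : a s%:C = z by rewrite /a -realcV -zE.
have -> : a (s^-1)%:C = w by rewrite /a -realcV invrK -wE.
by move/subr0_eq.
Qed.
End Polarization.

(** * Spanning families and normals of hyperplanes *)

Section LinearAlgebra.
Variable R : realType.
Local Notation C := R[i].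

(** A free tuple in [Y] of maximal length spans a subspace containing [Y], so its length is [N]. *)
Lemma spanning_points N (Y : set 'cV[C]_N) :
  (forall V : {vspace 'cV[C]_N}, (forall y, Y y -> y \in V) -> \dim V = N) ->
  exists2 y : 'I_N -> 'cV[C]_N, (forall j, Y (y j)) & \det (\matrix_(j, k) y j k 0) != 0.
Proof.
move=> hY.
pose p k := `[< exists t : k.-tuple 'cV[C]_N, free t /\ forall i, Y (tnth t i) >].
have dimN : \dim {: 'cV[C]_N} = N by rewrite dimvf /dim/= muln1.
have p0 : exists k, p k.
  by exists 0%N; apply/asboolP; exists [tuple]; split; [exact: nil_free|case].
have pb k : p k -> (k <= N)%N.
  move=> /asboolP[t [ft _]]; rewrite -[leqRHS]dimN -(size_tuple t).
  by move: ft; rewrite /free => /eqP <-; exact: dimvS (subvf _).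
case: (ex_maxnP p0 pb) => k /asboolP[t [ft tY]] kmax.
have kN : k = N.
  rewrite -(hY <<t>>%VS); last first.
    move=> y Yy; apply: contrapT => /negP yt.
    have /kmax : p k.+1.
      apply/asboolP; exists [tuple of y :: t]; rewrite free_cons yt ft; split=> // i.
      by case: (unliftP ord0 i) => [j ->|->]; [rewrite tnthS|].
    by rewrite ltnn.
  by move: ft; rewrite /free size_tuple => /eqP.
move: t ft tY {kmax}; rewrite kN => t ft tY.
exists (tnth t) => //.
rewrite -unitfE -unitmxE -row_free_unit; apply: inj_row_free => v vA.
apply/rowP => i; rewrite mxE; have /freeP/(_ (fun i => v 0 i)) := ft; apply.
apply/matrixP => k0 j; rewrite ord1 {j} summxE mxE.
have /rowP/(_ k0) := vA; rewrite !mxE => vA0; rewrite -[RHS]vA0; apply: eq_bigr => j _.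
by rewrite !mxE (tnth_nth 0).
Qed.

(** The base point [b] is taken off the affine hull of [X]. A subspace [V] containing all [x - b]
    then contains the direction of the hull and also the vector [v] leading from the hull to [b],
    which lies outside that direction; so [V] is everything. *)
Lemma affine_spanning N (X : set 'cV[C]_N) : (0 < N)%N ->
  affine_dim (aff X) (N - 1) ->
  exists b, forall V : {vspace 'cV[C]_N}, (forall x, X x -> x - b \in V) -> \dim V = N.
Proof.
move=> N0 [p [V0 [dV0 affE]]].
have dimN : \dim {: 'cV[C]_N} = N by rewrite dimvf /dim/= muln1.
have [v vV0] : exists v, v \notin V0.
  apply: contrapT => /forallNP h.
  have : (fullv <= V0)%VS by apply/subvP => x _; have := h x; case: (x \in V0).
  by move=> /dimvS; rewrite dimN dV0 leqNgt subn1 ltn_predL N0.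
exists (p + v) => V XV; apply/eqP; have dVN : (\dim V <= N)%N by rewrite -[leqRHS]dimN dimvS// subvf.
rewrite eqn_leq dVN leqNgt; apply/negP => dV.
have affV : aff X `<=` [set z | z - (p + v) \in V].
  move=> z; apply; split; last by [].
  by exists (\dim V), (p + v), V.
have pa : aff X p by rewrite affE/= subrr mem0v.
have vV : v \in V by have := affV _ pa; rewrite /= opprD addrA subrr add0r memvN.
have V0V : (V0 <= V)%VS.
  apply/subvP => u uV0; have : aff X (p + u) by rewrite affE/= addrAC subrr add0r.
  move=> /affV/=; rewrite opprD addrACA subrr add0r => uvV.
  by rewrite -[u](subrK v) memvD.
have : V0 == V.
  by rewrite -(geq_leqif (dimv_leqif_eq V0V)) dV0 subn1 -ltnS prednK.
by move=> /eqP V0E; rewrite V0E vV in vV0.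
Qed.

Lemma hyperplane_normal n (H : set 'cV[C]_n) : affine_hyperplane H ->
  exists e c, nsq e = 1 /\ forall z, H z -> dot z e = c.
Proof.
move=> [k [p [V [dV HE]]] kn].
pose A := \matrix_(i < \dim V, j < n) (vbasis V)`_i j 0.
have : kermx A^T != 0.
  rewrite -mxrank_eq0 mxrank_ker subn_eq0 -ltnNge (leq_ltn_trans (rank_leq_col _))//.
  by rewrite dV -kn.
move=> /rowV0Pn[v /sub_kermxP vA v0].
pose e0 : 'cV[C]_n := \col_j (v 0 j)^*%C.
have dot0 u : u \in V -> dot u e0 = 0.
  move=> /coord_vbasis ->.
  have dots (I : Type) (r : seq I) (F : I -> 'cV[C]_n) : dot (\sum_(i <- r) F i) e0 = \sum_(i <- r) dot (F i) e0.
    by elim: r => [|i r ih]; rewrite ?big_nil ?dot0l// !big_cons dotDl ih.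
  rewrite dots big1// => i _; rewrite dotZl.
  have /rowP/(_ i) := vA; rewrite !mxE => h.
  rewrite [X in _ * X](_ : _ = 0) ?mulr0// -[RHS]h /dot; apply: eq_bigr => j _.
  by rewrite !mxE conjcK mulrC.
have e00 : 0 < nsq e0.
  rewrite lt_neqAle nsq_ge0 andbT eq_sym; apply: contra v0 => /eqP/nsq_eq0 e0E.
  apply/eqP/rowP => j; have /colP/(_ j) := e0E; rewrite !mxE => /(congr1 conjc).
  by rewrite conjcK conjc0.
exists ((Num.sqrt (nsq e0))^-1%:C *: e0), (dot p ((Num.sqrt (nsq e0))^-1%:C *: e0)); split.
  rewrite nsqZ normc_def/= expr0n/= addr0 sqrtr_sqr real_normK ?num_real// exprVn sqr_sqrtr ?ltW//.
  by rewrite mulVf// gt_eqF.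
move=> z; rewrite HE/= => /dot0; rewrite dotBl !dotZr => /subr0_eq -> //.
Qed.

End LinearAlgebra.

(** * Convexity of the unit ball and identity theorems along segments *)

Section Ball.
Variable R : realType.
Local Notation C := R[i].

Lemma continuous_sum (T : topologicalType) (I : Type) (r : seq I) (F : I -> T -> C) x :
  (forall i, {for x, continuous (F i)}) -> {for x, continuous (fun y => \sum_(i <- r) F i y)}.
Proof.
move=> cF; elim: r => [|i r ih].
  rewrite (_ : (fun y => _) = fun=> 0); first exact: (@cst_continuous _ C).
  by apply/funext => y; rewrite big_nil.
rewrite (_ : (fun y => _) = fun y => F i y + \sum_(i <- r) F i y).
  by apply: (@continuousD C C T _ _ x (cF i) ih).
by apply/funext => y; rewrite big_cons.
Qed.

Lemma continuous_nsq n (z : 'cV[C]_n) : {for z, continuous (@nsq R n)}.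
Proof.
apply: (@continuous_comp _ C R (fun z : 'cV[C]_n => dot z z) (@complex.Re R)); last exact: continuous_Re.
apply: continuous_sum => i.
have ci : {for z, continuous (fun M : 'cV[C]_n => M i 0)}.
  by apply: differentiable_continuous; exact: differentiable_coord.
apply: (@continuousM C _ _ _ z ci).
by apply: (@continuous_comp _ C C (fun M : 'cV[C]_n => M i 0) (@conjc R)); [exact: ci|exact: continuous_conj].
Qed.

Lemma open_nsq_lt n (c : R) (z : 'cV[C]_n) : nsq z < c -> nbhs z [set u | nsq u < c].
Proof.
by move=> zc; exact: (@continuous_nsq n z _ (lt_nbhsl zc)).
Qed.

Lemma open_unit_ball n (z : 'cV[C]_n) : unit_ball z -> nbhs z (@unit_ball R n).
Proof.
rewrite unit_ballE => /open_nsq_lt; apply: (@filterS _ _ (nbhs_filter z)) => u.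
by rewrite unit_ballE.
Qed.

Lemma unit_ballZ n (t : C) (w : 'cV[C]_n) : `|t| <= 1 -> unit_ball w -> unit_ball (t *: w).
Proof.
rewrite !unit_ballE nsqZ => t1 wB; apply: le_lt_trans wB.
by rewrite ler_piMl ?nsq_ge0// expr_le1// ?Re_norm_ge0// -lecR -normCRe.
Qed.

(** The right side exceeds the left by exactly [lam * mu * nsq (z - w)]. *)
Lemma nsq_convex n (lam mu : R) (z w : 'cV[C]_n) : 0 <= lam -> 0 <= mu ->
  nsq (lam%:C *: z + mu%:C *: w) <= (lam + mu) * (lam * nsq z + mu * nsq w).
Proof.
move=> l0 m0; rewrite -[X in _ + X]opprK -scaleNr nsqB scaleNr.
have nr (c : R) (u : 'cV[C]_n) : nsq (c%:C *: u) = c ^+ 2 * nsq u.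
  by rewrite nsqZ normc_def/= expr0n/= addr0 sqrtr_sqr real_normK ?num_real.
have nN (u : 'cV[C]_n) : nsq (- u) = nsq u.
  by rewrite /nsq dotNl dotNr opprK.
rewrite nN !nr dotNr dotZl dotZr conjc_real -subr_ge0.
have := mulr_ge0 (mulr_ge0 l0 m0) (nsq_ge0 (z - w)); rewrite nsqB.
have -> : complex.Re (- (lam%:C * (mu%:C * dot z w))) = - (lam * (mu * complex.Re (dot z w))).
  by case: (dot z w) => a b /=; ring.
by move=> h; apply: le_trans h _; rewrite le_eqVlt; apply/orP; left; apply/eqP; ring.
Qed.

Lemma unit_ball_convex n (lam mu : R) (z w : 'cV[C]_n) : 0 <= lam -> 0 <= mu -> lam + mu <= 1 ->
  unit_ball z -> unit_ball w -> unit_ball (lam%:C *: z + mu%:C *: w).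
Proof.
rewrite !unit_ballE => l0 m0 lm z1 w1; apply: le_lt_trans (nsq_convex z w l0 m0) _.
move: l0 lm; rewrite le_eqVlt => /predU1P[<- lm|l0 lm].
  rewrite !(mul0r, add0r) mulrA -expr2; apply: (@le_lt_trans _ _ (1 * nsq w)); last by rewrite mul1r.
  by rewrite ler_wpM2r ?nsq_ge0// expr_le1//; move: lm; rewrite add0r.
have h1 : lam * nsq z < lam by rewrite gtr_pMr.
have h2 : mu * nsq w <= mu by rewrite ler_piMr// ltW.
have s0 : 0 < lam + mu by rewrite ltr_pwDl.
have h3 : lam * nsq z + mu * nsq w < lam + mu by rewrite ltr_leD.
apply: (@lt_le_trans _ _ ((lam + mu) * (lam + mu))); first by rewrite ltr_pM2l.
by rewrite mulr_ile1// ltW.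
Qed.

Lemma ball_polarization n m (f : 'cV[C]_n -> 'cV[C]_m) (r rho : R) z w :
  holomorphic_on unit_ball f -> 0 < r -> 0 <= rho -> f @` sphere r `<=` sphere rho ->
  unit_ball z -> unit_ball w -> dot z w = (r ^+ 2)%:C -> dot (f z) (f w) = (rho ^+ 2)%:C.
Proof.
move=> hf r0 rho0 fr zB wB; apply: (@polarization R n m f unit_ball) => //.
- by rewrite exprn_gt0.
- exact: open_unit_ball.
- move=> u _ /(sphereP u (ltW r0)) ur; apply/(sphereP _ rho0); apply: fr.
  by exists u.
- by move=> lam mu l0 m0 lm _; exact: unit_ball_convex.
Qed.

Lemma segment_interp n (z w : 'cV[C]_n) (t : R) :
  z + t%:C *: (w - z) = (1 - t)%:C *: z + t%:C *: w.
Proof.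
rewrite scalerBr addrA -[X in X + _ - _]scale1r addrAC -scalerBl; congr (_ *: _ + _).
by rewrite [RHS]rmorphB.
Qed.

Lemma unit_ball_segment n (z w : 'cV[C]_n) (t : R) : 0 <= t <= 1 ->
  unit_ball z -> unit_ball w -> unit_ball (z + t%:C *: (w - z)).
Proof.
move=> /andP[t0 t1] zB wB; rewrite segment_interp; apply: unit_ball_convex => //.
  by rewrite subr_ge0.
by rewrite subrK.
Qed.

Lemma line_differentiable n (z w : 'cV[C]_n) (t : C) : differentiable (fun t : C => z + t *: w) t.
Proof.
apply: differentiableD; first exact: differentiable_cst.
by apply: differentiable_Z; exact: ex_diff.
Qed.

Lemma identity_line n (h : 'cV[C]_n -> C) (D : set 'cV[C]_n) (z w : 'cV[C]_n) :
  (forall u, D u -> nbhs u D) -> (forall u, D u -> differentiable h u) ->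
  (forall t : R, 0 <= t <= 1 -> D (z + t%:C *: (w - z))) ->
  zeros_cluster (fun t => h (z + t *: (w - z))) 0 -> h w = 0.
Proof.
move=> oD dh Dzw acc.
have := @identity_segment R (fun t => h (z + t *: (w - z))); rewrite scale1r subrKC; apply=> //.
move=> t /Dzw Dt; have := differentiable_continuous (line_differentiable z (w - z) t%:C).
move=> /(_ _ (oD _ Dt)); apply: (@filterS _ _ (nbhs_filter _)) => t' Dt'.
apply/derivable1_diffP; apply: (@differentiable_comp C C 'cV[C]_n C (fun t => z + t *: (w - z)) h).
  exact: line_differentiable.
exact: dh.
Qed.

Lemma identity_near n (h : 'cV[C]_n -> C) (D : set 'cV[C]_n) (z w : 'cV[C]_n) :
  (forall u, D u -> nbhs u D) -> (forall u, D u -> differentiable h u) ->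
  (forall t : R, 0 <= t <= 1 -> D (z + t%:C *: (w - z))) ->
  nbhs z (fun u => h u = 0) -> h w = 0.
Proof.
move=> oD dh Dzw hz; apply: (identity_line oD dh Dzw); apply: near_zero_cluster.
have := differentiable_continuous (line_differentiable z (w - z) 0).
by move=> /(_ (fun u => h u = 0)); apply; rewrite scale0r addr0.
Qed.

Lemma identity_disc (h : C -> C) (r : R) c1 c2 :
  (forall c, `|c| < r%:C -> derivable h c 1) ->
  `|c1| < r%:C -> `|c2| < r%:C -> zeros_cluster h c1 -> h c2 = 0.
Proof.
move=> dh h1 h2 acc.
have near (c : C) : `|c| < r%:C -> nbhs c [set c | `|c| < r%:C].
  move=> cr; apply/nbhs_complexP; exists (r - complex.Re `|c|).
    by rewrite subr_gt0 -ltcR -normCRe.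
  move=> w wc; rewrite /= -(subrK c w); apply: (le_lt_trans (ler_normD _ _)).
  by rewrite -ltrBrDr [`|c|]normCRe -[X in _ < X]rmorphB.
have [<-|c12] := eqVneq c1 c2.
  have dh1 : nbhs c1 (fun c => derivable h c 1).
    by apply: (@filterS C (nbhs c1) (nbhs_filter _) _ _ dh); exact: near.
  by have [d d0] := zeros_cluster_nbhs dh1 acc; apply; rewrite subrr normr0 ltcR.
have cN : c2 - c1 != 0 by rewrite subr_eq0 eq_sym.
have ld t : differentiable (fun t : C => c1 + t * (c2 - c1)) t.
  by apply: diffable_add; [exact: diffable_cst|apply: diffable_mul; [exact: ex_diff|exact: diffable_cst]].
pose g (t : C) := h (c1 + t * (c2 - c1)).
have -> : h c2 = g 1 by rewrite /g mul1r subrKC.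
apply: identity_segment.
  move=> t /andP[t0 t1].
  have tr : `|c1 + t%:C * (c2 - c1)| < r%:C.
    have -> : c1 + t%:C * (c2 - c1) = (1 - t)%:C * c1 + t%:C * c2.
      by rewrite [(1 - t)%:C]rmorphB/=; ring.
    apply: (le_lt_trans (ler_normD _ _)); rewrite !normrM !(ger0_norm (x := _%:C)) ?ler0c ?subr_ge0//.
    move: h1 h2; rewrite (normCRe c1) (normCRe c2) -!realcM -realcD !ltcR.
    set p := complex.Re _; set q := complex.Re _ => pr qr.
    apply: (@le_lt_trans _ _ (Num.max p q)); last by rewrite gt_max pr qr.
    have -> : Num.max p q = (1 - t) * Num.max p q + t * Num.max p q by ring.
    apply: lerD; apply: ler_wpM2l; rewrite ?subr_ge0//.
      by rewrite le_max lexx.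
    by rewrite le_max lexx orbT.
  have near_t := differentiable_continuous (ld t%:C) (near _ tr).
  apply: (@filterS C (nbhs (t%:C : C)) (nbhs_filter _) [set t' | `|c1 + t' * (c2 - c1)| < r%:C]
    (fun t => derivable g t 1) _ near_t) => t' dt'.
  apply/derivable1_diffP; apply: (@differentiable_comp C C C C (fun t => c1 + t * (c2 - c1)) h).
    exact: ld.
  by apply/derivable1_diffP; exact: dh.
move=> d d0; have e0 : 0 < d * complex.Re `|c2 - c1|.
  by rewrite mulr_gt0// -ltcR -normCRe normr_gt0.
have [c [cc1 cd hc]] := acc _ e0.
exists ((c - c1) / (c2 - c1)); split.
- by rewrite mulf_neq0 ?subr_eq0// invr_eq0.
- by rewrite subr0 normrM normfV ltr_pdivrMr ?normr_gt0// [`|c2 - _|]normCRe -realcM.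
- by rewrite /g mulfVK// subrKC.
Qed.

End Ball.

(** * Extension across the sphere *)

Section GenericSlice.
Variable R : realType.
Local Notation C := R[i].
Local Notation nC := (fun z : C => complex.Re `|z|).

Lemma nsq_orthogonal n (e y : 'cV[C]_n) (c t : C) : nsq e = 1 -> dot y e = 0 ->
  nsq (c *: e + t *: y) = complex.Re `|c| ^+ 2 + complex.Re `|t| ^+ 2 * nsq y.
Proof.
move=> e1 ye; have ey : dot e y = 0 by rewrite dotC ye conjc0.
apply: complexI; rewrite -dotE dotDl !dotDr !dotZl !dotZr ye ey !mulr0 addr0 add0r.
rewrite realcD [X in _ = X + _]realcX [X in _ = _ + X]realcM realcX -!normCRe !sqr_normc !mulrA.
by rewrite !dotE e1 mulr1.
Qed.

(** Invertibility with base point [b] expresses what the rank hypothesis provides; invertibility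
    with base point [0] is what Cramer's rule consumes. *)
Definition value_mx n N (f : 'cV[C]_n -> 'cV[C]_N) (b : 'cV[C]_N) (z : 'I_N -> 'cV[C]_n) : 'M[C]_N :=
  \matrix_(j, k) (f (z j) k 0 - b k 0).

Lemma value_det_differentiable n N (V : normedModType C) (f : 'cV[C]_n -> 'cV[C]_N) (b : 'cV[C]_N)
    (z : V -> 'I_N -> 'cV[C]_n) t :
  (forall j, differentiable (fun t => z t j) t) -> (forall j, differentiable f (z t j)) ->
  differentiable (fun t => \det (value_mx f b (z t))) t.
Proof.
move=> dz df; apply: diffable_det => j k.
rewrite (_ : (fun y => _) = (fun t => f (z t j) k 0 - b k 0)); last by apply/funext => y; rewrite mxE.
apply: diffable_sub; last exact: diffable_cst.
apply: (@differentiable_comp _ _ _ _ (fun t => z t j) (fun u => f u k 0)) => //.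
exact: differentiable_coordinate.
Qed.

Variables (n N : nat) (f : 'cV[C]_n -> 'cV[C]_N) (r rho : R).
Hypothesis hf : holomorphic_on unit_ball f.
Hypotheses (r0 : 0 < r) (r1 : r < 1) (rho0 : 0 < rho).
Hypothesis pol : forall z w, unit_ball z -> unit_ball w -> dot z w = (r ^+ 2)%:C ->
  dot (f z) (f w) = (rho ^+ 2)%:C.

(* Pairing a linear relation among the [f (z j)] with [f w] shows that its
   coefficients sum to [0]. *)
Lemma value_det_shift (z : 'I_N -> 'cV[C]_n) b w : unit_ball w ->
  (forall j, unit_ball (z j) /\ dot (z j) w = (r ^+ 2)%:C) ->
  \det (value_mx f 0 z) = 0 -> \det (value_mx f b z) = 0.
Proof.
move=> wB zw /eqP/det0P[v v0 vM]; apply/eqP/det0P; exists v => //.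
have vf k : \sum_j v 0 j * f (z j) k 0 = 0.
  have /rowP/(_ k) := vM; rewrite !mxE => h; rewrite -[RHS]h; apply: eq_bigr => j _.
  by rewrite !mxE subr0.
have vs : \sum_j v 0 j = 0.
  have rN : (rho ^+ 2)%:C != 0 :> C by rewrite realc_eq0 expf_neq0// gt_eqF.
  apply: (mulIf rN); rewrite mul0r mulr_suml.
  rewrite (eq_bigr (fun j => \sum_k v 0 j * f (z j) k 0 * (f w k 0)^*%C)).
    by rewrite exchange_big big1// => k _; rewrite -mulr_suml vf mul0r.
  move=> j _; have [zB zwj] := zw j; rewrite -(pol zB wB zwj) mulr_sumr.
  by apply: eq_bigr => k _; rewrite mulrA.
apply/rowP => k; rewrite !mxE.
rewrite (eq_bigr (fun j => v 0 j * f (z j) k 0 - v 0 j * b k 0)).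
  by rewrite sumrB vf -mulr_suml vs mul0r subrr.
by move=> j _; rewrite mxE mulrBr.
Qed.

(* Shrinking the points towards [c0 e] and sliding them along [e] keeps them in
   the ball while [c] ranges over a disc.  The determinant with base point [b]
   does not vanish identically on that disc, and by [value_det_shift] it would if
   the one with base point [0] did. *)
Lemma generic_slice (e : 'cV[C]_n) c0 b (z : 'I_N -> 'cV[C]_n) (c1 : C) (S : set C) :
  (0 < N)%N -> nsq e = 1 -> (forall j, unit_ball (z j) /\ dot (z j) e = c0) ->
  \det (value_mx f b z) != 0 -> `|c1| < 1 ->
  (forall d : R, 0 < d -> exists c, [/\ S c, c != c1 & `|c - c1| < d%:C]) ->
  exists c z', [/\ S c, `|c| < 1, forall j, unit_ball (z' j) /\ dot (z' j) e = c &
    \det (value_mx f 0 z') != 0].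
Proof.
move=> N0 e1 zB detb c11 acc.
pose y j := z j - c0 *: e.
have ye j : dot (y j) e = 0.
  by rewrite /y dotBl dotZl (zB j).2 dotE e1 mulr1 subrr.
pose p (c t : C) j := c *: e + t *: y j.
have pE c t j : nsq (p c t j) = nC c ^+ 2 + nC t ^+ 2 * nsq (y j) by exact: nsq_orthogonal.
have nC0 c : 0 <= nC c by exact: Re_norm_ge0.
have zE j : z j = p c0 1 j by rewrite /p scale1r subrKC.
have nz j : nC c0 ^+ 2 + nsq (y j) < 1.
  by have := (zB j).1; rewrite unit_ballE zE pE normr1/= expr1n mul1r.
have ny j : nsq (y j) < 1 by apply: le_lt_trans (nz j); rewrite lerDr sqr_ge0.
have c01 : nC c0 < 1.
  rewrite -(@expr_lt1 _ 2)//; apply: le_lt_trans (nz (Ordinal N0)).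
  by rewrite lerDl nsq_ge0.
have c11' : nC c1 < 1 by rewrite -ltcR -normCRe.
have pe c t j : dot (p c t j) e = c.
  by rewrite /p dotDl !dotZl ye mulr0 addr0 dotE e1 mulr1.
have pB c t j : nC c ^+ 2 + nC t ^+ 2 <= 1 -> nC t != 0 -> unit_ball (p c t j).
  move=> h t0; rewrite unit_ballE pE; apply: lt_le_trans h; rewrite ltrD2l.
  by rewrite gtr_pMr// exprn_gt0// lt_neqAle eq_sym t0 nC0.
have p_diff_c t c j : differentiable (fun c : C => p c t j) c.
  apply: differentiableD; last exact: differentiable_cst.
  by apply: differentiable_Z; exact: ex_diff.
have p_diff_t c t j : differentiable (fun t : C => p c t j) t.
  apply: differentiableD; first exact: differentiable_cst.
  by apply: differentiable_Z; exact: ex_diff.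
(* The determinant is holomorphic in [t] near [[0, 1]] and nonzero at [t = 1], where the points are
   the original [z j]; hence its zeros cannot cluster at [t = 0]. *)
have [d d0 dP] : exists2 d : R, 0 < d & forall t : C, t != 0 -> `|t| < d%:C ->
    \det (value_mx f b (p c0 t)) != 0.
  apply: contrapT => hno.
  move/eqP: detb; apply.
  have -> : value_mx f b z = value_mx f b (p c0 1).
    by congr value_mx; apply/funext.
  apply: (@identity_segment R (fun t => \det (value_mx f b (p c0 t)))).
    move=> t /andP[t0 t1].
    have tB j : unit_ball (p c0 t%:C j).
      rewrite unit_ballE pE [`|t%:C|]ger0_norm ?ler0c//=; apply: le_lt_trans (nz j).
      by rewrite lerD2l ler_piMl ?nsq_ge0// expr_le1.
    have near_t : nbhs (t%:C : C) [set t' | forall j, unit_ball (p c0 t' j)].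
      apply: (@filter_forall C 'I_N (fun j t' => unit_ball (p c0 t' j)) (nbhs (t%:C : C)) (nbhs_filter _)) => j.
      exact: (differentiable_continuous (p_diff_t c0 t%:C j) (open_unit_ball (tB j))).
    apply: (@filterS C (nbhs (t%:C : C)) (nbhs_filter _) _ _ _ near_t) => t' tB'.
    apply/derivable1_diffP/value_det_differentiable => j; first exact: p_diff_t.
    exact: hf.
  move=> d d0; apply: contrapT => hd; apply: hno; exists d => // t t0 td.
  by apply/eqP => ht; apply: hd; exists t; rewrite subr0.
(* The radius [R0 < 1] is made to exceed [|c0|], [|c1|] and [r ^+ 2], so that one disc contains the
   starting height, the cluster point and part of the region [|c| > r ^+ 2] where the pole lies in
   the ball. Taking [t < 1 - R0] then keeps all the shifted points in the ball. *)
pose m := Num.max (Num.max (nC c0) (nC c1)) (r ^+ 2).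
have r21 : r ^+ 2 < 1 by rewrite expr_lt1// ltW.
have m1 : m < 1 by rewrite !gt_max c01 c11' r21.
pose R0 := (m + 1) / 2.
have /andP[mR0 R01] : m < R0 < 1 by rewrite /R0; have [-> ->] := midf_lt m1.
have : [/\ nC c0 < R0, nC c1 < R0 & r ^+ 2 < R0].
  by move: mR0; rewrite !gt_max => /andP[/andP[? ?] ?].
move=> [c0R c1R rR].
have R00 : 0 <= R0 by apply: le_trans (ltW c0R).
have [t t0 /andP[td tR]] : exists2 t : R, 0 < t & (t < d) && (t < 1 - R0).
  exists (Num.min d (1 - R0) / 2).
    by rewrite divr_gt0// lt_min d0 subr_gt0.
  by rewrite -lt_min ltr_pdivrMr// ltr_pMr ?ltr1n// lt_min d0 subr_gt0.
have nt : `|t%:C : C| = t%:C by rewrite ger0_norm// ler0c ltW.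
have nCt : complex.Re `|t%:C : C| = t by rewrite nt.
have ball c j : `|c| < R0%:C -> unit_ball (p c t%:C j).
  rewrite normCRe ltcR => cR; apply: pB; last by rewrite nCt gt_eqF.
  rewrite nCt; apply: (@le_trans _ _ (R0 + t)); last by rewrite -lerBrDl ltW.
  apply: lerD.
    apply: (@le_trans _ _ (R0 ^+ 2)); first by rewrite lerXn2r ?nnegrE// ltW.
    by rewrite expr2 ler_piMl// ltW.
  by rewrite expr2 ler_piMl ?ltW// (lt_le_trans tR)// gerBl.
have Dder b' c : `|c| < R0%:C -> derivable (fun c => \det (value_mx f b' (p c t%:C))) c 1.
  move=> cR; apply/derivable1_diffP/value_det_differentiable => j; first exact: p_diff_c.
  by apply: hf; exact: ball.
apply: contrapT => hno.
(* If no admissible [c] in [S] worked, the determinant with base point [0] would vanish at points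
   clustering at [c1], hence on the whole disc. *)
have D0 c : `|c| < R0%:C -> \det (value_mx f 0 (p c t%:C)) = 0.
  move=> cR; apply: (identity_disc (Dder 0) _ cR (c1 := c1)).
    by rewrite normCRe ltcR.
  move=> d' d'0; have e0 : 0 < Num.min d' (R0 - nC c1) by rewrite lt_min d'0 subr_gt0.
  have [c' [Sc' cc']] := acc _ e0.
  rewrite normCRe ltcR lt_min -!ltcR -normCRe => /andP[h1 h2].
  have c'R : `|c'| < R0%:C.
    rewrite -(subrK c1 c'); apply: (le_lt_trans (ler_normD _ _)).
    by rewrite -ltrBrDr [`|c1|]normCRe -[X in _ < X]rmorphB.
  exists c'; split=> //; apply: contrapT => /eqP Dc'; apply: hno.
  exists c', (p c' t%:C); split=> //.
    by apply: lt_trans c'R _; rewrite ltcR.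
  by move=> j; split; [exact: ball|exact: pe].
(* For [r ^+ 2 < |c| < R0] the hyperplane [dot z e = c] has a pole in the ball, namely [e] times
   [r ^+ 2] over the conjugate of [c], so [value_det_shift] applies. The determinant with base point
   [b] thus vanishes near the midpoint of [r ^+ 2] and [R0], hence also at [c0], against the choice
   of [t]. *)
have : \det (value_mx f b (p c0 t%:C)) = 0.
  have [h1 h2] := midf_lt rR.
  have c2R : `|((r ^+ 2 + R0) / 2)%:C : C| < R0%:C.
    by rewrite ger0_norm ?ltcR// ler0c divr_ge0// addr_ge0// sqr_ge0.
  apply: (identity_disc (Dder b) c2R); first by rewrite normCRe ltcR.
  apply: near_zero_cluster; apply/nbhs_complexP; exists ((R0 - r ^+ 2) / 2).
    by rewrite divr_gt0// subr_gt0.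
  move=> c cc2.
  have cR : nC c < R0.
    rewrite -ltcR -normCRe -(subrK (((r ^+ 2 + R0) / 2)%:C) c); apply: (le_lt_trans (ler_normD _ _)).
    rewrite -ltrBrDr [`|_%:C|]ger0_norm; last by rewrite ler0c divr_ge0// addr_ge0// sqr_ge0.
    by rewrite -rmorphB/= (_ : R0 - (r ^+ 2 + R0) / 2 = (R0 - r ^+ 2) / 2)//; field.
  have rc : r ^+ 2 < nC c.
    rewrite -ltcR -normCRe.
    have : ((r ^+ 2 + R0) / 2)%:C <= `|c - ((r ^+ 2 + R0) / 2)%:C| + `|c|.
      rewrite -[leLHS]ger0_norm; last by rewrite ler0c divr_ge0// addr_ge0// sqr_ge0.
      by rewrite distrC -{1}(subrK c ((r ^+ 2 + R0) / 2)%:C) ler_normD.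
    move: cc2; rewrite [`|c|]normCRe [`|c - _|]normCRe -realcD ltcR lecR ltcR.
    set a1 := complex.Re _; set a2 := complex.Re _ => u1 u2.
    rewrite -(ltrD2l a1); apply: lt_le_trans u2; rewrite -ltrBrDr; apply: lt_le_trans u1 _.
    by rewrite le_eqVlt; apply/orP; left; apply/eqP; field.
  have cN : c != 0 by rewrite -normr_gt0 normCRe ltcR (le_lt_trans _ rc)// sqr_ge0.
  have cJN : c^*%C != 0 by rewrite conjc_eq0.
  apply: (@value_det_shift _ _ (((r ^+ 2)%:C / c^*%C) *: e)).
  - rewrite unit_ballE nsqZ e1 mulr1 expr_lt1//.
    rewrite normrM normfV normcJ ger0_norm ?ler0c ?sqr_ge0// normCRe -realcV -realcM/=.
    by rewrite ltr_pdivrMr ?mul1r// (le_lt_trans _ rc)// sqr_ge0.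
  - move=> j; split; first by apply: ball; rewrite normCRe ltcR.
    by rewrite dotZr pe conjcM conjc_real conjc_inv conjcK divfK.
  - by apply: D0; rewrite normCRe ltcR.
move/eqP; apply/negP/dP; first by rewrite realc_eq0 gt_eqF.
by rewrite nt ltcR.
Qed.

End GenericSlice.

Section Extension.
Variable R : realType.
Local Notation C := R[i].

Lemma differentiable_dotl n (z w : 'cV[C]_n) : differentiable (fun w => dot w z) w.
Proof.
apply: diffable_sum => i _; apply: diffable_mul; last exact: diffable_cst.
exact: differentiable_coord.
Qed.

Lemma differentiable_continuous_dotr n (z w : 'cV[C]_n) : {for w, continuous (fun w => dot z w)}.
Proof.
rewrite (_ : (fun w => dot z w) = (@conjc R) \o (fun w => dot w z)).
  apply: (@continuous_comp 'cV[C]_n C C (fun w => dot w z) (@conjc R)); last exact: continuous_conj.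
  exact: differentiable_continuous (differentiable_dotl _ _).
by apply/funext => u; exact: dotC.
Qed.

Lemma differentiable_col (V : normedModType C) N (F : V -> 'cV[C]_N) x :
  (forall k, differentiable (fun y => F y k 0) x) -> differentiable F x.
Proof.
move=> dF; rewrite (_ : F = \sum_(k < N) (fun y => F y k 0 *: delta_mx k 0)).
  by apply: differentiable_sum => k; exact: differentiable_Z.
apply/funext => y; rewrite fct_sumE; apply/matrixP => i j; rewrite summxE (bigD1 i)//= big1.
  by rewrite addr0 !mxE !eqxx ord1 eqxx mulr1.
by move=> k ki; rewrite !mxE eq_sym (negbTE ki) mulr0.
Qed.

Variables (n N : nat) (f : 'cV[C]_n -> 'cV[C]_N) (r rho : R).
Hypothesis hf : holomorphic_on unit_ball f.
Hypotheses (r0 : 0 < r).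
Hypothesis pol : forall z w, unit_ball z -> unit_ball w -> dot z w = (r ^+ 2)%:C ->
  dot (f z) (f w) = (rho ^+ 2)%:C.

Section point.
Variables (p : 'cV[C]_n) (z : 'I_N -> 'cV[C]_n).
Hypothesis zB : forall j, unit_ball (z j) /\ dot (z j) p = (r ^+ 2)%:C.
Hypothesis detz : \det (value_mx f 0 z) != 0.

Let zeta (w : 'cV[C]_n) j := ((r ^+ 2)%:C / dot (z j) w) *: z j.
Let M (w : 'cV[C]_n) : 'M[C]_N := \matrix_(j, k) (f (zeta w j) k 0)^*%C.
Let good : set 'cV[C]_n := [set w | forall j, dot (z j) w != 0 /\ unit_ball (zeta w j)].

(* Cramer's rule for the equations [dot (f (zeta w j)) X = rho ^+ 2]; the points
   [zeta w j] are antiholomorphic in [w], so that [M w] is holomorphic. *)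
Definition extend (w : 'cV[C]_n) : 'cV[C]_N :=
  (\det (M w))^-1 *: (\adj (M w) *m const_mx (rho ^+ 2)%:C).

Let rN : (r ^+ 2)%:C != 0 :> C.
Proof. by rewrite realc_eq0 expf_neq0// gt_eqF. Qed.

Let zeta_p j : zeta p j = z j.
Proof. by rewrite /zeta (zB j).2 divff// scale1r. Qed.

Let near_good : nbhs p good.
Proof.
apply: (@filter_forall _ _ (fun j w => dot (z j) w != 0 /\ unit_ball (zeta w j)) (nbhs p) (nbhs_filter _)) => j.
have dN : dot (z j) p != 0 by rewrite (zB j).2.
have cd := @differentiable_continuous_dotr n (z j) p.
apply: (@filterI _ (nbhs p) (nbhs_filter p)).
  have /nbhs_complexP : exists2 d : R, 0 < d & forall t, `|t - dot (z j) p| < d%:C -> t != 0.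
    by have := @continuous_neq0 R id (dot (z j) p) (@cvg_id _ _) dN.
  exact: cd.
have cz : {for p, continuous (fun w => zeta w j)}.
  apply: (@continuous_comp _ C _ (fun w => dot (z j) w) (fun t => ((r ^+ 2)%:C / t) *: z j)); first exact: cd.
  apply/differentiable_continuous/differentiable_Z/diffable_mul; first exact: diffable_cst.
  by apply: diffable_inv; first exact: ex_diff.
by apply: cz; rewrite zeta_p; exact: open_unit_ball (zB j).1.
Qed.

Let M_diff w j k : good w -> differentiable (fun w => M w j k) w.
Proof.
move=> /(_ j)[dN zB'].
pose g (t : C) := f (((r ^+ 2)%:C / t) *: z j) k 0.
rewrite (_ : (fun w => M w j k) = (fun t => (g t^*%C)^*%C) \o (fun w => dot w (z j))); last first.
  by apply/funext => u; rewrite /= /M mxE /g -dotC.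
apply: differentiable_comp; first exact: differentiable_dotl.
apply/derivable1_diffP/derivable_conj/derivable1_diffP; rewrite -dotC.
apply: (@differentiable_comp C C _ C (fun t => ((r ^+ 2)%:C / t) *: z j) (fun u => f u k 0)).
  apply/differentiable_Z/diffable_mul; first exact: diffable_cst.
  by apply: diffable_inv; first exact: ex_diff.
by apply: differentiable_coordinate; exact: hf.
Qed.

Let detM_p : \det (M p) != 0.
Proof.
rewrite (_ : M p = map_mx (@conjc R) (value_mx f 0 z)).
  by rewrite det_map_mx conjc_eq0.
by apply/matrixP => j k; rewrite !mxE zeta_p subr0.
Qed.

Let near_det : nbhs p [set w | \det (M w) != 0].
Proof.
have gp : good p by move: near_good => /nbhs_singleton.
have dd : differentiable (fun w => \det (M w)) p.
  by apply: diffable_det => j k; exact: M_diff.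
have /nbhs_complexP h : exists2 d : R, 0 < d & forall t, `|t - \det (M p)| < d%:C -> t != 0.
  by have := @continuous_neq0 R id (\det (M p)) (@cvg_id _ _) detM_p.
exact: (differentiable_continuous dd h).
Qed.

(** Independence of values survives a small tilt of the hyperplane. This is used below with [1] in
    place of [r], for the hyperplanes [dot z w = 1] with [w] outside the ball. *)
Lemma near_frame : nbhs p [set w | exists2 z' : 'I_N -> 'cV[C]_n,
  (forall j, unit_ball (z' j) /\ dot (z' j) w = (r ^+ 2)%:C) & \det (value_mx f 0 z') != 0].
Proof.
apply: (@filterS _ (nbhs p) (nbhs_filter p) _ _ _ (@filterI _ (nbhs p) (nbhs_filter p) _ _ near_good near_det)).
move=> w [gw dw]; exists (zeta w).
  by move=> j; have [dN zB'] := gw j; rewrite dotZl divfK.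
rewrite -conjc_eq0 -det_map_mx (_ : map_mx _ _ = M w)//.
by apply/matrixP => j k; rewrite !mxE subr0.
Qed.

(** For [w] in the ball, [f w] itself solves the linear system by polarization, and invertibility of
    [M w] makes the solution unique. *)
Lemma extension : nbhs p [set w | differentiable extend w /\ (unit_ball w -> extend w = f w)].
Proof.
apply: (@filterS _ (nbhs p) (nbhs_filter p) _ _ _ (@filterI _ (nbhs p) (nbhs_filter p) _ _ near_good near_det)).
move=> w [gw dw]; split.
  apply: differentiable_col => k.
  rewrite (_ : (fun y => _) = (fun w => (\det (M w))^-1 * \sum_j cofactor (M w) j k * (rho ^+ 2)%:C)); last first.
    by apply/funext => u; rewrite !mxE; congr (_ * _); apply: eq_bigr => j _; rewrite !mxE.
  apply: diffable_mul; first by apply: diffable_inv => //; apply: diffable_det => i j; exact: M_diff.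
  apply: diffable_sum => j _; apply: diffable_mul; last exact: diffable_cst.
  apply: diffable_mul; first exact: diffable_cst.
  apply: diffable_det => i l.
  rewrite (_ : (fun y => _) = (fun y => M y (lift j i) (lift k l))); last by apply/funext => u; rewrite !mxE.
  exact: M_diff.
move=> wB; have Mf : M w *m f w = const_mx (rho ^+ 2)%:C.
  apply/matrixP => j l; rewrite ord1 {l} !mxE.
  have [dN zB'] := gw j.
  have := pol zB' wB; rewrite dotZl divfK// => /(_ erefl)/(congr1 (@conjc R)).
  rewrite conjc_real => <-; rewrite /dot rmorph_sum; apply: eq_bigr => k _.
  by rewrite mxE [RHS]conjcM conjcK.
by rewrite /extend -Mf mulmxA mul_adj_mx mul_scalar_mx scalerA mulVf// scale1r.
Qed.

End point.
End Extension.

(** * Boundary values of the extension *)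

Section Boundary.
Variable R : realType.
Local Notation C := R[i].

Lemma nbhs_normCP (V : normedModType C) (p : V) (P : set V) : nbhs p P ->
  exists2 d : R, 0 < d & forall w, `|w - p| < d%:C -> P w.
Proof.
move=> /nbhs_ballP[e /complex_gt0[-> e0] eP]; exists (complex.Re e) => // w wz.
by apply: eP; rewrite -ball_normE/= distrC.
Qed.

Lemma continuous_radius n (p : 'cV[C]_n) (x : R) : {for x, continuous (fun x : R => x%:C *: p)}.
Proof.
apply: (@continuous_comp R C 'cV[C]_n (fun x => x%:C) (fun t => t *: p)).
  by apply: continuous_complex; [exact: cvg_id|exact: cvg_cst].
by apply/differentiable_continuous/differentiable_Z; exact: ex_diff.
Qed.

Lemma nsq_realZ n (x : R) (p : 'cV[C]_n) : nsq (x%:C *: p) = x ^+ 2 * nsq p.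
Proof. by rewrite nsqZ normc_def/= expr0n/= addr0 sqrtr_sqr real_normK ?num_real. Qed.

(* Properness is used only for the compact image of a radial segment ending at [p]. *)
Lemma boundary_norm n N (f F : 'cV[C]_n -> 'cV[C]_N) p :
  proper_on unit_ball unit_ball f -> nsq p = 1 ->
  nbhs p [set w | differentiable F w /\ (unit_ball w -> F w = f w)] ->
  nsq (F p) = 1.
Proof.
move=> [fB fK] p1 nF.
have radB (x : R) : 0 <= x -> x < 1 -> unit_ball (x%:C *: p).
  by move=> x0 x1; rewrite unit_ballE nsq_realZ p1 mulr1 expr_lt1.
have [dFp _] := nbhs_singleton nF.
have cFp : {for p, continuous (fun w => nsq (F w))}.
  apply: (@continuous_comp _ 'cV[C]_N R F (@nsq R N)); first exact: differentiable_continuous.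
  exact: continuous_nsq.
have near_r (P : set 'cV[C]_n) : nbhs p P -> exists2 d : R, 0 < d < 1 & forall x, 1 - d <= x <= 1 -> P (x%:C *: p).
  move=> nP; have c1 := @continuous_radius n p 1.
  have {}c1 : nbhs (1 : R) (fun x => P (x%:C *: p)) by apply: c1; rewrite scale1r.
  have /nbhs_ballP[/= e e0 eP] := c1; exists (Num.min e 1 / 2).
    rewrite divr_gt0 ?lt_min ?e0//= ltr_pdivrMr// mul1r (@le_lt_trans _ _ 1)// ?ltr1n//.
    by rewrite ge_min lexx orbT.
  move=> x /andP[x1 x2]; apply: eP; rewrite /ball/= ger0_norm ?subr_ge0//.
  apply: (@le_lt_trans _ _ (Num.min e 1 / 2)); first by rewrite lerBlDl -lerBlDr.
  by rewrite ltr_pdivrMr// (@le_lt_trans _ _ e) ?ge_min ?lexx// ltr_pMr// ltr1n.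
apply/eqP; rewrite eq_le; apply/andP; split; rewrite leNgt; apply/negP => Fp.
  have := @filterI _ (nbhs p) (nbhs_filter p) _ _ nF (cFp _ (lt_nbhsr Fp)).
  move=> /near_r[d /andP[d0 d1] dP].
  have [[_ FfE] F1] : [set w | differentiable F w /\ (unit_ball w -> F w = f w)] ((1 - d)%:C *: p)
     /\ 1 < nsq (F ((1 - d)%:C *: p)).
    by apply: dP; rewrite lexx gerBl ltW.
  have dB : unit_ball ((1 - d)%:C *: p) by apply: radB; rewrite ?subr_ge0 ?ltW// gtrBl.
  have : unit_ball (f ((1 - d)%:C *: p)) by apply: fB; exists ((1 - d)%:C *: p).
  by rewrite unit_ballE -FfE// ltNge ltW.
(* Case [nsq (F p) < 1]: the image [K] of the closed radial segment, end point included, lies in the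
   target ball. Its preimage is compact, hence closed, and avoids [p]; but it contains the points
   [x *: p] with [x < 1] close to [1], a contradiction. *)
have [d /andP[d0 d1] dP] := near_r _ nF.
pose K := (fun x : R => F (x%:C *: p)) @` `[1 - d, 1].
have cK : compact K.
  apply: continuous_compact; last exact: segment_compact.
  apply: continuous_in_subspaceT => x; rewrite inE/= in_itv/= => /dP[dFx _].
  apply: (@continuous_comp R 'cV[C]_n _ (fun x => x%:C *: p) F); first exact: continuous_radius.
  exact: differentiable_continuous.
have KB : K `<=` unit_ball.
  move=> u [x /=]; rewrite in_itv/= => xd <- {u}; have [_ Ff] := dP x xd.
  move/andP: xd => [xd]; rewrite le_eqVlt => /predU1P[->|x1]; first by rewrite scale1r unit_ballE.
  have xB : unit_ball (x%:C *: p) by apply: radB => //; apply: le_trans xd; rewrite subr_ge0 ltW.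
  by rewrite Ff//; apply: fB; exists (x%:C *: p).
have cl : closed (unit_ball `&` f @^-1` K).
  by apply: compact_closed; [exact: norm_hausdorff|exact: fK].
have pN : ~ (unit_ball `&` f @^-1` K) p by move=> [+ _]; rewrite unit_ballE p1 ltxx.
have : nbhs p (~` (unit_ball `&` f @^-1` K)).
  by apply: open_nbhs_nbhs; split=> //; exact: closed_openC.
move=> /near_r[e /andP[e0 e1] eP].
pose x := 1 - Num.min d e.
have m0 : 0 < Num.min d e by rewrite lt_min d0.
have x1 : x < 1 by rewrite gtrBl.
have xd : 1 - d <= x <= 1 by rewrite (ltW x1) andbT /x lerD2l lerN2 ge_min lexx.
have xe : 1 - e <= x <= 1 by rewrite (ltW x1) andbT /x lerD2l lerN2 ge_min lexx orbT.
have xB : unit_ball (x%:C *: p).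
  by apply: radB => //; case/andP: xd => + _; apply: le_trans; rewrite subr_ge0 ltW.
apply: (eP x xe); split=> //=; exists x; first by rewrite /= in_itv.
by have [_ ->] := dP x xd.
Qed.

End Boundary.

(** * Local polarization and the functional equation *)

Section FunctionalEquation.
Variable R : realType.
Local Notation C := R[i].

Lemma ge0_realc (x : C) : 0 <= x -> x = (complex.Re x)%:C.
Proof. by case: x => a b; rewrite lecE/= => /andP[/eqP ->]. Qed.

(** [unit_circle_cluster] is applied to [|z| - 1], which vanishes on the circle; with [s = 2] its
    parameter [t] is the displacement from [1]. *)
Lemma circle_cluster (q : R) : 0 < q -> forall d : R, 0 < d ->
  exists c : C, [/\ `|c| = q%:C, c != q%:C & `|c - q%:C| < d%:C].
Proof.
move=> q0 d d0.
have h : exists2 r : R, 0 < r & forall z : C, `|z| = 1 -> `|z - 1| < r%:C -> `|z| - 1 = 0.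
  by exists 1 => // z -> _; exact: subrr.
have [t [t0 td /eqP]] := unit_circle_cluster (ltr1n R 2) h (divr_gt0 d0 q0).
rewrite subr0 in td.
have -> : (2 - 1 : R) = 1 by ring.
rewrite mulr1 subr_eq0 => /eqP t1.
have qC : 0 < q%:C :> C by rewrite ltcR.
exists (q%:C * (1 + t)); split.
- by rewrite normrM t1 mulr1 gtr0_norm.
- by rewrite mulrDr mulr1 -subr_eq0 addrAC subrr add0r mulf_neq0// gt_eqF.
- rewrite mulrDr mulr1 addrAC subrr add0r normrM gtr0_norm// mulrC -ltr_pdivlMr//.
  by rewrite -realcV -realcM.
Qed.

Lemma nbhs_norm_ball (V : normedModType C) (p : V) (d : R) u : `|u - p| < d%:C ->
  nbhs u [set w | `|w - p| < d%:C].
Proof.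
move=> up; apply/nbhs_ballP; exists (d%:C - `|u - p|); first by rewrite /= subr_gt0.
move=> w; rewrite -ball_normE/= distrC => wu.
by rewrite -(subrKA u) (le_lt_trans (ler_normD _ _))// -ltrBrDr.
Qed.

(** The weights may sum to less than [1]; the deficit pulls the point towards the origin, and the
    last term pays for it. *)
Lemma norm_convex n (lam mu : R) (z w p : 'cV[C]_n) (d : R) : 0 <= lam -> 0 <= mu -> lam + mu <= 1 ->
  `|z - p| < d%:C -> `|w - p| < d%:C ->
  `|lam%:C *: z + mu%:C *: w - p| <= d%:C + (1 - (lam + mu))%:C * `|p|.
Proof.
move=> l0 m0 lm zp wp.
have -> : lam%:C *: z + mu%:C *: w - p = lam%:C *: (z - p) + mu%:C *: (w - p) - (1 - (lam + mu))%:C *: p.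
  have -> : (1 - (lam + mu))%:C = 1 - (lam%:C + mu%:C) :> C by rewrite -realcD; exact: rmorphB.
  by apply/matrixP => i j; rewrite !mxE; ring.
have nr (x : R) (u : 'cV[C]_n) : 0 <= x -> `|x%:C *: u| = x%:C * `|u|.
  by move=> x0; rewrite normrZ ger0_norm// ler0c.
apply: (le_trans (ler_normB _ _)); rewrite [`|(1 - _)%:C *: _|]nr ?subr_ge0//; apply: lerD => //.
apply: (le_trans (ler_normD _ _)); rewrite !nr//.
apply: (@le_trans _ _ (lam%:C * d%:C + mu%:C * d%:C)).
  by apply: lerD; apply: ler_wpM2l; rewrite ?ler0c// ltW.
rewrite -mulrDl -realcD ler_piMl//; last by rewrite -[1]/(1%:C) lecR.
by apply: le_trans (ltW zp).
Qed.

Lemma norm_ball_segment n (z w p : 'cV[C]_n) (d t : R) : 0 <= t <= 1 ->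
  `|z - p| < d%:C -> `|w - p| < d%:C -> `|z + t%:C *: (w - z) - p| < d%:C.
Proof.
move=> /andP[t0 t1] zp wp; rewrite segment_interp.
have [ze we] := (ge0_realc (normr_ge0 (z - p)), ge0_realc (normr_ge0 (w - p))).
rewrite ze ltcR in zp; rewrite we ltcR in wp.
pose m := Num.max (complex.Re `|z - p|) (complex.Re `|w - p|).
have md : m < d by rewrite gt_max zp wp.
have [h1 h2] := midf_lt md.
apply: (@le_lt_trans _ _ (((m + d) / 2)%:C + (1 - (1 - t + t))%:C * `|p|)).
  apply: norm_convex => //; rewrite ?subr_ge0 ?subrK//.
    by rewrite ze ltcR (le_lt_trans _ h1)// le_max lexx.
  by rewrite we ltcR (le_lt_trans _ h1)// le_max lexx orbT.
by rewrite subrK subrr mul0r addr0 ltcR.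
Qed.

(** A ball around [p] is not closed under the combinations in the hypothesis of [polarization],
    which may shrink towards the origin. The lower bound on [lam + mu] in that hypothesis limits the
    shrinking, since [nsq z] and [nsq w] are close to [1]. *)
Lemma local_polarization n N (F : 'cV[C]_n -> 'cV[C]_N) p (d : R) : 0 < d -> nsq p = 1 ->
  (forall w, `|w - p| < d%:C -> differentiable F w) ->
  (forall w, `|w - p| < d%:C -> nsq w = 1 -> nsq (F w) = 1) ->
  exists2 d' : R, 0 < d' <= d & forall z w, `|z - p| < d'%:C -> `|w - p| < d'%:C ->
    dot z w = 1 -> dot (F z) (F w) = 1.
Proof.
move=> d0 p1 dF F1.
have [P0 P00 P0E] : exists2 P0 : R, 0 <= P0 & `|p| = P0%:C.
  have h := ge0_realc (normr_ge0 p); exists (complex.Re `|p|) => //.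
  by rewrite -ler0c -h.
(* With [nsq z] and [nsq w] below [1 + eta], the lower bound forces [1 - (lam + mu) <= eta / 2]. The
   shift is then at most [eta / 2 * P0 < d / 2], and the other half of [d] is the distance allowed
   for [z] and [w]. *)
pose eta := d / (P0 + 1).
have eta0 : 0 < eta by rewrite divr_gt0// ltr_wpDl.
have [d1 d10 d1P] : exists2 d1 : R, 0 < d1 & forall w, `|w - p| < d1%:C -> nsq w < 1 + eta.
  by apply: nbhs_normCP; apply: open_nsq_lt; rewrite p1 ltrDl.
exists (Num.min d1 (d / 2)).
  by rewrite lt_min d10 divr_gt0//= ge_min ler_pdivrMr// ler_peMr ?ler1n ?orbT// ltW.
move=> z w zp wp zw1.
have both (u : 'cV[C]_n) : `|u - p| < (Num.min d1 (d / 2))%:C -> `|u - p| < d1%:C /\ `|u - p| < (d / 2)%:C.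
  by move=> up; split; apply: (lt_le_trans up); rewrite lecR ge_min lexx ?orbT.
have [zd1 zd2] := both _ zp; have [wd1 wd2] := both _ wp.
have nz := d1P _ zd1; have nw := d1P _ wd1.
rewrite -[1]/(1%:C); apply: (@polarization R n N F [set w | `|w - p| < d%:C] 1 1 z w) => //.
  by move=> u; exact: nbhs_norm_ball.
move=> lam mu l0 m0 lm; rewrite !mulr1 => h /=.
apply: (le_lt_trans (norm_convex l0 m0 lm zd2 wd2)).
rewrite P0E -realcM -realcD ltcR.
set x := lam + mu in lm h *.
have x0 : 0 <= x by rewrite addr_ge0.
have hx : 4 <= x * (4 + 2 * eta).
  apply: (le_trans h); apply: (@le_trans _ _ (x ^+ 2 * (4 + 2 * eta))).
    by rewrite ler_wpM2l ?sqr_ge0//; move: nz nw; clear; lra.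
  apply: ler_wpM2r; last by rewrite expr2 ler_piMl.
  by rewrite addr_ge0// mulr_ge0// ltW.
have x1 : 1 - x <= eta / 2.
  by move: hx lm eta0; clear; nra.
have etaP : eta * P0 < d.
  by rewrite /eta mulrAC ltr_pdivrMr ?ltr_wpDl// ltr_pM2l// ltrDl.
have : (1 - x) * P0 <= eta / 2 * P0 by rewrite ler_wpM2r.
by move: etaP; clear; lra.
Qed.

Lemma value_mx_dot0 n N (f : 'cV[C]_n -> 'cV[C]_N) (z : 'I_N -> 'cV[C]_n) v :
  \det (value_mx f 0 z) != 0 -> (forall j, dot (f (z j)) v = 0) -> v = 0.
Proof.
move=> dz zv.
have Mu : value_mx f 0 z \in unitmx by rewrite unitmxE unitfE.
have : value_mx f 0 z *m map_mx (@conjc R) v = 0.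
  apply/matrixP => j k; rewrite ord1 !mxE -[RHS](zv j); apply: eq_bigr => i _.
  by rewrite !mxE subr0.
move/(congr1 (mulmx (invmx (value_mx f 0 z)))); rewrite mulmx0 mulKmx// => v0.
apply/colP => k; have /colP/(_ k) := v0; rewrite !mxE => /eqP.
by rewrite conjc_eq0 => /eqP.
Qed.

Section equation.
Variables (n N : nat) (f : 'cV[C]_n -> 'cV[C]_N) (r rho : R).
Hypothesis hf : holomorphic_on unit_ball f.
Hypothesis pf : proper_on unit_ball unit_ball f.
Hypotheses (r0 : 0 < r) (r1 : r < 1) (rho0 : 0 < rho) (N0 : (0 < N)%N).
Hypothesis pol : forall z w, unit_ball z -> unit_ball w -> dot z w = (r ^+ 2)%:C ->
  dot (f z) (f w) = (rho ^+ 2)%:C.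

(* On the hyperplane [dot z w = 1] both [F w] and [f (r ^+ 2 w) / rho ^+ 2] pair to [1] with [f z]. *)
Lemma reflection_eq (F : 'cV[C]_n -> 'cV[C]_N) p (d : R) w (z : 'I_N -> 'cV[C]_n) :
  (forall u, `|u - p| < d%:C -> unit_ball u -> F u = f u) ->
  (forall u v, `|u - p| < d%:C -> `|v - p| < d%:C -> dot u v = 1 -> dot (F u) (F v) = 1) ->
  `|w - p| < d%:C -> `|((nsq w)^-1)%:C *: w - p| < d%:C -> 1 < nsq w ->
  unit_ball ((r ^+ 2)%:C *: w) ->
  (forall j, unit_ball (z j) /\ dot (z j) w = 1) -> \det (value_mx f 0 z) != 0 ->
  (rho ^+ 2)%:C *: F w = f ((r ^+ 2)%:C *: w).
Proof.
move=> Ff F1 wd w0d w1 rwB zB dz.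
apply/eqP; rewrite -subr_eq0; apply/eqP; apply: (value_mx_dot0 dz) => j.
have [zjB zjw] := zB j.
rewrite dotBr dotZr conjc_real (pol zjB rwB); last by rewrite dotZr conjc_real zjw mulr1.
suff -> : dot (f (z j)) (F w) = 1 by rewrite mulr1 subrr.
apply/eqP; rewrite -subr_eq0; apply/eqP.
have nw0 : 0 < nsq w by apply: lt_trans w1.
(* The inversion of [w] in the unit sphere: a point of the hyperplane [dot z w = 1] that lies in the
   ball and near [p]. There [f = F], so the local polarization gives the product [1] near [z0], and
   the identity theorem carries it to [z j] along a segment inside the hyperplane. *)
set z0 := ((nsq w)^-1)%:C *: w in w0d.
have z0w : dot z0 w = 1.
  by rewrite /z0 dotZl dotE -realcM mulVf// gt_eqF.
have z0B : unit_ball z0.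
  rewrite unit_ballE /z0 nsq_realZ exprVn expr2 invfM mulfVK ?gt_eqF//.
  by rewrite invf_lt1.
apply: (@identity_line R n (fun u => dot (f u) (F w) - 1) unit_ball z0 (z j)).
- exact: open_unit_ball.
- move=> u uB; apply: diffable_sub; last exact: diffable_cst.
  apply: (@differentiable_comp _ _ _ _ f (fun v => dot v (F w))); first exact: hf.
  exact: differentiable_dotl.
- by move=> t t01; exact: unit_ball_segment.
apply: near_zero_cluster.
have lc := differentiable_continuous (line_differentiable z0 (z j - z0) 0).
have n1 : nbhs (0 : C) (fun t => unit_ball (z0 + t *: (z j - z0))).
  by apply: lc; rewrite scale0r addr0; exact: open_unit_ball.
have n2 : nbhs (0 : C) (fun t => `|z0 + t *: (z j - z0) - p| < d%:C).
  by apply: (lc [set u | `|u - p| < d%:C]); rewrite scale0r addr0; exact: nbhs_norm_ball.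
apply: (@filterS _ _ (nbhs_filter (0 : C)) _ _ _ (@filterI _ _ (nbhs_filter (0 : C)) _ _ n1 n2)) => t [tB td].
rewrite -Ff// F1 ?subrr//.
by rewrite dotDl dotZl dotBl zjw z0w subrr mulr0 addr0.
Qed.

(** [generic_slice] is used at two heights. The first, on [|c| = r ^+ 2], has its pole [p] on the
    unit sphere and provides the extension [F] near [p]. The second, at [c2] near [u] with
    [|c2| < 1], is the hyperplane [dot z w0 = 1] with [w0] near [p] and outside the closed ball, as
    [reflection_eq] demands. The equation then spreads from a neighbourhood of [w0] through a ball
    around [p], and from its part inside the unit ball to the whole unit ball. *)
Lemma functional_equation e c0 b (z : 'I_N -> 'cV[C]_n) : nsq e = 1 ->
  (forall j, unit_ball (z j) /\ dot (z j) e = c0) -> \det (value_mx f b z) != 0 ->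
  forall w, unit_ball w -> f ((r ^+ 2)%:C *: w) = (rho ^+ 2)%:C *: f w.
Proof.
move=> e1 zB dz.
have r20 : 0 < r ^+ 2 by rewrite exprn_gt0.
have r21 : r ^+ 2 < 1 by rewrite expr_lt1// ltW.
have rho20 : 0 < rho ^+ 2 by rewrite exprn_gt0.
have r2N : (r ^+ 2)%:C != 0 :> C by rewrite realc_eq0 gt_eqF.
have slice := @generic_slice R n N f r rho hf r0 r1 rho0 pol e c0 b z.
have [|c [z' [cr _ z'B dz']]] := slice (r ^+ 2)%:C [set c | `|c| = (r ^+ 2)%:C] N0 e1 zB dz _ (circle_cluster r20).
  by rewrite ger0_norm ?ler0c ?(ltW r20)// -[1]/(1%:C) ltcR.
(* For [c != 0], [dir c] is the vector [w] for which [dot z e = c] becomes [dot z w = 1]. Dividing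
   [c] by [r ^+ 2] first turns the right side into [r ^+ 2]. *)
pose dir (c : C) : 'cV[C]_n := (c^*%C)^-1 *: e.
pose u := c / (r ^+ 2)%:C.
have u1 : `|u| = 1.
  by rewrite /u normrM normfV cr ger0_norm ?ler0c ?(ltW r20)// divff.
have uN : u != 0 by rewrite -normr_eq0 u1 oner_eq0.
pose p := dir u.
have nsq_dir (c' : C) : nsq (dir c') = (complex.Re `|c'| ^+ 2)^-1.
  by rewrite /dir nsqZ e1 mulr1 normfV normcJ [in LHS]normCRe -realcV/= exprVn.
have p1 : nsq p = 1 by rewrite nsq_dir u1/= expr1n invr1.
have z'p j : unit_ball (z' j) /\ dot (z' j) p = (r ^+ 2)%:C.
  have [z'jB z'je] := z'B j; split=> //.
  by rewrite /p /dir dotZr z'je conjc_inv conjcK /u invfM invrK mulrAC mulVf ?mul1r// -normr_eq0 cr.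
have ext := extension hf r0 pol z'p dz'.
set F := extend f r rho z' in ext.
have near_r2 : nbhs p [set w | unit_ball ((r ^+ 2)%:C *: w)].
  have h : nsq p < ((r ^+ 2) ^+ 2)^-1 by rewrite p1 invf_gt1 ?exprn_gt0// expr_lt1// ltW.
  apply: (@filterS _ (nbhs p) (nbhs_filter p) _ _ _ (open_nsq_lt h)) => w /=.
  by rewrite unit_ballE nsq_realZ mulrC -ltr_pdivlMr ?exprn_gt0// div1r.
have [d0 d00 d0P] := nbhs_normCP (@filterI _ (nbhs p) (nbhs_filter p) _ _ ext near_r2).
have dF w : `|w - p| < d0%:C -> differentiable F w by move=> /d0P[[]].
have Ff w : `|w - p| < d0%:C -> unit_ball w -> F w = f w by move=> /d0P[[]].
have F1 w : `|w - p| < d0%:C -> nsq w = 1 -> nsq (F w) = 1.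
  move=> wd w1; apply: (boundary_norm pf w1).
  by apply: (@filterS _ (nbhs w) (nbhs_filter w) _ _ _ (nbhs_norm_ball wd)) => w' /d0P[].
have [d1 /andP[d10 d1d0] F11] := local_polarization d00 p1 dF F1.
have [d2 d20 d2P] : exists2 d2 : R, 0 < d2 & forall w, `|w - p| < d2%:C ->
    `|w - p| < d1%:C /\ `|((nsq w)^-1)%:C *: w - p| < d1%:C.
  have pp : `|p - p| < d1%:C by rewrite subrr normr0 ltcR.
  apply: nbhs_normCP; apply: (@filterI _ (nbhs p) (nbhs_filter p)); first exact: nbhs_norm_ball.
  have cs : {for p, continuous (fun w => ((nsq w)^-1)%:C *: w)}.
    have ck : {for p, continuous (fun w => ((nsq w)^-1)%:C : C)}.
      apply: (@continuous_comp _ R C (fun w => (nsq w)^-1) (fun x => x%:C)).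
        apply: (@continuous_comp _ R R (@nsq R n) (fun x => x^-1)); first exact: continuous_nsq.
        by apply: inv_continuous; rewrite p1 oner_eq0.
      by apply: continuous_complex; [exact: cvg_id|exact: cvg_cst].
    exact: (@cvgZ C 'cV[C]_n _ (nbhs p) (nbhs_filter p) _ id _ p ck (@cvg_id _ _)).
  by apply: (cs [set v | `|v - p| < d1%:C]); rewrite p1 invr1 scale1r; exact: nbhs_norm_ball.
have [d3 d30 d3P] : exists2 d3 : R, 0 < d3 & forall c', `|c' - u| < d3%:C ->
    c' != 0 /\ `|dir c' - p| < d2%:C.
  apply/nbhs_complexP; apply: (@filterI _ (nbhs u) (nbhs_filter u)).
    by apply/nbhs_complexP; have := @continuous_neq0 R id u (@cvg_id _ _) uN.
  have cdir : {for u, continuous dir}.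
    apply: (@continuous_comp C C _ (@conjc R) (fun t => t^-1 *: e)); first exact: continuous_conj.
    apply/differentiable_continuous/differentiable_Z/diffable_inv; first exact: ex_diff.
    by rewrite conjc_eq0.
  by apply: (cdir [set v | `|v - p| < d2%:C]); apply: nbhs_norm_ball; rewrite subrr normr0 ltcR.
have [eps eps0 /andP[eps1 epsd]] : exists2 eps : R, 0 < eps & (eps < 1) && (eps < d3).
  exists (Num.min 1 d3 / 2); first by rewrite divr_gt0// lt_min d30 ltr01.
  by rewrite -lt_min ltr_pdivrMr// ltr_pMr ?ltr1n// lt_min d30 ltr01.
(* [u] has modulus [1], but [generic_slice] requires a cluster point inside the open disc, so [u] is
   first moved inwards by less than [d3]. *)
have [||c2 [z2 [c2u c21 z2B dz2]]] := slice ((1 - eps)%:C * u) [set c' | `|c' - u| < d3%:C] N0 e1 zB dz.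
- rewrite normrM u1 mulr1 ger0_norm ?ler0c ?subr_ge0 ?(ltW eps1)//.
  by rewrite -[1 in ltRHS]/(1%:C) ltcR gtrBl.
- move=> d d'0; pose t := Num.min d eps / 2.
  have m0 : 0 < Num.min d eps by rewrite lt_min d'0.
  have t0 : 0 < t by rewrite divr_gt0.
  have tm : t < Num.min d eps by rewrite ltr_pdivrMr// ltr_pMr// ltr1n.
  have /andP[td te] : (t < d) && (t < eps) by rewrite -lt_min.
  exists ((1 - eps)%:C * u + t%:C * u); split.
  + rewrite /= (_ : _ - u = (t - eps)%:C * u); last first.
      by rewrite [(1 - eps)%:C]rmorphB [(t - eps)%:C]rmorphB/=; ring.
    rewrite normrM u1 mulr1 ler0_norm ?ler0c; last by rewrite -[0]/(0%:C) lecR subr_le0 ltW.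
    by rewrite -rmorphN ltcR opprB (le_lt_trans _ epsd)// gerBl ltW.
  + by rewrite -subr_eq0 addrAC subrr add0r mulf_neq0// realc_eq0 gt_eqF.
  + by rewrite addrAC subrr add0r normrM u1 mulr1 ger0_norm ?ler0c ?ltcR// ltW.
pose w0 := dir c2.
have [c2N w0d] := d3P _ c2u.
have z2w j : unit_ball (z2 j) /\ dot (z2 j) w0 = (1 ^+ 2)%:C.
  have [z2jB z2je] := z2B j; split=> //.
  by rewrite /w0 /dir dotZr z2je conjc_inv conjcK mulVf// expr1n.
have w01 : 1 < nsq w0.
  have h : 0 < complex.Re `|c2| by rewrite -ltcR -normCRe normr_gt0.
  by rewrite nsq_dir invf_gt1 ?exprn_gt0// expr_lt1 ?(ltW h)// -ltcR -normCRe.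
have eq_near : nbhs w0 (fun w => (rho ^+ 2)%:C *: F w = f ((r ^+ 2)%:C *: w)).
  have h1 := near_frame hf ltr01 z2w dz2.
  have h2 := nbhs_norm_ball w0d.
  have h3 : nbhs w0 [set w | 1 < nsq w] by exact: (@continuous_nsq R n w0 _ (lt_nbhsr w01)).
  apply: (@filterS _ (nbhs w0) (nbhs_filter w0) _ _ _ (@filterI _ (nbhs w0) (nbhs_filter w0) _ _ h1
    (@filterI _ (nbhs w0) (nbhs_filter w0) _ _ h2 h3))) => w [[z3 z3B dz3] [wd w1]].
  have [wd1 wd1'] := d2P _ wd.
  have up v : `|v - p| < d1%:C -> `|v - p| < d0%:C by move=> /lt_le_trans; apply; rewrite lecR.
  apply: (reflection_eq _ F11 wd1 wd1' w1 _ _ dz3).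
  - by move=> v /up; exact: Ff.
  - by have [] := d0P _ (up _ wd1).
  - by move=> j; have [] := z3B j; rewrite expr1n.
have r2_diff (G : 'cV[C]_n -> 'cV[C]_N) w k : differentiable G ((r ^+ 2)%:C *: w) ->
    differentiable (fun w => G ((r ^+ 2)%:C *: w) k 0) w.
  move=> dG; apply: (@differentiable_comp _ _ _ _ (fun w => (r ^+ 2)%:C *: w) (fun v => G v k 0)).
    by apply: differentiableZ; exact: ex_diff.
  exact: differentiable_coordinate.
have up v : `|v - p| < d1%:C -> `|v - p| < d0%:C by move=> /lt_le_trans; apply; rewrite lecR.
have eqV w : `|w - p| < d0%:C -> (rho ^+ 2)%:C *: F w = f ((r ^+ 2)%:C *: w).
  move=> wd; apply/colP => k; rewrite mxE; apply/eqP; rewrite -subr_eq0; apply/eqP.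
  apply: (@identity_near R n (fun w => (rho ^+ 2)%:C * F w k 0 - f ((r ^+ 2)%:C *: w) k 0)
    [set w | `|w - p| < d0%:C] w0 w).
  - by move=> v; exact: nbhs_norm_ball.
  - move=> v vd; apply: diffable_sub; last by apply: r2_diff; apply: hf; have [] := d0P _ vd.
    by apply: diffable_mul; [exact: diffable_cst|apply: differentiable_coordinate; exact: dF].
  - by move=> t t01; apply: norm_ball_segment => //; apply: up; have [] := d2P _ w0d.
  apply: (@filterS _ (nbhs w0) (nbhs_filter w0) _ _ _ eq_near) => v /colP/(_ k).
  by rewrite mxE => ->; rewrite subrr.
have [x x01 xd] : exists2 x : R, 0 <= x < 1 & `|x%:C *: p - p| < d0%:C.
  have c1 := @continuous_radius R n p 1.
  have : nbhs (1 : R) (fun x => `|x%:C *: p - p| < d0%:C).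
    by apply: (c1 [set v | `|v - p| < d0%:C]); rewrite scale1r; apply: nbhs_norm_ball; rewrite subrr normr0 ltcR.
  move=> /nbhs_ballP[/= a a0 aP]; pose m := Num.min a 1 / 2.
  have m0 : 0 < Num.min a 1 by rewrite lt_min a0 ltr01.
  have mp : 0 < m by rewrite divr_gt0.
  have mm : m < Num.min a 1 by rewrite ltr_pdivrMr// ltr_pMr// ltr1n.
  have /andP[ma m1] : (m < a) && (m < 1) by rewrite -lt_min.
  exists (1 - m); first by rewrite subr_ge0 ltW//= gtrBl.
  by apply: aP; rewrite /ball/= opprB addrC subrK ger0_norm// ltW.
move=> w wB; apply/colP => k; rewrite [RHS]mxE; apply/eqP; rewrite -subr_eq0; apply/eqP.
have xB : unit_ball (x%:C *: p).
  by case/andP: x01 => x0 x1; rewrite unit_ballE nsq_realZ p1 mulr1 expr_lt1.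
have r2B v : unit_ball v -> unit_ball ((r ^+ 2)%:C *: v).
  rewrite !unit_ballE nsq_realZ => v1; apply: le_lt_trans v1.
  by rewrite ler_piMl ?nsq_ge0// expr_le1// ?ltW.
apply: (@identity_near R n (fun w => f ((r ^+ 2)%:C *: w) k 0 - (rho ^+ 2)%:C * f w k 0)
    unit_ball (x%:C *: p) w).
- exact: open_unit_ball.
- move=> v vB; apply: diffable_sub; first by apply: r2_diff; apply: hf; exact: r2B.
  by apply: diffable_mul; [exact: diffable_cst|apply: differentiable_coordinate; exact: hf].
- by move=> t t01; exact: unit_ball_segment.
apply: (@filterS _ _ (nbhs_filter (x%:C *: p)) _ _ _
  (@filterI _ _ (nbhs_filter (x%:C *: p)) _ _ (nbhs_norm_ball xd) (open_unit_ball xB))) => v [vd vB].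
by rewrite -eqV// mxE Ff// subrr.
Qed.

End equation.

End FunctionalEquation.

(** * Homogeneity and the Veronese map *)

Section Homogeneity.
Variable R : realType.
Local Notation C := R[i].

Lemma exists_expr_lt (c d : R) : 0 < c < 1 -> 0 < d -> exists m, c ^+ m < d.
Proof.
move=> /andP[c0 c1] d0.
have h : `|c| < 1 by rewrite gtr0_norm.
have [m _ mP] := @cvgr_dist_lt R R nat \oo _ _ _ (cvg_expr h) _ d0; exists m.
by have := mP m (leqnn _); rewrite /= sub0r normrN gtr0_norm// exprn_gt0.
Qed.

(* If [phi z = z ^+ n * g z] near [0] with [g 0 != 0], the equation forces
   [c ^+ n = kappa], and then [phi t / t ^+ n = g (c ^+ m * t)] for all large [m]. *)
Lemma scaling_eq (phi : C -> C) (c kappa : R) : 0 < c < 1 -> 0 < kappa ->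
  (forall t, `|t| < 1 -> derivable phi t 1) ->
  (forall t, `|t| <= 1 -> phi (c%:C * t) = kappa%:C * phi t) ->
  (forall t, `|t| <= 1 -> phi t = 0) \/
  exists2 d : nat, c ^+ d = kappa & forall t, `|t| <= 1 -> phi t = t ^+ d * phi 1.
Proof.
move=> c01 k0 dphi eqphi; have /andP[c0 c1] := c01.
have cn m : `|(c ^+ m)%:C : C| = (c ^+ m)%:C by rewrite ger0_norm// ler0c exprn_ge0// ltW.
have lec1 (x : R) : (x%:C <= 1 :> C) = (x <= 1) by rewrite -lecR.
have small m t : `|t| <= 1 -> `|(c ^+ m)%:C * t| <= 1.
  move=> t1; rewrite normrM cn; apply: mulr_ile1; [|exact: normr_ge0| |exact: t1].
    by rewrite ler0c exprn_ge0// ltW.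
  by rewrite lec1 exprn_ile1 ?ltW.
have iter m t : `|t| <= 1 -> phi ((c ^+ m)%:C * t) = (kappa ^+ m)%:C * phi t.
  move=> t1; elim: m => [|m ih]; first by rewrite !mul1r.
  rewrite exprS realcM -mulrA eqphi; last exact: small.
  by rewrite ih mulrA -realcM -exprS.
have near0 (d : R) t : 0 < d -> `|t| <= 1 -> exists m, forall m', (m <= m')%N -> `|(c ^+ m')%:C * t| < d%:C.
  move=> d0 t1; have [m md] := exists_expr_lt c01 d0; exists m => m' mm'.
  rewrite normrM cn; apply: (@le_lt_trans _ _ ((c ^+ m')%:C)).
    by rewrite ler_piMr// ler0c exprn_ge0// ltW.
  by rewrite ltcR; apply: le_lt_trans md; apply: ler_wiXn2l => //; exact: ltW.
have kN m : (kappa ^+ m)%:C != 0 :> C by rewrite realc_eq0 expf_neq0// gt_eqF.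
have [||[d d0 dP]|[n [g [g0 cg [d d0 dP]]]]] := @holomorphic_local_form R phi 0 1.
- exact: ltr01.
- by move=> t; rewrite subr0; exact: dphi.
- left=> t t1; have [m /(_ m (leqnn _)) md] := near0 _ _ d0 t1.
  by apply: (mulfI (kN m)); rewrite mulr0 -iter// dP// subr0.
right.
have dP' z : `|z| < d%:C -> phi z = z ^+ n * g z by move=> zd; rewrite dP ?subr0.
have cnkN : c ^+ n != kappa -> (c ^+ n)%:C * g (c%:C * 0) - kappa%:C * g 0 != 0.
  by move=> cnk; rewrite mulr0 -mulrBl mulf_neq0// -rmorphB realc_eq0 subr_eq0.
have c_cont : {for 0, continuous (fun z => g (c%:C * z))}.
  apply: (@continuous_comp C C C (fun z => c%:C * z) g); last by rewrite mulr0.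
  by apply: (@continuousM C C); [exact: (@cst_continuous C C)|exact: cvg_id].
have cM (h : C -> C) (a : C) : {for 0, continuous h} -> {for 0, continuous (fun z => a * h z)}.
  by move=> ch; apply: (@continuousM C C); [exact: (@cst_continuous C C)|exact: ch].
have cnk : c ^+ n = kappa.
  apply/eqP; apply: contrapT => /negP cnk.
  pose G (z : C) : C := (c ^+ n)%:C * g (c%:C * z) - kappa%:C * g z.
  have cG : {for 0, continuous G} by apply: (@continuousB C C C); [exact: (cM _ _ c_cont)|exact: (cM _ _ cg)].
  have [e e0 eP] := continuous_neq0 cG (cnkN cnk).
  have m0 : 0 < Num.min (Num.min d e) 1 by rewrite !lt_min d0 e0 ltr01.
  pose z : R := Num.min (Num.min d e) 1 / 2.
  have z0 : 0 < z by rewrite divr_gt0.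
  have zm : z < Num.min (Num.min d e) 1 by rewrite ltr_pdivrMr// ltr_pMr// ltr1n.
  have /andP[/andP[zd ze] z1] : (z < d) && (z < e) && (z < 1) by rewrite -!lt_min.
  have nz : `|z%:C : C| = z%:C by rewrite ger0_norm// ler0c ltW.
  have := eP z%:C; rewrite subr0 nz ltcR => /(_ ze)/eqP; apply.
  have zN : z%:C ^+ n != 0 :> C by rewrite expf_neq0// realc_eq0 gt_eqF.
  apply: (mulfI zN); rewrite mulr0 mulrBr.
  have := eqphi z%:C; rewrite nz lec1 => /(_ (ltW z1)).
  have zdC : `|z%:C : C| < d%:C by rewrite nz ltcR.
  have czd : `|c%:C * z%:C| < d%:C.
    by rewrite normrM; apply: le_lt_trans zdC; rewrite ler_piMl// ger0_norm ?ler0c ?(ltW c0)// lec1 ltW.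
  rewrite (dP' _ zdC) (dP' _ czd).
  rewrite exprMn [(c ^+ n)%:C]realcX => h; apply/eqP; rewrite subr_eq0; apply/eqP.
  by rewrite mulrA [_ * c%:C ^+ n]mulrC h mulrCA.
have phiE t : `|t| <= 1 -> phi t = t ^+ n * g 0.
  move=> t1; apply/eqP; apply: contrapT => /negP ht.
  pose G (z : C) : C := phi t - t ^+ n * g z.
  have cG : {for 0, continuous G}.
    by apply: (@continuousB C C C); [exact: (@cst_continuous C C)|exact: (cM _ _ cg)].
  have G0 : G 0 != 0 by rewrite subr_eq0.
  have [e e0 eP] := continuous_neq0 cG G0.
  have m0 : 0 < Num.min d e by rewrite lt_min d0.
  have [m /(_ m (leqnn _)) md] := near0 _ _ m0 t1.
  have md1 : `|(c ^+ m)%:C * t| < d%:C by apply: (lt_le_trans md); rewrite lecR ge_min lexx.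
  have md2 : `|(c ^+ m)%:C * t| < e%:C by apply: (lt_le_trans md); rewrite lecR ge_min lexx orbT.
  have := eP ((c ^+ m)%:C * t); rewrite subr0 => /(_ md2)/eqP; apply.
  apply: (mulfI (kN m)); rewrite mulr0 mulrBr -iter// dP'// exprMn -realcX exprAC cnk.
  by rewrite mulrA subrr.
by exists n => // t t1; rewrite phiE// [phi 1]phiE ?normr1// expr1n mul1r.
Qed.

(** [scaling_eq] applies to each component along each complex line. A component that is not zero on
    its line has a degree [d] with [c ^+ d = kappa]; as [0 < c < 1], this determines [d], so all
    lines and components share it, and [kappa < 1] excludes [d = 0]. *)
Lemma homogeneous n N (f : 'cV[C]_n -> 'cV[C]_N) (c kappa : R) : 0 < c < 1 -> 0 < kappa < 1 ->
  holomorphic_on unit_ball f ->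
  (forall w, unit_ball w -> f (c%:C *: w) = kappa%:C *: f w) ->
  (exists2 w, unit_ball w & f w != 0) ->
  exists d : nat, [/\ (1 <= d)%N, c ^+ d = kappa &
    forall t w, `|t| <= 1 -> unit_ball w -> f (t *: w) = t ^+ d *: f w].
Proof.
move=> c01 /andP[k0 k1] hf fc [w1 w1B fw1].
have /andP[c0 c1] := c01.
have comp w k : unit_ball w ->
  (forall t, `|t| <= 1 -> f (t *: w) k 0 = 0) \/
  exists2 d : nat, c ^+ d = kappa & forall t, `|t| <= 1 -> f (t *: w) k 0 = t ^+ d * f w k 0.
  move=> wB; have := @scaling_eq (fun t => f (t *: w) k 0) c kappa c01 k0.
  rewrite scale1r; apply.
    move=> t t1; apply/derivable1_diffP.
    apply: (@differentiable_comp C C _ C (fun t => t *: w) (fun u => f u k 0)).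
      by apply: differentiable_Z; exact: ex_diff.
    by apply/differentiable_coordinate/hf/unit_ballZ => //; exact: ltW.
  by move=> t t1; rewrite -scalerA fc ?mxE//; exact: unit_ballZ.
have [k fk] : exists k, f w1 k 0 != 0.
  apply: contrapT => /forallNP h; move/eqP: fw1; apply; apply/colP => k.
  by rewrite mxE; apply/eqP; apply: contrapT => /negP; exact: h.
have [/(_ 1)|[d cd _]] := comp w1 k w1B.
  by rewrite normr1 scale1r => /(_ (lexx _)) h; rewrite h eqxx in fk.
exists d; split=> //.
  by case: d cd => // h; rewrite -h expr0 ltxx in k1.
move=> t w t1 wB; apply/colP => j; rewrite mxE.
have [h|[d' cd' ->//]] := comp w j wB.
  by have := h 1; rewrite normr1 scale1r => /(_ (lexx _)) ->; rewrite h// mulr0.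
suff -> : d' = d by [].
have : c ^+ d' = c ^+ d by rewrite cd.
by apply: ieexprIn => //; rewrite lt_eqF.
Qed.

End Homogeneity.

(** * Products of values as powers of products *)

Section Kernel.
Variable R : realType.
Local Notation C := R[i].
Variables (n N : nat) (f : 'cV[C]_n -> 'cV[C]_N) (r rho : R) (d : nat).
Hypothesis hf : holomorphic_on unit_ball f.
Hypotheses (r0 : 0 < r) (r1 : r < 1) (d1 : (1 <= d)%N) (rd : (r ^+ 2) ^+ d = rho ^+ 2).
Hypothesis pol : forall z w, unit_ball z -> unit_ball w -> dot z w = (r ^+ 2)%:C ->
  dot (f z) (f w) = (rho ^+ 2)%:C.
Hypothesis hom : forall t w, `|t| <= 1 -> unit_ball w -> f (t *: w) = t ^+ d *: f w.

(** Multiplying [z] by [r ^+ 2 / dot z w], of modulus at most [1], brings the pair to the product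
    [r ^+ 2] where [pol] applies; homogeneity undoes the scaling. *)
Lemma kernel_large z w : unit_ball z -> unit_ball w -> (r ^+ 2)%:C <= `|dot z w| ->
  dot (f z) (f w) = dot z w ^+ d.
Proof.
move=> zB wB; set q := dot z w => rq.
have r2 : 0 < (r ^+ 2)%:C :> C by rewrite ltcR exprn_gt0.
have q0 : q != 0 by rewrite -normr_gt0 (lt_le_trans r2).
pose t := (r ^+ 2)%:C / q.
have t1 : `|t| <= 1.
  by rewrite normrM normfV [`|(r ^+ 2)%:C|]gtr0_norm// ler_pdivrMr ?normr_gt0// mul1r.
have tN : t != 0 by rewrite mulf_neq0 ?invr_eq0// gt_eqF.
have := pol (unit_ballZ t1 zB) wB; rewrite dotZl mulfVK// => /(_ erefl).
rewrite hom// dotZl -rd realcX => h.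
apply: (mulfI (expf_neq0 d tN)); rewrite h -exprMn; congr (_ ^+ d).
by rewrite mulfVK.
Qed.

(** For first arguments near [w] the product has modulus above [r ^+ 2], and the identity theorem
    carries the equality along the segment from [w] to [z]. *)
Lemma kernel_near z w : unit_ball z -> unit_ball w -> r ^+ 2 < nsq w ->
  dot (f z) (f w) = dot z w ^+ d.
Proof.
move=> zB wB rw; apply/eqP; rewrite -subr_eq0; apply/eqP.
apply: (@identity_near R n (fun z => dot (f z) (f w) - dot z w ^+ d) unit_ball w z).
- exact: open_unit_ball.
- move=> u uB; apply: diffable_sub; first exact: (@differentiable_comp _ _ _ _ f (fun v => dot v (f w)) u (hf uB) (differentiable_dotl _ _)).
  by apply: diffable_exp; exact: differentiable_dotl.
- by move=> t t01; exact: unit_ball_segment.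
have c : {for w, continuous (fun u => complex.Re (dot u w))}.
  apply: (@continuous_comp _ C R (fun u => dot u w) (@complex.Re R)); last exact: continuous_Re.
  exact: differentiable_continuous (differentiable_dotl _ _).
apply: (@filterS _ _ (nbhs_filter w) _ _ _
  (@filterI _ _ (nbhs_filter w) _ _ (c _ (lt_nbhsr rw)) (open_unit_ball wB))) => u [/= ur uB].
rewrite kernel_large ?subrr//.
rewrite normc_def lecR; apply: (le_trans (ltW ur)).
by rewrite (le_trans (ler_norm _))// -sqrtr_sqr ler_wsqrtr// lerDl sqr_ge0.
Qed.

(** A short nonzero [w] is a contraction of a vector of square norm [(1 + r ^+ 2) / 2], which lies
    strictly between [r ^+ 2] and [1]; homogeneity removes the factor. *)
Lemma kernel z w : unit_ball z -> unit_ball w -> dot (f z) (f w) = dot z w ^+ d.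
Proof.
move=> zB wB; have [/eqP/nsq_eq0 ->|w0] := boolP (nsq w == 0).
  have -> : f 0 = 0.
    have := @hom 0 w; rewrite normr0 scale0r => -> //.
    by rewrite expr0n gtn_eqF// scale0r.
  by rewrite ![dot _ 0]dotC !dot0l conjc0 expr0n gtn_eqF.
have [|wr] := ltP (r ^+ 2) (nsq w); first exact: kernel_near.
have {}w0 : 0 < nsq w by rewrite lt_neqAle eq_sym w0 nsq_ge0.
have r21 : r ^+ 2 < 1 by rewrite expr_lt1// ltW.
pose m := (1 + r ^+ 2) / 2.
have [rm m1] : r ^+ 2 < m /\ m < 1 by split; [rewrite ltr_pdivlMr// mulr_natr mulr2n ltrD2r|rewrite ltr_pdivrMr// mul1r -[ltRHS]/(1 + 1) ltrD2l].
have m0 : 0 < m by apply: lt_trans rm; rewrite exprn_gt0.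
pose s := Num.sqrt (nsq w / m).
have s0 : 0 < s by rewrite sqrtr_gt0 divr_gt0.
have s2 : s ^+ 2 = nsq w / m by rewrite sqr_sqrtr// divr_ge0// ltW.
have sN : s%:C != 0 :> C by rewrite realc_eq0 gt_eqF.
have s1 : `|s%:C : C| <= 1.
  rewrite ger0_norm ?ler0c ?(ltW s0)// -[1]/(1%:C) lecR.
  by rewrite -(@expr_le1 _ 2) ?ltW// s2 ltr_pdivrMr// mul1r (le_lt_trans wr).
have nw' : nsq (s^-1%:C *: w) = m.
  by rewrite nsq_realZ exprVn s2 invf_div mulfVK// gt_eqF.
have -> : w = s%:C *: (s^-1%:C *: w) by rewrite scalerA realcV divff// scale1r.
have wB' : unit_ball (s^-1%:C *: w) by rewrite unit_ballE nw'.
move: (s^-1%:C *: w) wB' nw' => w' wB' nw'.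
rewrite hom// !dotZr kernel_near ?nw'// exprMn rmorphXn//.
Qed.

End Kernel.

(** * The multinomial theorem and separation of monomials *)

Section Multinomial.
Variable K : numFieldType.

(* The multinomial theorem is the comparison of coefficients in [exp (\sum x i) = \prod exp (x i)]. *)
Definition truncated_exp (d : nat) (x : K) : {poly K} := \poly_(j < d.+1) (x ^+ j / (j`!)%:R).

Lemma coef_prod_truncated_exp (I : Type) (s : seq I) (x : I -> K) d k : (k <= d)%N ->
  (\prod_(i <- s) truncated_exp d (x i))`_k = (\sum_(i <- s) x i) ^+ k / (k`!)%:R.
Proof.
have fN m : (m`!)%:R != 0 :> K by rewrite pnatr_eq0 -lt0n fact_gt0.
elim: s k => [|i s ih] k kd.
  rewrite !big_nil coef1 expr0n; case: k kd => [|k] _ /=; last by rewrite mul0r.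
  by rewrite divr1.
rewrite !big_cons coefMr exprDn mulr_suml; apply: eq_bigr => j _.
have jk : (j <= k)%N by rewrite -ltnS.
rewrite ih ?(leq_trans jk)// coef_poly ltnS (leq_trans (leq_subr _ _) kd).
rewrite -mulr_natr -(bin_fact jk) !natrM; field.
by rewrite !fN/= pnatr_eq0 -lt0n bin_gt0.
Qed.

Lemma multinomial n d (x : 'I_n -> K) :
  (\sum_i x i) ^+ d = \sum_(a in multi_indices n d)
    (d`!)%:R / (\prod_i (tnth a i)`!)%:R * \prod_i x i ^+ tnth a i.
Proof.
have fN m : (m`!)%:R != 0 :> K by rewrite pnatr_eq0 -lt0n fact_gt0.
apply: (mulIf (invr_neq0 (fN d))); rewrite -(coef_prod_truncated_exp _ x (leqnn d)).
under eq_bigr do rewrite /truncated_exp poly_def.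
rewrite bigA_distr_bigA /= coef_sum mulr_suml.
rewrite (reindex (fun t : n.-tuple 'I_d.+1 => [ffun i => tnth t i])); last first.
  exists (fun f : {ffun 'I_n -> 'I_d.+1} => [tuple f i | i < n]) => t _.
    by apply: eq_from_tnth => i; rewrite tnth_mktuple ffunE.
  by apply/ffunP => i; rewrite ffunE tnth_mktuple.
rewrite [RHS]big_mkcond; apply: eq_bigr => t _; rewrite inE.
under eq_bigr do rewrite ffunE.
rewrite scaler_prod coefZ prodrXr coefXn big_tuple eq_sym.
case: eqP => _; last by rewrite mulr0.
rewrite mulr1 natr_prod prodf_div.
by rewrite [RHS]mulrAC [_ / _ / _]mulrAC divff// mul1r mulrC.
Qed.

Lemma digits_inj (B n : nat) (u v : nat -> nat) :
  (forall i, u i < B)%N -> (forall i, v i < B)%N ->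
  (\sum_(i < n) u i * B ^ i = \sum_(i < n) v i * B ^ i)%N -> forall i, (i < n)%N -> u i = v i.
Proof.
elim: n u v => // n ih u v uB vB.
have B0 : (0 < B)%N by apply: leq_ltn_trans (uB 0).
rewrite !big_ord_recl !expn0 !muln1.
have shift (w : nat -> nat) : (\sum_(i < n) w (lift ord0 i) * B ^ lift ord0 i = (\sum_(i < n) w i.+1 * B ^ i) * B)%N.
  by rewrite big_distrl; apply: eq_bigr => i _; rewrite /= expnSr mulnA.
rewrite !shift => e.
have e0 : u 0 = v 0.
  by have := congr1 (fun m => m %% B)%N e; rewrite !(addnC _ (_ * B)%N) !modnMDl !modn_small.
move: e; rewrite e0 => /addnI/eqP; rewrite eqn_pmul2r// => /eqP e.
case=> [|i]; first by [].
by rewrite ltnS; apply: (ih (u \o succn) (v \o succn)) => // j; [exact: uB|exact: vB].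
Qed.

Lemma poly_eq0_horner (p : {poly K}) : (forall x, p.[x] = 0) -> p = 0.
Proof.
move=> p0; apply/eqP; apply: contrapT => /negP pN.
suff : (size [seq (i%:R : K) | i <- iota 0 (size p)] < size p)%N by rewrite size_map size_iota ltnn.
apply: max_poly_roots pN _ _; first by apply/allP => x _; rewrite /root p0.
by rewrite map_inj_uniq ?iota_uniq// => i j /eqP; rewrite eqr_nat => /eqP.
Qed.

End Multinomial.

Section VeroneseMap.
Variable R : realType.
Local Notation C := R[i].
Variables (n d : nat).

Definition Hcoef (j : 'I_('C(n + d - 1, d))) : C :=
  sqrtC ((d`!)%:R / (\prod_(i < n) (tnth (multi_index j) i)`!)%:R).

Lemma HmapE (z : 'cV[C]_n) j : Hmap d z j 0 = Hcoef j * \prod_i z i 0 ^+ tnth (multi_index j) i.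
Proof. by rewrite mxE. Qed.

Lemma Hcoef_gt0 j : 0 < Hcoef j.
Proof.
rewrite sqrtC_gt0 divr_gt0// ltr0n ?fact_gt0// prodn_gt0// => i.
exact: fact_gt0.
Qed.

Lemma dot_Hmap (z w : 'cV[C]_n) : dot (Hmap d z) (Hmap d w) = dot z w ^+ d.
Proof.
rewrite [in RHS]/dot multinomial big_enum_val/= (reindex (cast_ord (esym (card_multi_indices n d)))); last first.
  by exists (cast_ord (card_multi_indices n d)) => j _; rewrite ?cast_ordK ?cast_ordKV.
apply: eq_bigr => j _; rewrite !HmapE -/(multi_index j).
rewrite conjcM rmorph_prod/= [in LHS]mulrACA -big_split/=; congr (_ * _).
  rewrite [(Hcoef j)^*%C](_ : _ = Hcoef j) -?expr2 ?sqrtCK//.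
  by rewrite {1 2}(ge0_realc (ltW (Hcoef_gt0 j))) conjc_real.
by apply: eq_bigr => i _; rewrite rmorphXn/= exprMn.
Qed.

Lemma HmapZ (t : C) (z : 'cV[C]_n) : Hmap d (t *: z) = t ^+ d *: Hmap d z.
Proof.
apply/colP => j; rewrite [RHS]mxE !HmapE mulrCA; congr (_ * _).
under eq_bigr do rewrite mxE exprMn.
rewrite big_split prodrXr; congr (t ^+ _ * _).
have := enum_valP (cast_ord (esym (card_multi_indices n d)) j).
by rewrite -/(multi_index j) inE big_tuple => /eqP.
Qed.

(* The substitution [z i = x ^+ (d.+1 ^ i)] sends distinct monomials to distinct powers of [x]. *)
Lemma Hmap_span (a : 'cV[C]_('C(n + d - 1, d))) :
  (forall z, unit_ball z -> dot (Hmap d z) a = 0) -> a = 0.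
Proof.
move=> ha.
have {}ha z : dot (Hmap d z) a = 0.
  (* By homogeneity the test vectors may range over the whole space: this factor brings any [z] into
     the ball. *)
  pose t : R := (1 + nsq z)^-1.
  have z1 : 0 < 1 + nsq z by rewrite ltr_pwDl// nsq_ge0.
  have tN : t%:C != 0 :> C by rewrite realc_eq0 invr_eq0 gt_eqF.
  have /ha : unit_ball (t%:C *: z).
    rewrite unit_ballE nsq_realZ exprVn mulrC ltr_pdivrMr ?exprn_gt0// mul1r.
    by have := nsq_ge0 z; move: (nsq z) => x x0; nra.
  by rewrite HmapZ dotZl => /eqP; rewrite mulf_eq0 (negbTE (expf_neq0 _ tN)) => /eqP.
pose code (j : 'I_('C(n + d - 1, d))) := (\sum_(i < n) tnth (multi_index j) i * d.+1 ^ i)%N.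
have code_inj : injective code.
  move=> j k jk.
  suff /enum_val_inj/cast_ord_inj : multi_index j = multi_index k by [].
  apply: eq_from_tnth => i.
  (* [digits_inj] expects digits indexed by all natural numbers; positions from [n] on get the digit
     [0]. *)
  pose u (l : 'I_('C(n + d - 1, d))) (m : nat) : nat := if (insub m : option 'I_n) is Some i then tnth (multi_index l) i else 0%N.
  have uB l m : (u l m < d.+1)%N by rewrite /u; case: insub.
  have uE l (o : 'I_n) : u l o = tnth (multi_index l) o by rewrite /u valK.
  apply: val_inj; rewrite /= -!uE; apply: (@digits_inj d.+1 n) => //.
  by rewrite -[LHS]/(\sum_(i < n) _)%N; under eq_bigr do rewrite uE; under [RHS]eq_bigr do rewrite uE.
have P0 : \sum_j (Hcoef j * (a j 0)^*%C) *: 'X^(code j) = 0 :> {poly C}.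
  apply: poly_eq0_horner => x; rewrite horner_sum -[RHS](ha (\col_i x ^+ (d.+1 ^ i))).
  apply: eq_bigr => j _; rewrite hornerZ hornerXn HmapE mulrAC; congr (_ * _ * _).
  by rewrite -prodrXr; apply: eq_bigr => i _; rewrite mxE mulnC exprM.
apply/colP => j; have := congr1 (fun p : {poly C} => p`_(code j)) P0.
rewrite coef_sum (bigD1 j)//= big1 => [|k kj]; last first.
  by rewrite coefZ coefXn (inj_eq code_inj) eq_sym (negbTE kj) mulr0.
rewrite coefZ coefXn eqxx mulr1 addr0 coef0 mxE => /eqP.
by rewrite mulf_eq0 (gt_eqF (Hcoef_gt0 j)) conjc_eq0 => /eqP.
Qed.

End VeroneseMap.

(** * Unitary equivalence of maps with equal products *)

Section UnitaryFactor.
Variable R : realType.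
Local Notation C := R[i].

Definition adjmx m n (A : 'M[C]_(m, n)) : 'M[C]_(n, m) := map_mx (@conjc R) A^T.

Lemma dot_adjmx m n (A : 'M[C]_(m, n)) u v : dot (A *m u) v = dot u (adjmx A *m v).
Proof.
rewrite /dot; under eq_bigr do rewrite mxE mulr_suml.
rewrite exchange_big; apply: eq_bigr => k _.
rewrite mxE rmorph_sum mulr_sumr; apply: eq_bigr => j _.
by rewrite !mxE rmorphM/= conjcK mulrCA mulrA.
Qed.

Lemma isometry_unitary M N (eN : M = N) (T : 'M[C]_(N, M)) : adjmx T *m T = 1%:M ->
  exists2 U : 'M[C]_N, U \is unitarymx &
    forall v : 'cV[C]_M, T *m v = U *m castmx (eN, erefl 1%N) v.
Proof.
case: N / eN T => T TT; exists T; last by move=> v; rewrite castmx_id.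
by apply/unitarymxP; exact: mulmx1C.
Qed.

(** Pairing with the independent vectors [f (y j)] expresses [f z] linearly through [Hmap d z], as
    [T *m Hmap d z]. The equality of dimensions comes out of two factorizations of identities:
    [adjmx T *m T = 1%:M] gives one inequality, and [A = B *m adjmx T] with [A] invertible gives the
    other. *)
Lemma unitary_factor n N (f : 'cV[C]_n -> 'cV[C]_N) d (y : 'I_N -> 'cV[C]_n) :
  (forall z w, unit_ball z -> unit_ball w -> dot (f z) (f w) = dot z w ^+ d) ->
  (forall j, unit_ball (y j)) -> \det (value_mx f 0 y) != 0 ->
  exists (eN : 'C(n + d - 1, d) = N) (U : 'M[C]_N),
    U \is unitarymx /\ forall z, unit_ball z -> f z = U *m castmx (eN, erefl 1%N) (Hmap d z).
Proof.
move=> fdot yB dety.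
pose A : 'M[C]_N := \matrix_(j, k) (f (y j) k 0)^*%C.
pose B : 'M[C]_(N, 'C(n + d - 1, d)) := \matrix_(j, k) (Hmap d (y j) k 0)^*%C.
have AU : A \in unitmx.
  rewrite unitmxE unitfE (_ : A = map_mx (@conjc R) (value_mx f 0 y)).
    by rewrite det_map_mx conjc_eq0.
  by apply/matrixP => j k; rewrite !mxE subr0.
pose T := invmx A *m B.
have fT z : unit_ball z -> f z = T *m Hmap d z.
  move=> zB; rewrite -mulmxA; have -> : B *m Hmap d z = A *m f z; last by rewrite mulKmx.
  apply/colP => j; rewrite mxE [RHS]mxE.
  transitivity (dot (Hmap d z) (Hmap d (y j))).
    by apply: eq_bigr => k _; rewrite mxE mulrC.
  rewrite dot_Hmap -fdot//; apply: eq_bigr => k _; by rewrite [in RHS]mxE mulrC.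
have TT : adjmx T *m T = 1%:M.
  (* [Hmap_span] is used twice: first to see that [W] kills every [Hmap d w], then to see that each
     row of [W] is zero. *)
  apply/eqP; rewrite -subr_eq0; apply/eqP; set W := _ - _.
  have WH w : unit_ball w -> W *m Hmap d w = 0.
    move=> wB; apply: Hmap_span => z zB.
    by rewrite mulmxBl mul1mx -mulmxA dotBr -dot_adjmx -!fT// fdot// dot_Hmap subrr.
  apply/matrixP => i k; rewrite [RHS]mxE.
  pose a : 'cV[C]_('C(n + d - 1, d)) := \col_k (W i k)^*%C.
  have aE j : a j 0 = (W i j)^*%C by rewrite mxE.
  have : a = 0.
    apply: Hmap_span => w /WH/colP/(_ i); rewrite mxE [RHS]mxE => h; rewrite -[RHS]h.
    by apply: eq_bigr => j _; rewrite aE conjcK mulrC.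
  by move=> a0; apply: (can_inj (@conjcK R)); rewrite conjc0 -aE a0 mxE.
have AB : A = B *m adjmx T.
  apply/matrixP => j k; rewrite !mxE fT// mxE rmorph_sum; apply: eq_bigr => l _.
  by rewrite !mxE rmorphM mulrC.
have eN : 'C(n + d - 1, d) = N.
  apply/eqP; rewrite eqn_leq (mulmx1_min TT)/=.
  by apply: (@mulmx1_min _ _ _ B (adjmx T *m invmx A)); rewrite mulmxA -AB mulmxV.
have [U Uu UT] := isometry_unitary eN TT.
by exists eN, U; split=> // z zB; rewrite fT// UT.
Qed.

End UnitaryFactor.

Theorem theorem1p3 (R : realType) (n N : nat) (f : 'cV[R[i]]_n -> 'cV[R[i]]_N)
    (r rho : R) :
  (2 <= n)%N ->
  holomorphic_on unit_ball f ->
  proper_on unit_ball unit_ball f ->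
  hyperplane_rank unit_ball f (N - 1)%N ->
  0 < r < 1 -> 0 < rho < 1 ->
  f @` sphere r `<=` sphere rho ->
  exists (d : nat) (eN : 'C(n + d - 1, d) = N) (U : 'M[R[i]]_N),
    [/\ (1 <= d)%N, U \is unitarymx &
        forall z, unit_ball z -> f z = U *m castmx (eN, erefl 1%N) (Hmap d z)].
Proof.
move=> n2 hf pf [[H hypH affH] _] /andP[r0 r1] /andP[rho0 rho1] fr.
have pol z w := @ball_polarization R n N f r rho z w hf r0 (ltW rho0) fr.
have r21 : 0 < r ^+ 2 < 1 by rewrite exprn_gt0//= expr_lt1// ltW.
have rho21 : 0 < rho ^+ 2 < 1 by rewrite exprn_gt0//= expr_lt1// ltW.
have [x xr] : exists x : 'cV[R[i]]_n, nsq x = r ^+ 2.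
  pose i0 := Ordinal (ltn_trans (ltn0Sn 0) n2).
  exists (r%:C *: delta_mx i0 0); rewrite nsq_realZ /nsq /dot (bigD1 i0)//= big1.
    by rewrite !mxE !eqxx mul1r conjc1 addr0 mulr1.
  by move=> i ii0; rewrite !mxE (negbTE ii0) mul0r.
have fx : nsq (f x) = rho ^+ 2.
  apply/(sphereP (f x) (ltW rho0))/fr; exists x => //; exact/(sphereP x (ltW r0)).
(* [N - 1] is a truncated subtraction, so [N = 0] has to be excluded: [f] takes a value of norm
   [rho > 0] on the sphere of radius [r]. *)
have N0 : (0 < N)%N.
  rewrite lt0n; apply: contraTN (exprn_gt0 2 rho0) => /eqP N0.
  rewrite -fx /nsq /dot big1 ?ltxx// => i; exfalso.
  by have := ltn_ord i; rewrite [X in (_ < X)%N]N0.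
have [e [c [e1 He]]] := hyperplane_normal hypH.
have [b hb] := affine_spanning N0 affH.
have [|y Yy dety] := @spanning_points R N [set x - b | x in f @` (H `&` unit_ball)].
  by move=> V hV; apply: hb => u fu; apply: hV; exists u.
have /boolp.choice[z zP] : forall j, exists z, (H `&` unit_ball) z /\ f z - b = y j.
  by move=> j; have [_ [z zH <-] <-] := Yy j; exists z.
have zB j : unit_ball (z j) /\ dot (z j) e = c by have [[/He]] := zP j.
have detz : \det (value_mx f b z) != 0.
  rewrite (_ : value_mx f b z = \matrix_(j, k) y j k 0)//.
  by apply/matrixP => j k; rewrite !mxE -(zP j).2 !mxE.
have fe := functional_equation hf pf r0 r1 rho0 N0 pol e1 zB detz.
have [d [d1 rd hom]] : exists d : nat, [/\ (1 <= d)%N, (r ^+ 2) ^+ d = rho ^+ 2 &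
    forall t w, `|t| <= 1 -> unit_ball w -> f (t *: w) = t ^+ d *: f w].
  apply: (homogeneous r21 rho21 hf fe); exists x.
    by rewrite unit_ballE xr; case/andP: r21.
  apply: contraTN (exprn_gt0 2 rho0) => /eqP fx0.
  by rewrite -fx fx0 /nsq dot0l ltxx.
have r1C : `|r%:C : R[i]| < 1 by rewrite gtr0_norm ?ltcR// -[1]/(1%:C) ltcR.
(* Here only some independent family of values of [f] in the ball is wanted, at any height, so [S]
   is everything and [r] is just a point of the unit disc. *)
have [|c' [y' [_ _ y'B dety']]] := @generic_slice R n N f r rho hf r0 r1 rho0 pol e c b z r%:C setT N0 e1 zB detz r1C.
  by move=> q q0; have [u [_ ? ?]] := circle_cluster r0 q0; exists u.
have [eN [U [Uu fU]]] := unitary_factor (kernel hf r0 r1 d1 rd pol hom) (fun j => (y'B j).1) dety'.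
by exists d, eN, U.
Qed.
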